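(* Let $\mathcal{M}$ be a braided monoidal bicategory and let $A$ be a monoidal object (pseudomonoid) in $\mathcal{M}$ whose centre $\mathcal{Z}A$ exists, with universal centre piece $i:\mathcal{Z}A\to A$. Then $\mathcal{Z}A$ is a braided monoidal object of $\mathcal{M}$, and the morphism $i:\mathcal{Z}A\to A$ is strong monoidal.
   Context: Conventions. $\mathcal{M}$ is a braided monoidal bicategory with tensor product $\otimes$, unit $I$ and braiding (pseudonatural equivalence) $c_{X,Y}:X\otimes Y\xrightarrow{\sim}Y\otimes X$. By the coherence theorem for monoidal bicategories one takes $\mathcal{M}$ to be a braided Gray monoid, so that associativity and unit constraints of $\otimes$ are suppressed. The coherent invertible 2-cells relating $c_{X,Y\otimes Z}$ with $(1_Y\otimes c_{X,Z})\circ(c_{X,Y}\otimes 1_Z)$, and $c_{X\otimes Y,Z}$ with $(c_{X,Z}\otimes 1_Y)\circ(1_X\otimes c_{Y,Z})$, the pseudonaturality 2-cells $c_{f,g}$ of $c$, and the interchange 2-cells of $\otimes$ are written $\cong$. Monoidal objects. A monoidal object (pseudomonoid) in $\mathcal{M}$ is an object $A$ with morphisms $m:A\otimes A\to A$ and $j:I\to A$ and invertible 2-cells $\alpha:m\circ(m\otimes 1_A)\Rightarrow m\circ(1_A\otimes m)$, $m\circ(j\otimes 1_A)\cong 1_A$, $m\circ(1_A\otimes j)\cong 1_A$ satisfying the usual pentagon and triangle coherence axioms. A monoidal morphism $f:A\to A'$ is a morphism with 2-cells $m\circ(f\otimes f)\Rightarrow f\circ m$ and $j\Rightarrow f\circ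 j$ satisfying the usual associativity and unit coherence axioms; it is strong when both 2-cells are invertible. Braided monoidal objects. A braided monoidal object is a monoidal object $B$ with an invertible 2-cell $\beta:m\Rightarrow m\circ c_{B,B}$ (the braiding) satisfying the two usual braiding (hexagon) axioms: (1) the composite $m(m\otimes 1)\xRightarrow{\alpha}m(1\otimes m)\xRightarrow{\beta}m\,c_{B,B}(1\otimes m)\cong m(m\otimes 1)c_{B,B\otimes B}\xRightarrow{\alpha}m(1\otimes m)c_{B,B\otimes B}$ equals the composite $m(m\otimes 1)\xRightarrow{\beta\otimes 1}m(m\otimes 1)(c_{B,B}\otimes 1)\xRightarrow{\alpha}m(1\otimes m)(c_{B,B}\otimes 1)\xRightarrow{1\otimes\beta}m(1\otimes m)(1\otimes c_{B,B})(c_{B,B}\otimes 1)\cong m(1\otimes m)c_{B,B\otimes B}$; (2) the composite $m(1\otimes m)\xRightarrow{\alpha^{-1}}m(m\otimes 1)\xRightarrow{\beta}m\,c_{B,B}(m\otimes 1)\cong m(1\otimes m)c_{B\otimes B,B}\xRightarrow{\alpha^{-1}}m(m\otimes 1)c_{B\otimes B,B}$ equals the composite $m(1\otimes m)\xRightarrow{1\otimes\beta}m(1\otimes m)(1\otimes c_{B,B})\xRightarrow{\alpha^{-1}}m(m\otimes 1)(1\otimes c_{B,B})\xRightarrow{\beta\otimes 1}m(m\otimes 1)(c_{B,B}\otimes 1)(1\otimes c_{B,B})\cong m(m\otimes 1)c_{B\otimes B,B}$. Centre pieces. Let $A$ be a monoidal object. A centre piece is a morphism $u:U\to A$ equipped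 with an invertible 2-cell $\gamma:m\circ(u\otimes 1_A)\Rightarrow m\circ(1_A\otimes u)\circ c_{U,A}$ such that the composite $m(m\otimes 1)(u\otimes 1\otimes 1)\xRightarrow{\alpha}m(1\otimes m)(u\otimes 1\otimes 1)\cong m(u\otimes 1)(1_U\otimes m)\xRightarrow{\gamma}m(1\otimes u)c_{U,A}(1_U\otimes m)\cong m(1\otimes u)(m\otimes 1_U)c_{U,A\otimes A}\cong m(m\otimes 1)(1\otimes 1\otimes u)c_{U,A\otimes A}\xRightarrow{\alpha}m(1\otimes m)(1\otimes 1\otimes u)c_{U,A\otimes A}$ equals the composite $m(m\otimes 1)(u\otimes 1\otimes 1)\xRightarrow{\gamma\otimes 1}m(m\otimes 1)(1\otimes u\otimes 1)(c_{U,A}\otimes 1)\xRightarrow{\alpha}m(1\otimes m)(1\otimes u\otimes 1)(c_{U,A}\otimes 1)\xRightarrow{1\otimes\gamma}m(1\otimes m)(1\otimes 1\otimes u)(1\otimes c_{U,A})(c_{U,A}\otimes 1)\cong m(1\otimes m)(1\otimes 1\otimes u)c_{U,A\otimes A}$. A morphism of centre pieces $(u,\gamma)\to(v,\gamma)$, with $u,v:U\to A$, is a 2-cell $\sigma:u\Rightarrow v$ such that $\gamma\,(m\circ(\sigma\otimes 1_A))=(m\circ(1_A\otimes\sigma)\circ c_{U,A})\,\gamma$. This gives a category $\mathcal{CP}(U,A)$ and a pseudofunctor $\mathcal{CP}(-,A):\mathcal{M}^{\mathrm{op}}\to\mathrm{Cat}$; for $f:V\to U$, the functor $\mathcal{CP}(f,A)$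 sends $(u,\gamma)$ to $u\circ f$ with the 2-cell obtained by pasting $\gamma$ with the pseudonaturality isomorphism $c_{f,1_A}$. Centre. The centre of $A$ is a birepresenting object $\mathcal{Z}A$ for $\mathcal{CP}(-,A)$: there is a centre piece $i:\mathcal{Z}A\to A$ such that composition with $i$ induces, for every object $U$, an equivalence of categories $\mathcal{M}(U,\mathcal{Z}A)\simeq\mathcal{CP}(U,A)$. It is unique up to equivalence if it exists. *)

(* Defs.v *)
From Stdlib Require Import ssreflect ssrfun ProofIrrelevance.

Set Implicit Arguments.
Unset Strict Implicit.
Unset Printing Implicit Defensive.

(* A strict 2-category.  All 1-cells live in one type [Mor] and all 2-cells in
   one type [Cell], with explicit boundary maps, instead of hom-families indexed
   by objects.  In a Gray monoid X(YZ) = (XY)Z is only a propositional equality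
   of objects, and with hom-families every law would need transports along it.
   Compositions are total functions, but nothing is assumed about them outside
   composable arguments.
     g ∘ f   f first, then g
     s ∙ t   vertical composite, s first, then t
     f ◁ s, s ▷ f   whiskering of a 2-cell by a 1-cell *)
Record two_category := TwoCategory {
  Ob : Type;
  Mor : Type;
  Cell : Type;
  dom : Mor -> Ob;
  cod : Mor -> Ob;
  src : Cell -> Mor;
  tgt : Cell -> Mor;
  id1 : Ob -> Mor;
  comp : Mor -> Mor -> Mor;
  id2 : Mor -> Cell;
  vcomp : Cell -> Cell -> Cell;
  lwhisk : Mor -> Cell -> Cell;
  rwhisk : Cell -> Mor -> Cell;

  dom_tgt : forall s, dom (tgt s) = dom (src s);
  cod_tgt : forall s, cod (tgt s) = cod (src s);

  dom_id1 : forall x, dom (id1 x) = x;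
  cod_id1 : forall x, cod (id1 x) = x;
  dom_comp : forall g f, dom g = cod f -> dom (comp g f) = dom f;
  cod_comp : forall g f, dom g = cod f -> cod (comp g f) = cod g;
  comp_id1_l : forall f, comp (id1 (cod f)) f = f;
  comp_id1_r : forall f, comp f (id1 (dom f)) = f;
  compA : forall h g f, dom h = cod g -> dom g = cod f ->
    comp h (comp g f) = comp (comp h g) f;

  src_id2 : forall f, src (id2 f) = f;
  tgt_id2 : forall f, tgt (id2 f) = f;
  src_vcomp : forall s t, tgt s = src t -> src (vcomp s t) = src s;
  tgt_vcomp : forall s t, tgt s = src t -> tgt (vcomp s t) = tgt t;
  vcomp_id2_l : forall s, vcomp (id2 (src s)) s = s;
  vcomp_id2_r : forall s, vcomp s (id2 (tgt s)) = s;
  vcompA : forall s t r, tgt s = src t -> tgt t = src r ->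
    vcomp s (vcomp t r) = vcomp (vcomp s t) r;

  src_lwhisk : forall f s, dom f = cod (src s) ->
    src (lwhisk f s) = comp f (src s);
  tgt_lwhisk : forall f s, dom f = cod (src s) ->
    tgt (lwhisk f s) = comp f (tgt s);
  lwhisk_id2 : forall f g, dom f = cod g ->
    lwhisk f (id2 g) = id2 (comp f g);
  lwhisk_vcomp : forall f s t, dom f = cod (src s) -> tgt s = src t ->
    lwhisk f (vcomp s t) = vcomp (lwhisk f s) (lwhisk f t);
  lwhisk_id1 : forall s, lwhisk (id1 (cod (src s))) s = s;
  lwhisk_comp : forall g f s, dom g = cod f -> dom f = cod (src s) ->
    lwhisk (comp g f) s = lwhisk g (lwhisk f s);

  src_rwhisk : forall s f, dom (src s) = cod f ->
    src (rwhisk s f) = comp (src s) f;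
  tgt_rwhisk : forall s f, dom (src s) = cod f ->
    tgt (rwhisk s f) = comp (tgt s) f;
  rwhisk_id2 : forall g f, dom g = cod f ->
    rwhisk (id2 g) f = id2 (comp g f);
  rwhisk_vcomp : forall s t f, dom (src s) = cod f -> tgt s = src t ->
    rwhisk (vcomp s t) f = vcomp (rwhisk s f) (rwhisk t f);
  rwhisk_id1 : forall s, rwhisk s (id1 (dom (src s))) = s;
  rwhisk_comp : forall s g f, dom (src s) = cod g -> dom g = cod f ->
    rwhisk s (comp g f) = rwhisk (rwhisk s g) f;

  lrwhisk : forall g s f, dom g = cod (src s) -> dom (src s) = cod f ->
    rwhisk (lwhisk g s) f = lwhisk g (rwhisk s f);
  whisk_exchange : forall s t, dom (src s) = cod (src t) ->
    vcomp (rwhisk s (src t)) (lwhisk (tgt s) t)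
    = vcomp (lwhisk (src s) t) (rwhisk s (tgt t))
}.

Arguments dom {_} _.
Arguments cod {_} _.
Arguments src {_} _.
Arguments tgt {_} _.
Arguments id1 {_} _.
Arguments comp {_} _ _.
Arguments id2 {_} _.
Arguments vcomp {_} _ _.
Arguments lwhisk {_} _ _.
Arguments rwhisk {_} _ _.

Declare Scope gray_scope.
Delimit Scope gray_scope with gray.
Open Scope gray_scope.

Notation "g ∘ f" := (comp g f) (at level 40, left associativity) : gray_scope.
Notation "f ◁ s" := (lwhisk f s) (at level 45, right associativity) : gray_scope.
Notation "s ▷ f" := (rwhisk s f) (at level 44, left associativity) : gray_scope.
Notation "s ∙ t" := (vcomp s t) (at level 50, left associativity) : gray_scope.

Record hom (C : two_category) (x y : Ob C) := Hom {
  hom_mor :> Mor C;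
  hom_dom : dom hom_mor = x;
  hom_cod : cod hom_mor = y
}.

Record cell (C : two_category) (f g : Mor C) := MkCell {
  cell_val :> Cell C;
  cell_src : src cell_val = f;
  cell_tgt : tgt cell_val = g
}.

Record iso2 (C : two_category) (f g : Mor C) := Iso2 {
  iso_fwd :> cell f g;
  iso_bwd : cell g f;
  iso_fwdK : iso_fwd ∙ iso_bwd = id2 f;
  iso_bwdK : iso_bwd ∙ iso_fwd = id2 g
}.

Definition iso_inv (C : two_category) (f g : Mor C) (s : iso2 f g) : iso2 g f :=
  Iso2 (iso_bwdK s) (iso_fwdK s).

Notation "s ^-1" := (iso_inv s) (at level 3, left associativity, format "s ^-1")
  : gray_scope.

Definition invertible (C : two_category) (f g : Mor C) (s : cell f g) : Prop :=
  exists t : cell g f, s ∙ t = id2 f /\ t ∙ s = id2 g.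

Definition equivalence1 (C : two_category) (x y : Ob C) (f : hom x y) : Prop :=
  exists g : hom y x,
    inhabited (iso2 (g ∘ f) (id1 x)) /\ inhabited (iso2 (f ∘ g) (id1 y)).

(* A Gray monoid: the tensor product is given by the 2-functors X ⊗ - and
   - ⊗ X, written X ⋉ f, f ⋊ X on 1-cells and X ⋉₂ s, s ⋊₂ X on 2-cells,
   together with the invertible interchange 2-cells
     interchange f g : (f ⊗ 1)(1 ⊗ g) ⇒ (1 ⊗ g)(f ⊗ 1). *)
Record gray_monoid := GrayMonoid {
  gm_2cat :> two_category;
  unitO : Ob gm_2cat;
  tensO : Ob gm_2cat -> Ob gm_2cat -> Ob gm_2cat;
  ltens : Ob gm_2cat -> Mor gm_2cat -> Mor gm_2cat;
  rtens : Mor gm_2cat -> Ob gm_2cat -> Mor gm_2cat;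
  ltens2 : Ob gm_2cat -> Cell gm_2cat -> Cell gm_2cat;
  rtens2 : Cell gm_2cat -> Ob gm_2cat -> Cell gm_2cat;
  interchange : forall f g : Mor gm_2cat,
    iso2 (rtens f (cod g) ∘ ltens (dom f) g) (ltens (cod f) g ∘ rtens f (dom g));

  dom_ltens : forall X f, dom (ltens X f) = tensO X (dom f);
  cod_ltens : forall X f, cod (ltens X f) = tensO X (cod f);
  ltens_id1 : forall X Y, ltens X (id1 Y) = id1 (tensO X Y);
  ltens_comp : forall X g f, dom g = cod f ->
    ltens X (g ∘ f) = ltens X g ∘ ltens X f;
  src_ltens2 : forall X s, src (ltens2 X s) = ltens X (src s);
  tgt_ltens2 : forall X s, tgt (ltens2 X s) = ltens X (tgt s);
  ltens2_id2 : forall X f, ltens2 X (id2 f) = id2 (ltens X f);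
  ltens2_vcomp : forall X s t, tgt s = src t ->
    ltens2 X (s ∙ t) = ltens2 X s ∙ ltens2 X t;
  ltens2_lwhisk : forall X f s, dom f = cod (src s) ->
    ltens2 X (f ◁ s) = ltens X f ◁ ltens2 X s;
  ltens2_rwhisk : forall X s f, dom (src s) = cod f ->
    ltens2 X (s ▷ f) = ltens2 X s ▷ ltens X f;

  dom_rtens : forall f X, dom (rtens f X) = tensO (dom f) X;
  cod_rtens : forall f X, cod (rtens f X) = tensO (cod f) X;
  rtens_id1 : forall Y X, rtens (id1 Y) X = id1 (tensO Y X);
  rtens_comp : forall g f X, dom g = cod f ->
    rtens (g ∘ f) X = rtens g X ∘ rtens f X;
  src_rtens2 : forall s X, src (rtens2 s X) = rtens (src s) X;
  tgt_rtens2 : forall s X, tgt (rtens2 s X) = rtens (tgt s) X;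
  rtens2_id2 : forall f X, rtens2 (id2 f) X = id2 (rtens f X);
  rtens2_vcomp : forall s t X, tgt s = src t ->
    rtens2 (s ∙ t) X = rtens2 s X ∙ rtens2 t X;
  rtens2_lwhisk : forall f s X, dom f = cod (src s) ->
    rtens2 (f ◁ s) X = rtens f X ◁ rtens2 s X;
  rtens2_rwhisk : forall s f X, dom (src s) = cod f ->
    rtens2 (s ▷ f) X = rtens2 s X ▷ rtens f X;

  tensO1l : forall X, tensO unitO X = X;
  tensO1r : forall X, tensO X unitO = X;
  tensOA : forall X Y Z, tensO X (tensO Y Z) = tensO (tensO X Y) Z;
  ltens_unit : forall f, ltens unitO f = f;
  rtens_unit : forall f, rtens f unitO = f;
  ltens_tensO : forall X Y f, ltens (tensO X Y) f = ltens X (ltens Y f);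
  rtens_tensO : forall f X Y, rtens f (tensO X Y) = rtens (rtens f X) Y;
  lrtens : forall X f Y, rtens (ltens X f) Y = ltens X (rtens f Y);
  ltens2_unit : forall s, ltens2 unitO s = s;
  rtens2_unit : forall s, rtens2 s unitO = s;
  ltens2_tensO : forall X Y s, ltens2 (tensO X Y) s = ltens2 X (ltens2 Y s);
  rtens2_tensO : forall s X Y, rtens2 s (tensO X Y) = rtens2 (rtens2 s X) Y;
  lrtens2 : forall X s Y, rtens2 (ltens2 X s) Y = ltens2 X (rtens2 s Y);

  interchange_ltens : forall X f g,
    ltens2 X (interchange f g) = interchange (ltens X f) g;
  interchange_mid : forall f X g,
    interchange (rtens f X) g = interchange f (ltens X g) :> Cell gm_2cat;
  interchange_rtens : forall f g X,
    rtens2 (interchange f g) X = interchange f (rtens g X);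
  interchange_id1_l : forall X g, interchange (id1 X) g = id2 (ltens X g) :> Cell gm_2cat;
  interchange_id1_r : forall f X, interchange f (id1 X) = id2 (rtens f X) :> Cell gm_2cat;
  interchange_comp_l : forall f' f g, dom f' = cod f ->
    interchange (f' ∘ f) g
    = (rtens f' (cod g) ◁ interchange f g) ∙ (interchange f' g ▷ rtens f (dom g))
    :> Cell gm_2cat;
  interchange_comp_r : forall f g' g, dom g' = cod g ->
    interchange f (g' ∘ g)
    = (interchange f g' ▷ ltens (dom f) g) ∙ (ltens (cod f) g' ◁ interchange f g)
    :> Cell gm_2cat;
  interchange_nat_l : forall s g,
    (rtens2 s (cod g) ▷ ltens (dom (src s)) g) ∙ interchange (tgt s) g
    = interchange (src s) g ∙ (ltens (cod (src s)) g ◁ rtens2 s (dom g));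
  interchange_nat_r : forall f t,
    (rtens f (cod (src t)) ◁ ltens2 (dom f) t) ∙ interchange f (tgt t)
    = interchange f (src t) ∙ (ltens2 (cod f) t ▷ rtens f (dom (src t)))
}.

Arguments unitO {_}.
Arguments tensO {_} _ _.
Arguments ltens {_} _ _.
Arguments rtens {_} _ _.
Arguments ltens2 {_} _ _.
Arguments rtens2 {_} _ _.
Arguments interchange {_} _ _.

Notation "X ⊗ Y" := (tensO X Y) (at level 32, left associativity) : gray_scope.
Notation "X ⋉ f" := (ltens X f) (at level 35, right associativity) : gray_scope.
Notation "f ⋊ X" := (rtens f X) (at level 34, left associativity) : gray_scope.
Notation "X ⋉₂ s" := (ltens2 X s) (at level 35, right associativity) : gray_scope.
Notation "s ⋊₂ X" := (rtens2 s X) (at level 34, left associativity) : gray_scope.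

(* The convention f ⊗ g = (f ⊗ 1)(1 ⊗ g) for tensor products of 1-cells. *)
Definition tens1 (M : gray_monoid) (f g : Mor M) : Mor M :=
  (f ⋊ cod g) ∘ (dom f ⋉ g).

Notation "f ⊗₁ g" := (tens1 f g) (at level 32, left associativity) : gray_scope.

(* A braided Gray monoid.  The pseudonaturality 2-cells of c are given in each
   variable separately, brl f Y = c_{f,1_Y} and brr X g = c_{1_X,g}; the general
   c_{f,g} is their pasting, independent of the order by [br_interchange].
   hexR and hexS are invertible modifications, and the last four axioms are the
   coherence conditions of a braided monoidal bicategory when the associativity
   constraints are identities.  As in that definition there are no axioms on
   c_{X,I} and c_{I,X}. *)
Record braided_gray_monoid := BraidedGrayMonoid {
  bgm_gray :> gray_monoid;

  br : forall X Y : Ob bgm_gray, hom (X ⊗ Y) (Y ⊗ X);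
  br_equiv : forall X Y, equivalence1 (br X Y);

  brl : forall (f : Mor bgm_gray) (Y : Ob bgm_gray),
    iso2 (br (cod f) Y ∘ (f ⋊ Y)) ((Y ⋉ f) ∘ br (dom f) Y);
  brl_id1 : forall X Y, brl (id1 X) Y = id2 (br X Y) :> Cell bgm_gray;
  brl_comp : forall f' f Y, dom f' = cod f ->
    brl (f' ∘ f) Y = (brl f' Y ▷ (f ⋊ Y)) ∙ ((Y ⋉ f') ◁ brl f Y) :> Cell bgm_gray;
  brl_nat : forall (s : Cell bgm_gray) Y,
    (br (cod (src s)) Y ◁ (s ⋊₂ Y)) ∙ brl (tgt s) Y
    = brl (src s) Y ∙ ((Y ⋉₂ s) ▷ br (dom (src s)) Y);

  brr : forall (X : Ob bgm_gray) (g : Mor bgm_gray),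
    iso2 (br X (cod g) ∘ (X ⋉ g)) ((g ⋊ X) ∘ br X (dom g));
  brr_id1 : forall X Y, brr X (id1 Y) = id2 (br X Y) :> Cell bgm_gray;
  brr_comp : forall X g' g, dom g' = cod g ->
    brr X (g' ∘ g) = (brr X g' ▷ (X ⋉ g)) ∙ ((g' ⋊ X) ◁ brr X g) :> Cell bgm_gray;
  brr_nat : forall X (s : Cell bgm_gray),
    (br X (cod (src s)) ◁ (X ⋉₂ s)) ∙ brr X (tgt s)
    = brr X (src s) ∙ ((s ⋊₂ X) ▷ br X (dom (src s)));

  br_interchange : forall f g : Mor bgm_gray,
    (brl f (cod g) ▷ (dom f ⋉ g)) ∙ ((cod g ⋉ f) ◁ brr (dom f) g)
    = (br (cod f) (cod g) ◁ interchange f g)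
      ∙ (brr (cod f) g ▷ (f ⋊ dom g))
      ∙ ((g ⋊ cod f) ◁ brl f (dom g))
      ∙ (interchange g f ▷ br (dom f) (dom g));

  hexR : forall X Y Z : Ob bgm_gray,
    iso2 (br X (Y ⊗ Z)) ((Y ⋉ br X Z) ∘ (br X Y ⋊ Z));
  hexR_mod1 : forall (f : Mor bgm_gray) Y Z,
    brl f (Y ⊗ Z) ∙ (((Y ⊗ Z) ⋉ f) ◁ hexR (dom f) Y Z)
    = (hexR (cod f) Y Z ▷ (f ⋊ (Y ⊗ Z)))
      ∙ ((Y ⋉ br (cod f) Z) ◁ (brl f Y ⋊₂ Z))
      ∙ ((Y ⋉₂ brl f Z) ▷ (br (dom f) Y ⋊ Z));
  hexR_mod2 : forall X (g : Mor bgm_gray) Z,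
    brr X (g ⋊ Z) ∙ ((g ⋊ (Z ⊗ X)) ◁ hexR X (dom g) Z)
    = (hexR X (cod g) Z ▷ (X ⋉ (g ⋊ Z)))
      ∙ ((cod g ⋉ br X Z) ◁ (brr X g ⋊₂ Z))
      ∙ ((interchange g (br X Z))^-1 ▷ (br X (dom g) ⋊ Z));
  hexR_mod3 : forall X Y (h : Mor bgm_gray),
    brr X (Y ⋉ h) ∙ ((Y ⋉ (h ⋊ X)) ◁ hexR X Y (dom h))
    = (hexR X Y (cod h) ▷ ((X ⊗ Y) ⋉ h))
      ∙ ((Y ⋉ br X (cod h)) ◁ interchange (br X Y) h)
      ∙ ((Y ⋉₂ brr X h) ▷ (br X Y ⋊ dom h));

  hexS : forall X Y Z : Ob bgm_gray,
    iso2 (br (X ⊗ Y) Z) ((br X Z ⋊ Y) ∘ (X ⋉ br Y Z));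
  hexS_mod1 : forall (f : Mor bgm_gray) Y Z,
    brl (f ⋊ Y) Z ∙ ((Z ⋉ (f ⋊ Y)) ◁ hexS (dom f) Y Z)
    = (hexS (cod f) Y Z ▷ (f ⋊ (Y ⊗ Z)))
      ∙ ((br (cod f) Z ⋊ Y) ◁ (interchange f (br Y Z))^-1)
      ∙ ((brl f Z ⋊₂ Y) ▷ (dom f ⋉ br Y Z));
  hexS_mod2 : forall X (g : Mor bgm_gray) Z,
    brl (X ⋉ g) Z ∙ (((Z ⊗ X) ⋉ g) ◁ hexS X (dom g) Z)
    = (hexS X (cod g) Z ▷ (X ⋉ (g ⋊ Z)))
      ∙ ((br X Z ⋊ cod g) ◁ (X ⋉₂ brl g Z))
      ∙ (interchange (br X Z) g ▷ (X ⋉ br (dom g) Z));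
  hexS_mod3 : forall X Y (h : Mor bgm_gray),
    brr (X ⊗ Y) h ∙ ((h ⋊ (X ⊗ Y)) ◁ hexS X Y (dom h))
    = (hexS X Y (cod h) ▷ ((X ⊗ Y) ⋉ h))
      ∙ ((br X (cod h) ⋊ Y) ◁ (X ⋉₂ brr Y h))
      ∙ ((brr X h ⋊₂ Y) ▷ (X ⋉ br Y (dom h)));

  br_coh1 : forall X Y Z W,
    hexR X (Y ⊗ Z) W ∙ (((Y ⊗ Z) ⋉ br X W) ◁ (hexR X Y Z ⋊₂ W))
    = hexR X Y (Z ⊗ W) ∙ ((Y ⋉₂ hexR X Z W) ▷ (br X Y ⋊ (Z ⊗ W)));
  br_coh2 : forall X Y Z W,
    hexS (X ⊗ Y) Z W ∙ ((hexS X Y W ⋊₂ Z) ▷ ((X ⊗ Y) ⋉ br Z W))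
    = hexS X (Y ⊗ Z) W ∙ ((br X W ⋊ (Y ⊗ Z)) ◁ (X ⋉₂ hexS Y Z W));
  br_coh3 : forall X Y Z W,
    hexR (X ⊗ Y) Z W
      ∙ ((Z ⋉ br (X ⊗ Y) W) ◁ (hexS X Y Z ⋊₂ W))
      ∙ ((Z ⋉₂ hexS X Y W) ▷ ((br X Z ⋊ (Y ⊗ W)) ∘ (X ⋉ (br Y Z ⋊ W))))
    = hexS X Y (Z ⊗ W)
      ∙ ((br X (Z ⊗ W) ⋊ Y) ◁ (X ⋉₂ hexR Y Z W))
      ∙ ((hexR X Z W ⋊₂ Y) ▷ (((X ⊗ Z) ⋉ br Y W) ∘ (X ⋉ (br Y Z ⋊ W))))
      ∙ ((Z ⋉ (br X W ⋊ Y))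
          ◁ (interchange (br X Z) (br Y W) ▷ (X ⋉ (br Y Z ⋊ W))));
  br_coh4 : forall X Y Z,
    ((br Y Z ⋊ X) ◁ (hexR X Y Z)^-1)
      ∙ (brr X (br Y Z))^-1
      ∙ (hexR X Z Y ▷ (X ⋉ br Y Z))
    = ((hexS Y X Z)^-1 ▷ (br X Y ⋊ Z))
      ∙ brl (br X Y) Z
      ∙ ((Z ⋉ br X Y) ◁ hexS X Y Z)
}.

Arguments br {_} _ _.
Arguments brl {_} _ _.
Arguments brr {_} _ _.
Arguments hexR {_} _ _ _.
Arguments hexS {_} _ _ _.

Record pseudomonoid (M : gray_monoid) (A : Ob M) := Pseudomonoid {
  pm_mul : hom (A ⊗ A) A;
  pm_unit : hom unitO A;
  pm_assoc : iso2 (pm_mul ∘ (pm_mul ⋊ A)) (pm_mul ∘ (A ⋉ pm_mul));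
  pm_lunit : iso2 (pm_mul ∘ (pm_unit ⋊ A)) (id1 A);
  pm_runit : iso2 (pm_mul ∘ (A ⋉ pm_unit)) (id1 A);
  pm_pentagon :
    (pm_assoc ▷ (pm_mul ⋊ (A ⊗ A)))
      ∙ (pm_mul ◁ (interchange pm_mul pm_mul)^-1)
      ∙ (pm_assoc ▷ ((A ⊗ A) ⋉ pm_mul))
    = (pm_mul ◁ (pm_assoc ⋊₂ A))
      ∙ (pm_assoc ▷ (A ⋉ (pm_mul ⋊ A)))
      ∙ (pm_mul ◁ (A ⋉₂ pm_assoc));
  pm_triangle :
    (pm_assoc ▷ (A ⋉ (pm_unit ⋊ A))) ∙ (pm_mul ◁ (A ⋉₂ pm_lunit))
    = pm_mul ◁ (pm_runit ⋊₂ A)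
}.

Record monoidal_morphism (M : gray_monoid) (A A' : Ob M)
    (P : pseudomonoid A) (P' : pseudomonoid A') (f : hom A A') :=
  MonoidalMorphism {
  mm_mul : cell (pm_mul P' ∘ (f ⊗₁ f)) (f ∘ pm_mul P);
  mm_unit : cell (pm_unit P') (f ∘ pm_unit P);
  mm_assoc :
    (pm_mul P' ◁ ((mm_mul ⋊₂ A') ▷ ((A ⊗ A) ⋉ f)))
      ∙ ((pm_mul P' ∘ (f ⋊ A')) ◁ interchange (pm_mul P) f)
      ∙ (mm_mul ▷ (pm_mul P ⋊ A))
      ∙ (f ◁ pm_assoc P)
    = (pm_assoc P' ▷ ((f ⋊ (A' ⊗ A')) ∘ (A ⋉ (f ⊗₁ f))))
      ∙ (pm_mul P' ◁ ((interchange f (pm_mul P'))^-1 ▷ (A ⋉ (f ⊗₁ f))))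
      ∙ ((pm_mul P' ∘ (f ⋊ A')) ◁ (A ⋉₂ mm_mul))
      ∙ (mm_mul ▷ (A ⋉ pm_mul P));
  mm_lunit :
    (pm_mul P' ◁ ((mm_unit ⋊₂ A') ▷ f))
      ∙ ((pm_mul P' ∘ (f ⋊ A')) ◁ interchange (pm_unit P) f)
      ∙ (mm_mul ▷ (pm_unit P ⋊ A))
      ∙ (f ◁ pm_lunit P)
    = pm_lunit P' ▷ f;
  mm_runit :
    (pm_mul P' ◁ (interchange f (pm_unit P'))^-1)
      ∙ ((pm_mul P' ∘ (f ⋊ A')) ◁ (A ⋉₂ mm_unit))
      ∙ (mm_mul ▷ (A ⋉ pm_unit P))
      ∙ (f ◁ pm_runit P)
    = pm_runit P' ▷ f
}.

Definition strong_monoidal (M : gray_monoid) (A A' : Ob M)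
    (P : pseudomonoid A) (P' : pseudomonoid A') (f : hom A A')
    (F : monoidal_morphism P P' f) : Prop :=
  invertible (mm_mul F) /\ invertible (mm_unit F).

Record braiding (M : braided_gray_monoid) (B : Ob M) (P : pseudomonoid B) :=
  Braiding {
  bd_iso : iso2 (pm_mul P) (pm_mul P ∘ br B B);
  bd_hexagon1 :
    pm_assoc P
      ∙ (bd_iso ▷ (B ⋉ pm_mul P))
      ∙ (pm_mul P ◁ brr B (pm_mul P))
      ∙ (pm_assoc P ▷ br B (B ⊗ B))
    = (pm_mul P ◁ (bd_iso ⋊₂ B))
      ∙ (pm_assoc P ▷ (br B B ⋊ B))
      ∙ (pm_mul P ◁ ((B ⋉₂ bd_iso) ▷ (br B B ⋊ B)))
      ∙ ((pm_mul P ∘ (B ⋉ pm_mul P)) ◁ (hexR B B B)^-1);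
  bd_hexagon2 :
    (pm_assoc P)^-1
      ∙ (bd_iso ▷ (pm_mul P ⋊ B))
      ∙ (pm_mul P ◁ brl (pm_mul P) B)
      ∙ ((pm_assoc P)^-1 ▷ br (B ⊗ B) B)
    = (pm_mul P ◁ (B ⋉₂ bd_iso))
      ∙ ((pm_assoc P)^-1 ▷ (B ⋉ br B B))
      ∙ (pm_mul P ◁ ((bd_iso ⋊₂ B) ▷ (B ⋉ br B B)))
      ∙ ((pm_mul P ∘ (pm_mul P ⋊ B)) ◁ (hexS B B B)^-1)
}.

Record centre_piece (M : braided_gray_monoid) (A : Ob M) (P : pseudomonoid A)
    (U : Ob M) := CentrePiece {
  cp_mor :> hom U A;
  cp_iso : iso2 (pm_mul P ∘ (cp_mor ⋊ A)) (pm_mul P ∘ (A ⋉ cp_mor) ∘ br U A);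
  cp_axiom :
    (pm_assoc P ▷ (cp_mor ⋊ (A ⊗ A)))
      ∙ (pm_mul P ◁ (interchange cp_mor (pm_mul P))^-1)
      ∙ (cp_iso ▷ (U ⋉ pm_mul P))
      ∙ ((pm_mul P ∘ (A ⋉ cp_mor)) ◁ brr U (pm_mul P))
      ∙ (pm_mul P ◁ ((interchange (pm_mul P) cp_mor)^-1 ▷ br U (A ⊗ A)))
      ∙ (pm_assoc P ▷ (((A ⊗ A) ⋉ cp_mor) ∘ br U (A ⊗ A)))
    = (pm_mul P ◁ (cp_iso ⋊₂ A))
      ∙ (pm_assoc P ▷ ((A ⋉ (cp_mor ⋊ A)) ∘ (br U A ⋊ A)))
      ∙ (pm_mul P ◁ ((A ⋉₂ cp_iso) ▷ (br U A ⋊ A)))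
      ∙ ((pm_mul P ∘ (A ⋉ pm_mul P) ∘ ((A ⊗ A) ⋉ cp_mor)) ◁ (hexR U A A)^-1)
}.

Record centre_piece_map (M : braided_gray_monoid) (A : Ob M) (P : pseudomonoid A)
    (U : Ob M) (u v : centre_piece P U) := CentrePieceMap {
  cpm_cell :> cell u v;
  cpm_axiom :
    (pm_mul P ◁ (cpm_cell ⋊₂ A)) ∙ cp_iso v
    = cp_iso u ∙ ((pm_mul P ◁ (A ⋉₂ cpm_cell)) ▷ br U A)
}.

(* [bd] proves equations between objects and 1-cells by computing boundaries and
   normalising 1-cells.  [nf] distributes tensors and whiskerings over vertical
   composites, merges nested whiskerings and reassociates to the right; the
   composability conditions are discharged by [bd]. *)
Lemma comp_id1_l' (C : two_category) (x : Ob C) f : cod f = x -> id1 x ∘ f = f.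
Proof. move=> <-; exact: comp_id1_l. Qed.

Lemma comp_id1_r' (C : two_category) (x : Ob C) f : dom f = x -> f ∘ id1 x = f.
Proof. move=> <-; exact: comp_id1_r. Qed.

Ltac bd_step :=
  match goal with
  | |- context [dom (comp ?g ?f)] => rewrite -> (@dom_comp _ g f)
  | |- context [cod (comp ?g ?f)] => rewrite -> (@cod_comp _ g f)
  | |- context [dom (hom_mor ?f)] => rewrite -> (hom_dom f)
  | |- context [cod (hom_mor ?f)] => rewrite -> (hom_cod f)
  | |- context [dom (id1 ?x)] => rewrite -> (dom_id1 x)
  | |- context [cod (id1 ?x)] => rewrite -> (cod_id1 x)
  | |- context [dom (ltens ?x ?f)] => rewrite -> (dom_ltens x f)
  | |- context [cod (ltens ?x ?f)] => rewrite -> (cod_ltens x f)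
  | |- context [dom (rtens ?f ?x)] => rewrite -> (dom_rtens f x)
  | |- context [cod (rtens ?f ?x)] => rewrite -> (cod_rtens f x)
  | |- context [tensO (tensO ?x ?y) ?z] => rewrite <- (tensOA x y z)
  | |- context [tensO unitO ?x] => rewrite -> (tensO1l x)
  | |- context [tensO ?x unitO] => rewrite -> (tensO1r x)
  | |- context [dom (tgt ?s)] => rewrite -> (dom_tgt s)
  | |- context [cod (tgt ?s)] => rewrite -> (cod_tgt s)
  | |- context [src (cell_val ?s)] => rewrite -> (cell_src s)
  | |- context [tgt (cell_val ?s)] => rewrite -> (cell_tgt s)
  | |- context [src (id2 ?s)] => rewrite -> (src_id2 s)
  | |- context [tgt (id2 ?s)] => rewrite -> (tgt_id2 s)
  | |- context [src (ltens2 ?x ?s)] => rewrite -> (src_ltens2 x s)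
  | |- context [tgt (ltens2 ?x ?s)] => rewrite -> (tgt_ltens2 x s)
  | |- context [src (rtens2 ?s ?x)] => rewrite -> (src_rtens2 s x)
  | |- context [tgt (rtens2 ?s ?x)] => rewrite -> (tgt_rtens2 s x)
  | |- context [ltens ?x (id1 ?y)] => rewrite -> (ltens_id1 x y)
  | |- context [rtens (id1 ?y) ?x] => rewrite -> (rtens_id1 y x)
  | |- context [ltens unitO ?f] => rewrite -> (ltens_unit f)
  | |- context [rtens ?f unitO] => rewrite -> (rtens_unit f)
  | |- context [rtens (ltens ?x ?f) ?y] => rewrite -> (lrtens x f y)
  | |- context [ltens ?x (ltens ?y ?f)] => rewrite <- (ltens_tensO x y f)
  | |- context [rtens (rtens ?f ?x) ?y] => rewrite <- (rtens_tensO f x y)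
  | |- context [src (vcomp ?s ?t)] => rewrite -> (@src_vcomp _ s t)
  | |- context [tgt (vcomp ?s ?t)] => rewrite -> (@tgt_vcomp _ s t)
  | |- context [src (lwhisk ?f ?s)] => rewrite -> (@src_lwhisk _ f s)
  | |- context [tgt (lwhisk ?f ?s)] => rewrite -> (@tgt_lwhisk _ f s)
  | |- context [src (rwhisk ?s ?f)] => rewrite -> (@src_rwhisk _ s f)
  | |- context [tgt (rwhisk ?s ?f)] => rewrite -> (@tgt_rwhisk _ s f)
  | H : src ?s = _ |- context [src ?s] => rewrite -> H
  | H : tgt ?s = _ |- context [tgt ?s] => rewrite -> H
  | |- context [ltens ?X (comp ?g ?f)] => rewrite -> (@ltens_comp _ X g f)
  | |- context [rtens (comp ?g ?f) ?X] => rewrite -> (@rtens_comp _ g f X)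
  | |- context [comp (comp ?h ?g) ?f] => rewrite <- (@compA _ h g f)
  | |- context [comp (id1 ?x) ?f] => rewrite -> (@comp_id1_l' _ x f)
  | |- context [comp ?f (id1 ?x)] => rewrite -> (@comp_id1_r' _ f x)
  end.
Ltac bd_norm := repeat (bd_step; [ | solve [done | bd_norm; (done || congruence)] ..]).
Ltac bd := bd_norm; (done || congruence).

Ltac nf_step :=
  match goal with
  | |- context [ltens2 ?X (vcomp ?s ?t)] => rewrite -> (@ltens2_vcomp _ X s t)
  | |- context [rtens2 (vcomp ?s ?t) ?X] => rewrite -> (@rtens2_vcomp _ s t X)
  | |- context [ltens2 ?X (lwhisk ?f ?s)] => rewrite -> (@ltens2_lwhisk _ X f s)
  | |- context [rtens2 (lwhisk ?f ?s) ?X] => rewrite -> (@rtens2_lwhisk _ f s X)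
  | |- context [ltens2 ?X (rwhisk ?s ?f)] => rewrite -> (@ltens2_rwhisk _ X s f)
  | |- context [rtens2 (rwhisk ?s ?f) ?X] => rewrite -> (@rtens2_rwhisk _ s f X)
  | |- context [lwhisk ?f (vcomp ?s ?t)] => rewrite -> (@lwhisk_vcomp _ f s t)
  | |- context [rwhisk (vcomp ?s ?t) ?f] => rewrite -> (@rwhisk_vcomp _ s t f)
  | |- context [rwhisk (lwhisk ?g ?s) ?f] => rewrite -> (@lrwhisk _ g s f)
  | |- context [lwhisk ?g (lwhisk ?f ?s)] => rewrite <- (@lwhisk_comp _ g f s)
  | |- context [rwhisk (rwhisk ?s ?g) ?f] => rewrite <- (@rwhisk_comp _ s g f)
  | |- context [vcomp (vcomp ?s ?t) ?r] => rewrite <- (@vcompA _ s t r)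
  end.
Ltac nf := repeat (nf_step; [ | solve [bd] ..]); bd_norm.

Section TwoCells.
Variable C : two_category.
Implicit Types (f g h k : Mor C) (s t : Cell C).

Lemma cell_inj f g (s t : cell f g) : s = t :> Cell C -> s = t.
Proof.
case: s t => [s sf sg] [t tf tg] /= E; case: t / E tf tg => tf tg.
by rewrite (proof_irrelevance _ sf tf) (proof_irrelevance _ sg tg).
Qed.

Lemma cell_cod f g (s : cell f g) : cod g = cod f.
Proof. by have := cod_tgt s; rewrite (cell_src s) (cell_tgt s). Qed.

Lemma cell_dom f g (s : cell f g) : dom g = dom f.
Proof. by have := dom_tgt s; rewrite (cell_src s) (cell_tgt s). Qed.

Definition cell_id f : cell f f := MkCell (src_id2 f) (tgt_id2 f).

Lemma vcomp_bd f g h (s : cell f g) (t : cell g h) :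
  src (s ∙ t) = f /\ tgt (s ∙ t) = h.
Proof. by split; bd. Qed.

Definition cell_vcomp f g h (s : cell f g) (t : cell g h) : cell f h :=
  MkCell (proj1 (vcomp_bd s t)) (proj2 (vcomp_bd s t)).

Lemma lwhisk_bd k f g (s : cell f g) : dom k = cod f ->
  src (k ◁ s) = k ∘ f /\ tgt (k ◁ s) = k ∘ g.
Proof. by move=> e; split; [rewrite src_lwhisk | rewrite tgt_lwhisk]; bd. Qed.

Definition cell_lwhisk k f g (s : cell f g) (e : dom k = cod f) :
    cell (k ∘ f) (k ∘ g) :=
  MkCell (proj1 (lwhisk_bd s e)) (proj2 (lwhisk_bd s e)).

Lemma rwhisk_bd f g (s : cell f g) k : dom f = cod k ->
  src (s ▷ k) = f ∘ k /\ tgt (s ▷ k) = g ∘ k.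
Proof. by move=> e; split; [rewrite src_rwhisk | rewrite tgt_rwhisk]; bd. Qed.

Definition cell_rwhisk f g (s : cell f g) k (e : dom f = cod k) :
    cell (f ∘ k) (g ∘ k) :=
  MkCell (proj1 (rwhisk_bd s e)) (proj2 (rwhisk_bd s e)).

Definition cell_cast f g f' g' (ef : f = f') (eg : g = g') (s : cell f g) :
    cell f' g' :=
  MkCell (etrans (cell_src s) ef) (etrans (cell_tgt s) eg).

Definition iso_cast f g f' g' (ef : f = f') (eg : g = g') (s : iso2 f g) :
    iso2 f' g' :=
  Iso2 (iso_fwd := cell_cast ef eg s) (iso_bwd := cell_cast eg ef s^-1)
    (etrans (iso_fwdK s) (congr1 id2 ef)) (etrans (iso_bwdK s) (congr1 id2 eg)).

Lemma vcomp_id_l f g (s : cell f g) : id2 f ∙ s = s.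
Proof. by have := vcomp_id2_l s; rewrite cell_src. Qed.

Lemma vcomp_id_r f g (s : cell f g) : s ∙ id2 g = s.
Proof. by have := vcomp_id2_r s; rewrite cell_tgt. Qed.

Lemma iso_vcompK f g h (s : cell f g) (s' : cell g f) (t : cell g h) (t' : cell h g) :
  s ∙ s' = id2 f -> t ∙ t' = id2 g -> (s ∙ t) ∙ (t' ∙ s') = id2 f.
Proof.
move=> Es Et; rewrite -vcompA; try bd.
by rewrite (vcompA (s := t)) ?Et ?vcomp_id_l //; bd.
Qed.

Definition iso_vcomp f g h (s : iso2 f g) (t : iso2 g h) : iso2 f h :=
  Iso2 (iso_fwd := cell_vcomp s t) (iso_bwd := cell_vcomp t^-1 s^-1)
    (iso_vcompK (iso_fwdK s) (iso_fwdK t)) (iso_vcompK (iso_bwdK t) (iso_bwdK s)).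

Lemma iso_lwhiskK k f g (s : cell f g) (t : cell g f) : dom k = cod f ->
  s ∙ t = id2 f -> (k ◁ s) ∙ (k ◁ t) = id2 (k ∘ f).
Proof. by move=> e E; rewrite -lwhisk_vcomp ?E ?lwhisk_id2 //; bd. Qed.

Definition iso_lwhisk k f g (s : iso2 f g) (e : dom k = cod f) :
    iso2 (k ∘ f) (k ∘ g) :=
  let e' := etrans e (esym (cell_cod s)) in
  Iso2 (iso_fwd := cell_lwhisk s e) (iso_bwd := cell_lwhisk s^-1 e')
    (iso_lwhiskK e (iso_fwdK s)) (iso_lwhiskK e' (iso_bwdK s)).

Lemma iso_rwhiskK f g (s : cell f g) (t : cell g f) k : dom f = cod k ->
  s ∙ t = id2 f -> (s ▷ k) ∙ (t ▷ k) = id2 (f ∘ k).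
Proof. by move=> e E; rewrite -rwhisk_vcomp ?E ?rwhisk_id2 //; bd. Qed.

Definition iso_rwhisk f g (s : iso2 f g) k (e : dom f = cod k) :
    iso2 (f ∘ k) (g ∘ k) :=
  let e' := etrans (cell_dom s) e in
  Iso2 (iso_fwd := cell_rwhisk s e) (iso_bwd := cell_rwhisk s^-1 e')
    (iso_rwhiskK e (iso_fwdK s)) (iso_rwhiskK e' (iso_bwdK s)).
End TwoCells.

Lemma chain (C : two_category) (a b c d r : Cell C) : a ∙ b = c ∙ d ->
  tgt a = src b -> tgt b = src r -> tgt c = src d ->
  a ∙ (b ∙ r) = c ∙ (d ∙ r).
Proof.
move=> E h1 h2 h3.
have h4 : tgt d = src r by rewrite -h2 -(tgt_vcomp h1) E tgt_vcomp.
by rewrite vcompA // E vcompA.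
Qed.

Lemma vcompA4 (C : two_category) (a b c d : Cell C) :
  tgt a = src b -> tgt b = src c -> tgt c = src d ->
  a ∙ b ∙ c ∙ d = a ∙ (b ∙ (c ∙ d)).
Proof.
move=> h1 h2 h3; rewrite -!vcompA ?src_vcomp ?tgt_vcomp //.
Qed.
Lemma vcompA6 (C : two_category) (a b c d e g : Cell C) :
  tgt a = src b -> tgt b = src c -> tgt c = src d -> tgt d = src e -> tgt e = src g ->
  a ∙ b ∙ c ∙ d ∙ e ∙ g = a ∙ (b ∙ (c ∙ (d ∙ (e ∙ g)))).
Proof.
move=> h1 h2 h3 h4 h5; do 3!rewrite -?vcompA ?src_vcomp ?tgt_vcomp //.
Qed.
Lemma chain4 (C : two_category) (a b c d e g r : Cell C) :
  a ∙ (b ∙ (c ∙ d)) = e ∙ g ->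
  tgt a = src b -> tgt b = src c -> tgt c = src d -> tgt d = src r ->
  tgt e = src g -> tgt g = src r ->
  a ∙ (b ∙ (c ∙ (d ∙ r))) = e ∙ (g ∙ r).
Proof.
move=> E h1 h2 h3 h4 h5 h6; transitivity ((a ∙ (b ∙ (c ∙ d))) ∙ r).
  by clear E h5 h6; nf.
by rewrite E -vcompA.
Qed.
Lemma chain6 (C : two_category) (a b c d e g r a' b' c' d' : Cell C) :
  a ∙ (b ∙ (c ∙ (d ∙ (e ∙ g)))) = a' ∙ (b' ∙ (c' ∙ d')) ->
  tgt a = src b -> tgt b = src c -> tgt c = src d -> tgt d = src e ->
  tgt e = src g -> tgt g = src r ->
  tgt a' = src b' -> tgt b' = src c' -> tgt c' = src d' -> tgt d' = src r ->
  a ∙ (b ∙ (c ∙ (d ∙ (e ∙ (g ∙ r))))) = a' ∙ (b' ∙ (c' ∙ (d' ∙ r))).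
Proof.
move=> E h1 h2 h3 h4 h5 h6 k1 k2 k3 k4.
transitivity ((a' ∙ (b' ∙ (c' ∙ d'))) ∙ r).
  by rewrite -E; clear E k1 k2 k3 k4; nf.
by clear E h1 h2 h3 h4 h5 h6; nf.
Qed.

Section Inverses.
Variable C : two_category.

Lemma iso_swap (a a' b b' X Y : Cell C) :
  a' ∙ a = id2 (src Y) -> b ∙ b' = id2 (tgt X) -> X ∙ b = a ∙ Y ->
  tgt a' = src a -> tgt a = src Y -> tgt a' = src X ->
  tgt X = src b -> tgt b = src b' -> tgt Y = src b' ->
  a' ∙ X = Y ∙ b'.
Proof.
move=> Ea Eb E h1 h2 h3 h4 h5 h6.
rewrite -{1}(vcomp_id2_r X) -Eb (vcompA h4 h5) E -(vcompA h2 h6).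
rewrite -> (vcompA h1); last by rewrite src_vcomp.
by rewrite Ea -{1}(src_vcomp h6) vcomp_id2_l.
Qed.

Lemma iso_inv_uniq (f g : Mor C) (s : iso2 f g) (t : Cell C) :
  src t = g -> s ∙ t = id2 f -> t = s^-1.
Proof.
move=> h E; rewrite -[LHS]vcomp_id2_l h -(iso_bwdK s) -vcompA ?E; try bd.
exact: vcomp_id_r.
Qed.
End Inverses.

(* The centre-piece axiom is stable under restriction along f : V → U.  The
   2-cells are generalised to bare variables with given boundaries so that
   normalisation does not have to rewrite inside dependent arguments:
   ifm, ium, jf, ju are the inverse interchange cells of (f,m), (u,m), (m,f),
   (m,u), and Rv, Ru the inverses of hexR V A A, hexR U A A. *)
Section RestrictionCalculus.
Variables (M : gray_monoid) (A U V : Ob M) (m : hom (A ⊗ A) A) (u : hom U A) (f : hom V U).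
Variables (cU : hom (U ⊗ A) (A ⊗ U)) (cV : hom (V ⊗ A) (A ⊗ V))
  (cU2 : hom (U ⊗ (A ⊗ A)) ((A ⊗ A) ⊗ U)) (cV2 : hom (V ⊗ (A ⊗ A)) ((A ⊗ A) ⊗ V)).
Variables (al ga bl1 bl2 bv bu Rv Ru : Cell M) (ifm ium jf ju : Cell M).
Hypotheses (alS : src al = m ∘ (m ⋊ A)) (alT : tgt al = m ∘ (A ⋉ m)).
Hypotheses (gaS : src ga = m ∘ (u ⋊ A)) (gaT : tgt ga = m ∘ (A ⋉ u) ∘ cU).
Hypotheses (b1S : src bl1 = cU ∘ (f ⋊ A)) (b1T : tgt bl1 = (A ⋉ f) ∘ cV).
Hypotheses (b2S : src bl2 = cU2 ∘ (f ⋊ (A ⊗ A))) (b2T : tgt bl2 = ((A ⊗ A) ⋉ f) ∘ cV2).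
Hypotheses (bvS : src bv = cV ∘ (V ⋉ m)) (bvT : tgt bv = (m ⋊ V) ∘ cV2).
Hypotheses (buS : src bu = cU ∘ (U ⋉ m)) (buT : tgt bu = (m ⋊ U) ∘ cU2).
Hypotheses (RvT : tgt Rv = cV2) (RvS : src Rv = (A ⋉ cV) ∘ (cV ⋊ A)).
Hypotheses (RuT : tgt Ru = cU2) (RuS : src Ru = (A ⋉ cU) ∘ (cU ⋊ A)).
Hypotheses (ifT : tgt ifm = (f ⋊ A) ∘ (V ⋉ m)) (ifS : src ifm = (U ⋉ m) ∘ (f ⋊ (A ⊗ A))).
Hypotheses (iuT : tgt ium = (u ⋊ A) ∘ (U ⋉ m)) (iuS : src ium = (A ⋉ m) ∘ (u ⋊ (A ⊗ A))).
Hypotheses (jfT : tgt jf = (m ⋊ U) ∘ ((A ⊗ A) ⋉ f)) (jfS : src jf = (A ⋉ f) ∘ (m ⋊ V)).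
Hypotheses (juT : tgt ju = (m ⋊ A) ∘ ((A ⊗ A) ⋉ u)) (juS : src ju = (A ⋉ u) ∘ (m ⋊ U)).

Hypothesis Ebr : (cU ◁ ifm) ∙ (bl1 ▷ (V ⋉ m)) ∙ ((A ⋉ f) ◁ bv) ∙ (jf ▷ cV2)
   = (bu ▷ (f ⋊ (A ⊗ A))) ∙ ((m ⋊ U) ◁ bl2).
Hypothesis ER : ((A ⋉ cU) ◁ (bl1 ⋊₂ A)) ∙ ((A ⋉₂ bl1) ▷ (cV ⋊ A)) ∙ (((A ⊗ A) ⋉ f) ◁ Rv)
   = (Ru ▷ (f ⋊ (A ⊗ A))) ∙ bl2.
Hypothesis Ecp :
    (al ▷ (u ⋊ (A ⊗ A)))
      ∙ (m ◁ ium)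
      ∙ (ga ▷ (U ⋉ m))
      ∙ ((m ∘ (A ⋉ u)) ◁ bu)
      ∙ (m ◁ (ju ▷ cU2))
      ∙ (al ▷ (((A ⊗ A) ⋉ u) ∘ cU2))
    = (m ◁ (ga ⋊₂ A))
      ∙ (al ▷ ((A ⋉ (u ⋊ A)) ∘ (cU ⋊ A)))
      ∙ (m ◁ ((A ⋉₂ ga) ▷ (cU ⋊ A)))
      ∙ ((m ∘ (A ⋉ m) ∘ ((A ⊗ A) ⋉ u)) ◁ Ru).
Notation ga' := ((ga ▷ (f ⋊ A)) ∙ ((m ∘ (A ⋉ u)) ◁ bl1)).
Lemma restr_calc :
    (al ▷ ((u ∘ f) ⋊ (A ⊗ A)))
      ∙ (m ◁ ((ium ▷ (f ⋊ (A ⊗ A))) ∙ ((u ⋊ A) ◁ ifm)))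
      ∙ (ga' ▷ (V ⋉ m))
      ∙ ((m ∘ (A ⋉ (u ∘ f))) ◁ bv)
      ∙ (m ◁ ((((A ⋉ u) ◁ jf) ∙ (ju ▷ ((A ⊗ A) ⋉ f))) ▷ cV2))
      ∙ (al ▷ (((A ⊗ A) ⋉ (u ∘ f)) ∘ cV2))
    = (m ◁ (ga' ⋊₂ A))
      ∙ (al ▷ ((A ⋉ ((u ∘ f) ⋊ A)) ∘ (cV ⋊ A)))
      ∙ (m ◁ ((A ⋉₂ ga') ▷ (cV ⋊ A)))
      ∙ ((m ∘ (A ⋉ m) ∘ ((A ⊗ A) ⋉ (u ∘ f))) ◁ Rv).
Proof.
have X1 := @whisk_exchange _ ga ifm.
have {}X1 := esym (X1 ltac:(bd)).
have X2 := Ebr; rewrite -> vcompA4 in X2; [|bd..].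
have {}X2 := congr1 (lwhisk (m ∘ (A ⋉ u))) X2.
have X3 := @whisk_exchange _ ju bl2.
have {}X3 := X3 ltac:(bd).
have {}X3 := esym (congr1 (lwhisk m) X3).
have X4 := @whisk_exchange _ al (((A ⊗ A) ⋉ u) ◁ bl2).
have {}X4 := esym (X4 ltac:(bd)).
have X5 := Ecp; rewrite -> vcompA6 in X5; [|bd..]; rewrite -> vcompA4 in X5; [|bd..].
have {}X5 := congr1 (fun z => z ▷ (f ⋊ (A ⊗ A))) X5.
have X6 := @whisk_exchange _ al ((A ⋉ (u ⋊ A)) ◁ (bl1 ⋊₂ A)).
have {}X6 := X6 ltac:(bd).
have X7 := @whisk_exchange _ (A ⋉₂ ga) (bl1 ⋊₂ A).
have {}X7 := X7 ltac:(bd).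
have {}X7 := congr1 (lwhisk m) X7.
have X8 := congr1 (lwhisk (m ∘ (A ⋉ m) ∘ ((A ⊗ A) ⋉ u))) ER.
rewrite -> vcompA6; [|bd..].
rewrite -> vcompA4; [|bd..].
nf.
(move: X1; nf => X1; move: X2; nf => X2; move: X3; nf => X3; move: X4; nf => X4).
(move: X5; nf => X5).
(move: X6; nf => X6; move: X7; nf => X7; move: X8; nf => X8).
rewrite -> (chain X1); [|bd..].
rewrite -> (chain4 X2); [|bd..].
rewrite -> (chain X3); [|bd..].
rewrite -> X4.
rewrite -> (chain6 X5); [|bd..].
rewrite <- (chain X6); [|bd..].
rewrite <- (chain X7); [|bd..].
by rewrite X8.
Qed.
End RestrictionCalculus.

Definition hom_id (C : two_category) (x : Ob C) : hom x x :=
  Hom (dom_id1 x) (cod_id1 x).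

Definition hom_comp (C : two_category) (x y z : Ob C) (g : hom y z) (f : hom x y) :
  hom x z.
Proof. by exists (g ∘ f); bd. Defined.

Lemma vcompK (C : two_category) (f : Mor C) (a a' b b' : Cell C) :
  a ∙ a' = id2 f -> b ∙ b' = id2 (src a') -> tgt a = src b -> tgt b = src b' ->
  tgt b' = src a' -> (a ∙ b) ∙ (b' ∙ a') = id2 f.
Proof.
move=> Ea Eb h1 h2 h3.
rewrite <- (vcompA h1); last by rewrite src_vcomp.
by rewrite (vcompA h2 h3) Eb vcomp_id2_l.
Qed.

Lemma interchange_inv_comp_l (M : gray_monoid) (f' f g : Mor M) : dom f' = cod f ->
  (interchange (f' ∘ f) g)^-1
  = ((interchange f' g)^-1 ▷ (f ⋊ dom g)) ∙ ((f' ⋊ cod g) ◁ (interchange f g)^-1)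
  :> Cell M.
Proof.
move=> e; symmetry; apply: iso_inv_uniq; first by bd.
rewrite -> (interchange_comp_l g e); apply: vcompK; try bd.
- rewrite (iso_lwhiskK _ (iso_fwdK _)); [bd | congr id2; bd].
- rewrite (iso_rwhiskK _ (iso_fwdK _)); [bd | congr id2; bd].
Qed.

Lemma interchange_inv_comp_r (M : gray_monoid) (f g' g : Mor M) : dom g' = cod g ->
  (interchange f (g' ∘ g))^-1
  = ((cod f ⋉ g') ◁ (interchange f g)^-1) ∙ ((interchange f g')^-1 ▷ (dom f ⋉ g))
  :> Cell M.
Proof.
move=> e; symmetry; apply: iso_inv_uniq; first by bd.
rewrite -> (interchange_comp_r f e); apply: vcompK; try bd.
- rewrite (iso_rwhiskK _ (iso_fwdK _)); [bd | congr id2; bd].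
- rewrite (iso_lwhiskK _ (iso_fwdK _)); [bd | congr id2; bd].
Qed.
Lemma iso_sandwich (C : two_category) (a a' p q r r' y1 y2 : Cell C) :
  p ∙ q = a ∙ (y1 ∙ (y2 ∙ r)) ->
  a' ∙ a = id2 (src y1) -> r ∙ r' = id2 (tgt y2) ->
  tgt a' = src a -> tgt a = src y1 -> tgt y1 = src y2 -> tgt y2 = src r ->
  tgt r = src r' -> tgt p = src q -> tgt q = src r' ->
  a' ∙ (p ∙ (q ∙ r')) = y1 ∙ y2.
Proof.
move=> E Ea Er h1 h2 h3 h4 h5 h6 h7; rewrite (vcompA h6 h7) {}E.
clear p q h6 h7.
transitivity ((a' ∙ a) ∙ (y1 ∙ (y2 ∙ (r ∙ r')))); first by clear Ea Er; nf.
rewrite Ea Er vcomp_id2_r -{1}(src_vcomp h3); exact: vcomp_id2_l.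
Qed.

Lemma br_interchange_hom (M : braided_gray_monoid) (x x' y y' : Ob M)
    (f : hom x x') (g : hom y y') :
  (brl f y' ▷ (x ⋉ g)) ∙ ((y' ⋉ f) ◁ brr x g)
  = (br x' y' ◁ interchange f g) ∙ (brr x' g ▷ (f ⋊ y)) ∙ ((g ⋊ x') ◁ brl f y)
    ∙ (interchange g f ▷ br x y).
Proof.
case: f g => f fx fx' [g gy gy'] /=.
by case: _ / fx; case: _ / fx'; case: _ / gy; case: _ / gy'; exact: br_interchange.
Qed.

Lemma hexR_mod1_hom (M : braided_gray_monoid) (x x' y z : Ob M) (f : hom x x') :
  brl f (y ⊗ z) ∙ (((y ⊗ z) ⋉ f) ◁ hexR x y z)
  = (hexR x' y z ▷ (f ⋊ (y ⊗ z))) ∙ ((y ⋉ br x' z) ◁ (brl f y ⋊₂ z))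
    ∙ ((y ⋉₂ brl f z) ▷ (br x y ⋊ z)).
Proof. by case: f => f fx fx' /=; case: _ / fx; case: _ / fx'; exact: hexR_mod1. Qed.

Section Restriction.
Variables (M : braided_gray_monoid) (A : Ob M) (P : pseudomonoid A).
Variables (U V : Ob M) (u : centre_piece P U) (f : hom V U).
Notation m := (pm_mul P).

Definition cp_restrict_iso :
  iso2 (m ∘ (hom_comp u f ⋊ A)) (m ∘ (A ⋉ hom_comp u f) ∘ br V A).
Proof.
refine (iso_cast _ _ (iso_vcomp
  (iso_rwhisk (k := f ⋊ A) (cp_iso u) _)
  (iso_cast _ erefl (iso_lwhisk (k := m ∘ (A ⋉ u)) (brl f A) _)))); rewrite /=; bd.
Defined.

Lemma cp_restrict_isoE :
  cp_restrict_iso = (cp_iso u ▷ (f ⋊ A)) ∙ ((m ∘ (A ⋉ u)) ◁ brl f A) :> Cell M.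
Proof. by []. Qed.

Lemma cp_restrict_axiom : let w := hom_comp u f in
    (pm_assoc P ▷ (w ⋊ (A ⊗ A)))
      ∙ (m ◁ (interchange w m)^-1)
      ∙ (cp_restrict_iso ▷ (V ⋉ m))
      ∙ ((m ∘ (A ⋉ w)) ◁ brr V m)
      ∙ (m ◁ ((interchange m w)^-1 ▷ br V (A ⊗ A)))
      ∙ (pm_assoc P ▷ (((A ⊗ A) ⋉ w) ∘ br V (A ⊗ A)))
    = (m ◁ (cp_restrict_iso ⋊₂ A))
      ∙ (pm_assoc P ▷ ((A ⋉ (w ⋊ A)) ∘ (br V A ⋊ A)))
      ∙ (m ◁ ((A ⋉₂ cp_restrict_iso) ▷ (br V A ⋊ A)))
      ∙ ((m ∘ (A ⋉ m) ∘ ((A ⊗ A) ⋉ w)) ◁ (hexR V A A)^-1).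
Proof.
move=> w; rewrite cp_restrict_isoE {}/w -[hom_mor (hom_comp u f)]/(u ∘ f).
have -> : (interchange (u ∘ f) m)^-1
    = ((interchange u m)^-1 ▷ (f ⋊ (A ⊗ A))) ∙ ((u ⋊ A) ◁ (interchange f m)^-1)
    :> Cell M.
  rewrite -> interchange_inv_comp_l; [|bd].
  congr ((_ ▷ (f ⋊ _)) ∙ ((u ⋊ _) ◁ _)); bd.
have -> : (interchange m (u ∘ f))^-1
    = ((A ⋉ u) ◁ (interchange m f)^-1) ∙ ((interchange m u)^-1 ▷ ((A ⊗ A) ⋉ f))
    :> Cell M.
  rewrite -> interchange_inv_comp_r; [|bd].
  congr (((_ ⋉ u) ◁ _) ∙ (_ ▷ (_ ⋉ f))); bd.
apply: (restr_calc (bl2 := brl f (A ⊗ A)) (bu := brr U m) (cU := br U A)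
  (cU2 := br U (A ⊗ A)) (Ru := (hexR U A A)^-1)); try bd.
- have E := br_interchange_hom f m.
  rewrite -> vcompA4 in E; [|bd..].
  rewrite -> vcompA4; [|bd..].
  apply: (iso_sandwich E); try bd.
  + by rewrite (iso_lwhiskK _ (iso_bwdK _)); [bd | congr id2; bd].
  + by rewrite (iso_rwhiskK _ (iso_fwdK _)); [bd | congr id2; bd].
- have E := hexR_mod1_hom A A f.
  rewrite <- vcompA in E; [|bd..].
  apply: esym; apply: (iso_swap _ _ E); try bd.
  + by rewrite (iso_rwhiskK _ (iso_bwdK _)); [bd | congr id2; bd].
  + by rewrite (iso_lwhiskK _ (iso_fwdK _)); [bd | congr id2; bd].
- exact: cp_axiom.
Qed.

Definition cp_restrict : centre_piece P V := CentrePiece cp_restrict_axiom.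
End Restriction.

Record category := Category {
  cat_ob :> Type;
  cat_hom : cat_ob -> cat_ob -> Type;
  cat_id : forall x, cat_hom x x;
  cat_comp : forall x y z, cat_hom x y -> cat_hom y z -> cat_hom x z;
  cat_id_l : forall x y (f : cat_hom x y), cat_comp (cat_id x) f = f;
  cat_id_r : forall x y (f : cat_hom x y), cat_comp f (cat_id y) = f;
  cat_compA : forall x y z w (f : cat_hom x y) (g : cat_hom y z) (h : cat_hom z w),
    cat_comp f (cat_comp g h) = cat_comp (cat_comp f g) h
}.

Record functor (C D : category) := Functor {
  fun_ob :> C -> D;
  fun_hom : forall x y : C, cat_hom x y -> cat_hom (fun_ob x) (fun_ob y);
  fun_id : forall x, fun_hom (cat_id x) = cat_id (fun_ob x);
  fun_comp : forall x y z (f : cat_hom x y) (g : cat_hom y z),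
    fun_hom (cat_comp f g) = cat_comp (fun_hom f) (fun_hom g)
}.

Definition functor_id (C : category) : functor C C :=
  Functor (fun_ob := fun x => x) (fun_hom := fun _ _ f => f)
    (fun _ => erefl) (fun _ _ _ _ _ => erefl).

Definition functor_comp (C D E : category) (G : functor D E) (F : functor C D) :
  functor C E.
Proof.
refine (Functor (fun_ob := fun x => G (F x))
  (fun_hom := fun _ _ f => fun_hom G (fun_hom F f)) _ _).
- by move=> x; rewrite !fun_id.
- by move=> x y z f g; rewrite !fun_comp.
Defined.

Record natural_iso (C D : category) (F G : functor C D) := NaturalIso {
  ni_fwd : forall x : C, cat_hom (F x) (G x);
  ni_bwd : forall x : C, cat_hom (G x) (F x);
  ni_fwdK : forall x, cat_comp (ni_fwd x) (ni_bwd x) = cat_id (F x);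
  ni_bwdK : forall x, cat_comp (ni_bwd x) (ni_fwd x) = cat_id (G x);
  ni_nat : forall x y (f : cat_hom x y),
    cat_comp (fun_hom F f) (ni_fwd y) = cat_comp (ni_fwd x) (fun_hom G f)
}.

Definition equivalence_of_categories (C D : category) (F : functor C D) : Prop :=
  exists G : functor D C,
    inhabited (natural_iso (functor_comp G F) (functor_id C))
    /\ inhabited (natural_iso (functor_comp F G) (functor_id D)).

Definition hom_category (C : two_category) (x y : Ob C) : category.
Proof.
refine (@Category (hom x y) (fun f g => cell f g) (fun f => cell_id f)
  (fun f g h s t => cell_vcomp s t) _ _ _).
- by move=> f g s; apply: cell_inj; exact: vcomp_id_l.
- by move=> f g s; apply: cell_inj; exact: vcomp_id_r.
- by move=> f g h k s t r; apply: cell_inj; apply: vcompA; bd.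
Defined.

Lemma brl_nat_hom (M : braided_gray_monoid) (x x' y : Ob M) (f g : hom x x')
    (s : cell f g) :
  (br x' y ◁ (s ⋊₂ y)) ∙ brl g y = brl f y ∙ ((y ⋉₂ s) ▷ br x y).
Proof.
move: f g s => [f fx fx'] [g gx gx'] [s sf sg] /=; simpl in *.
by subst f g; subst x x'; exact: brl_nat.
Qed.

Section CentrePieces.
Variables (M : braided_gray_monoid) (A : Ob M) (P : pseudomonoid A).
Notation m := (pm_mul P).

Lemma cpm_inj (U : Ob M) (u v : centre_piece P U) (s t : centre_piece_map u v) :
  s = t :> Cell M -> s = t.
Proof.
case: s t => [s sE] [t tE] /= /cell_inj E; case: t / E tE => tE.
by rewrite (proof_irrelevance _ sE tE).
Qed.

Lemma cpm_id_axiom (U : Ob M) (u : centre_piece P U) :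
  (m ◁ (cell_id u ⋊₂ A)) ∙ cp_iso u = cp_iso u ∙ ((m ◁ (A ⋉₂ cell_id u)) ▷ br U A).
Proof.
rewrite /= rtens2_id2 ltens2_id2 !lwhisk_id2; try bd.
by rewrite rwhisk_id2 ?vcomp_id_l ?vcomp_id_r //; bd.
Qed.

Definition cpm_id (U : Ob M) (u : centre_piece P U) : centre_piece_map u u :=
  CentrePieceMap (cpm_id_axiom u).

Lemma cpm_comp_axiom (U : Ob M) (u v w : centre_piece P U)
    (s : centre_piece_map u v) (t : centre_piece_map v w) :
  (m ◁ (cell_vcomp s t ⋊₂ A)) ∙ cp_iso w
  = cp_iso u ∙ ((m ◁ (A ⋉₂ cell_vcomp s t)) ▷ br U A).
Proof.
rewrite /=; transitivity ((m ◁ (s ⋊₂ A)) ∙ ((m ◁ (t ⋊₂ A)) ∙ cp_iso w)).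
  by nf.
rewrite cpm_axiom vcompA; try bd.
by rewrite cpm_axiom; nf.
Qed.

Definition cpm_comp (U : Ob M) (u v w : centre_piece P U)
    (s : centre_piece_map u v) (t : centre_piece_map v w) : centre_piece_map u w :=
  CentrePieceMap (cpm_comp_axiom s t).

Definition cp_category (U : Ob M) : category.
Proof.
refine (@Category (centre_piece P U) (@centre_piece_map M A P U) (@cpm_id U)
  (@cpm_comp U) _ _ _).
- by move=> u v s; apply: cpm_inj; exact: vcomp_id_l.
- by move=> u v s; apply: cpm_inj; exact: vcomp_id_r.
- by move=> u v w x s t r; apply: cpm_inj; apply: vcompA; bd.
Defined.

Variables (Z : Ob M) (i : centre_piece P Z) (U : Ob M).

Lemma cpm_restrict_bd (f g : hom U Z) (s : cell f g) :
  src (i ◁ s) = cp_restrict i f /\ tgt (i ◁ s) = cp_restrict i g.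
Proof. by apply: lwhisk_bd; bd. Qed.

Definition cpm_restrict_cell (f g : hom U Z) (s : cell f g) :
    cell (cp_restrict i f) (cp_restrict i g) :=
  MkCell (proj1 (cpm_restrict_bd s)) (proj2 (cpm_restrict_bd s)).

Lemma cpm_restrict_axiom (f g : hom U Z) (s : cell f g) :
  (m ◁ (cpm_restrict_cell s ⋊₂ A)) ∙ cp_iso (cp_restrict i g)
  = cp_iso (cp_restrict i f) ∙ ((m ◁ (A ⋉₂ cpm_restrict_cell s)) ▷ br U A).
Proof.
rewrite -[cp_iso (cp_restrict i g)]/(cp_restrict_iso i g).
rewrite -[cp_iso (cp_restrict i f)]/(cp_restrict_iso i f).
rewrite !cp_restrict_isoE -[cell_val (cpm_restrict_cell s)]/(i ◁ s).
have X1 := @whisk_exchange _ (cp_iso i) (s ⋊₂ A).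
have {}X1 := esym (X1 ltac:(bd)).
have X2 := congr1 (lwhisk (m ∘ (A ⋉ i))) (brl_nat_hom A s).
nf; move: X1; nf => X1; move: X2; nf => X2.
rewrite -> vcompA; [|bd..].
rewrite -> X1; rewrite <- vcompA; [|bd..].
by rewrite X2.
Qed.

Definition cpm_restrict (f g : hom U Z) (s : cell f g) :
    centre_piece_map (cp_restrict i f) (cp_restrict i g) :=
  CentrePieceMap (cpm_restrict_axiom s).

Definition cp_functor : functor (hom_category U Z) (cp_category U).
Proof.
refine (@Functor (hom_category U Z) (cp_category U) (fun f => cp_restrict i f)
  cpm_restrict _ _).
- by move=> f; apply: cpm_inj; rewrite /= lwhisk_id2 //; bd.
- by move=> f g h s t; apply: cpm_inj; rewrite /= lwhisk_vcomp //; bd.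
Defined.
End CentrePieces.

Definition is_centre (M : braided_gray_monoid) (A : Ob M) (P : pseudomonoid A)
    (Z : Ob M) (i : centre_piece P Z) : Prop :=
  forall U : Ob M, equivalence_of_categories (cp_functor i U).

(* Main.v *)
(* For u : U → A and x : X → A write u * x = m (u ⊗ x).  A half-braiding γ of u yields
   isomorphisms u * x ≅ (x * u) c_{U,X}, and the centre-piece axiom becomes a hexagon for
   them.  By these hexagons and the coherence of c, the product u * v of two centre pieces
   is a centre piece, and the associativity isomorphisms of * as well as the half-braiding
   u * v ≅ (v * u) c_{U,V} itself are morphisms of centre pieces.  The unit j is a centre
   piece and the unit isomorphisms are morphisms of centre pieces: although no axiom
   concerns c_{I,X}, the 2-cell c_{I,X} ≅ c_{I,X} c_{I,X} and the fact that c_{I,X} is an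
   equivalence give 1 ≅ c_{I,X}, compatibly with the braiding.
   The universal property represents i * i as i ∘ μ and j as i ∘ η, and lifts these
   isomorphisms of centre pieces along i ∘ -.  Since i ∘ - is faithful, an equation between
   the lifts holds as soon as its image under i does, and the images are the laws of *. *)
From Stdlib Require Import ssreflect ssrfun ssrbool List Arith.
Require Import Defs.
Import ListNotations.

Set Implicit Arguments.
Unset Strict Implicit.
Unset Printing Implicit Defensive.

Section Identities.
Variables (C : two_category) (x : Ob C).
Lemma rwhisk_id1' (s : Cell C) : dom (src s) = x -> s ▷ id1 x = s.
Proof. move=> <-; exact: rwhisk_id1. Qed.
Lemma vcomp_id2_l' (f : Mor C) (s : Cell C) : src s = f -> id2 f ∙ s = s.
Proof. move=> <-; exact: vcomp_id2_l. Qed.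
End Identities.

(** * Pasting diagrams in a Gray monoid, by reflection *)

(* A 2-cell is normalised to a vertical composite of slices p ◁ (X ⊗ a ⊗ Y) ▷ q, where a
   is an atomic 2-cell, p and q are composites of slices X ⊗ f ⊗ Y of atomic 1-cells, and
   X and Y are tensor products of atomic objects. *)
Inductive oexpr := OVar (i : nat) | OUnit | OTens (a b : oexpr).
Inductive mexpr :=
  | MVar (i : nat) | MId (o : oexpr) | MComp (g f : mexpr)
  | ML (o : oexpr) (f : mexpr) | MR (f : mexpr) (o : oexpr).
Inductive cexpr :=
  | CVar (i : nat) | CId (f : mexpr) | CComp (s t : cexpr)
  | CLW (f : mexpr) (s : cexpr) | CRW (s : cexpr) (f : mexpr)
  | CL (o : oexpr) (s : cexpr) | CR (s : cexpr) (o : oexpr).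

Notation word := (list nat).
Record slice := Slice { sl_l : word; sl_at : nat; sl_r : word }.
Record cslice := CSlice {
  cs_p : list slice; cs_l : word; cs_at : nat; cs_r : word; cs_q : list slice }.

Definition word_dec : forall a b : word, {a = b} + {a <> b} := list_eq_dec Nat.eq_dec.
Definition slice_dec : forall a b : slice, {a = b} + {a <> b}.
Proof. decide equality; (apply: word_dec || apply: Nat.eq_dec). Defined.
Definition path_dec : forall a b : list slice, {a = b} + {a <> b} := list_eq_dec slice_dec.
Definition cslice_dec : forall a b : cslice, {a = b} + {a <> b}.
Proof.
decide equality; (apply: path_dec || apply: word_dec || apply: Nat.eq_dec).
Defined.
Definition chain_dec : forall a b : list cslice, {a = b} + {a <> b} :=
  list_eq_dec cslice_dec.

Fixpoint oflat (e : oexpr) : word :=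
  match e with OVar i => [i] | OUnit => [] | OTens a b => oflat a ++ oflat b end.

Definition stens (X Y : word) (s : slice) : slice :=
  Slice (X ++ sl_l s) (sl_at s) (sl_r s ++ Y).
Notation ptens X Y := (map (stens X Y)).

Record pnf := PNF { p_dom : word; p_path : list slice; p_cod : word }.
Record cnf := CNF {
  c_dom : word; c_cod : word; c_src : list slice; c_tgt : list slice;
  c_chain : list cslice }.

Definition cnf_dec : forall a b : cnf, {a = b} + {a <> b}.
Proof.
decide equality; (apply: chain_dec || apply: path_dec || apply: word_dec).
Defined.

Definition caddp (l : list slice) (s : cslice) : cslice :=
  CSlice (l ++ cs_p s) (cs_l s) (cs_at s) (cs_r s) (cs_q s).
Definition caddq (l : list slice) (s : cslice) : cslice :=
  CSlice (cs_p s) (cs_l s) (cs_at s) (cs_r s) (cs_q s ++ l).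
Definition ctens (X Y : word) (s : cslice) : cslice :=
  CSlice (ptens X Y (cs_p s)) (X ++ cs_l s) (cs_at s) (cs_r s ++ Y)
    (ptens X Y (cs_q s)).

Section Eval.
Variable M : gray_monoid.
Variable eo : list (Ob M).

Fixpoint oev (e : oexpr) : Ob M :=
  match e with
  | OVar i => nth i eo unitO
  | OUnit => unitO
  | OTens a b => oev a ⊗ oev b
  end.

Fixpoint wev (w : word) : Ob M :=
  match w with
  | [] => unitO
  | i :: w' => match w' with [] => nth i eo unitO | _ => nth i eo unitO ⊗ wev w' end
  end.

Lemma wev_cons i w : wev (i :: w) = nth i eo unitO ⊗ wev w.
Proof. by case: w => //=; rewrite tensO1r. Qed.

Lemma wev_app v w : wev (v ++ w) = wev v ⊗ wev w.
Proof.
elim: v => [|i v IH]; first by rewrite tensO1l.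
by rewrite -app_comm_cons !wev_cons IH tensOA.
Qed.

Lemma oflatE e : wev (oflat e) = oev e.
Proof. by elim: e => //= a Ea b Eb; rewrite wev_app Ea Eb. Qed.

Record matom := MAtom {
  ma : Mor M; ma_dom : oexpr; ma_cod : oexpr;
  ma_domE : dom ma = oev ma_dom; ma_codE : cod ma = oev ma_cod }.

Definition matom0 : matom :=
  @MAtom (id1 unitO) OUnit OUnit (dom_id1 _) (cod_id1 _).

Variable em : list matom.
Notation mat i := (nth i em matom0).

Fixpoint mev (e : mexpr) : Mor M :=
  match e with
  | MVar i => ma (mat i)
  | MId o => id1 (oev o)
  | MComp g f => mev g ∘ mev f
  | ML o f => oev o ⋉ mev f
  | MR f o => mev f ⋊ oev o
  end.

Definition ltw (X : word) (f : Mor M) := match X with [] => f | _ => wev X ⋉ f end.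
Definition rtw (f : Mor M) (X : word) := match X with [] => f | _ => f ⋊ wev X end.
Lemma ltE X f : ltw X f = wev X ⋉ f.
Proof. by case: X => //=; rewrite ltens_unit. Qed.
Lemma rtE X f : rtw f X = f ⋊ wev X.
Proof. by case: X => //=; rewrite rtens_unit. Qed.

Definition sev (s : slice) : Mor M := ltw (sl_l s) (rtw (ma (mat (sl_at s))) (sl_r s)).
Definition sdom (s : slice) : word := sl_l s ++ oflat (ma_dom (mat (sl_at s))) ++ sl_r s.
Definition scod (s : slice) : word := sl_l s ++ oflat (ma_cod (mat (sl_at s))) ++ sl_r s.

Lemma dom_sev s : dom (sev s) = wev (sdom s).
Proof.
by rewrite /sev /sdom ltE rtE dom_ltens dom_rtens ma_domE !wev_app oflatE.
Qed.
Lemma cod_sev s : cod (sev s) = wev (scod s).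
Proof.
by rewrite /sev /scod ltE rtE cod_ltens cod_rtens ma_codE !wev_app oflatE.
Qed.

Lemma sev_tens X Y s : sev (stens X Y s) = wev X ⋉ (sev s ⋊ wev Y).
Proof.
by rewrite /sev !ltE !rtE !wev_app ltens_tensO rtens_tensO lrtens.
Qed.

Fixpoint pev (d : word) (l : list slice) : Mor M :=
  match l with
  | [] => id1 (wev d)
  | s :: l' => match l' with [] => sev s | _ => sev s ∘ pev d l' end
  end.

Fixpoint wtp (d : word) (l : list slice) : option word :=
  match l with
  | [] => Some d
  | s :: l' => match wtp d l' with
               | Some w => match word_dec w (sdom s) with
                           | left _ => Some (scod s) | right _ => None end
               | None => None end
  end.

Lemma pev_cons d s l : cod (pev d l) = wev (sdom s) ->
  pev d (s :: l) = sev s ∘ pev d l.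
Proof.
case: l => //= h; rewrite comp_id1_r' // dom_sev -h cod_id1 //.
Qed.

Lemma wtp_ok d l c : wtp d l = Some c -> dom (pev d l) = wev d /\ cod (pev d l) = wev c.
Proof.
elim: l c => [|s l IH] c; first by move=> [<-]; rewrite /= dom_id1 cod_id1.
move=> /=; case E: (wtp d l) => [w|] //; case: word_dec => // ew [<-].
have [hd hc] := IH _ E; rewrite -[X in dom X]/(pev d (s :: l)) -[X in cod X]/(pev d (s :: l)).
rewrite pev_cons ?hc ?ew // dom_comp ?cod_comp ?dom_sev ?cod_sev ?hd ?hc ?ew //.
Qed.

Lemma wtp_cons d s l c : wtp d (s :: l) = Some c <->
  wtp d l = Some (sdom s) /\ c = scod s.
Proof.
move=> /=; split.
- by case: (wtp d l) => [w|] //; case: word_dec => // -> [].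
- by move=> [-> ->]; case: word_dec.
Qed.

Lemma pev_app d l c l' c' : wtp d l = Some c -> wtp c l' = Some c' ->
  wtp d (l' ++ l) = Some c' /\ pev d (l' ++ l) = pev c l' ∘ pev d l.
Proof.
move=> h; elim: l' c' => [|s l' IH] c'.
  by move=> [<-]; split=> //=; rewrite comp_id1_l' //; case: (wtp_ok h).
move=> /wtp_cons [h' ->]; have [w e] := IH _ h'; rewrite -app_comm_cons.
have [_ hc] := wtp_ok w; have [hd' hc'] := wtp_ok h'; have [_ hcl] := wtp_ok h.
split; first by apply/wtp_cons.
rewrite !pev_cons // e compA // ?dom_sev ?hc' ?hd' ?hcl //.
Qed.

Lemma pev_tens X Y d l c : wtp d l = Some c ->
  wtp (X ++ d ++ Y) (ptens X Y l) = Some (X ++ c ++ Y)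
  /\ pev (X ++ d ++ Y) (ptens X Y l) = wev X ⋉ (pev d l ⋊ wev Y).
Proof.
elim: l c => [|s l IH] c.
  by move=> [<-]; split=> //=; rewrite rtens_id1 ltens_id1 !wev_app.
move=> /wtp_cons [h ->]; have [w e] := IH _ h.
have [hd hc] := wtp_ok h; have [_ hc'] := wtp_ok w.
have sd : sdom (stens X Y s) = X ++ sdom s ++ Y by rewrite /sdom /= !app_assoc.
have sc : scod (stens X Y s) = X ++ scod s ++ Y by rewrite /scod /= !app_assoc.
split; first by apply/wtp_cons; rewrite sd sc w.
rewrite [map _ _]/= !pev_cons ?sd ?hc' // e sev_tens.
rewrite rtens_comp ?dom_sev ?hc // ltens_comp // dom_rtens cod_rtens dom_sev hc //.
Qed.

Fixpoint mnf (e : mexpr) : option pnf :=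
  match e with
  | MVar i => Some (PNF (oflat (ma_dom (mat i))) [Slice [] i []] (oflat (ma_cod (mat i))))
  | MId o => Some (PNF (oflat o) [] (oflat o))
  | MComp g f =>
    match mnf g, mnf f with
    | Some (PNF d l c), Some (PNF d' l' c') =>
      match word_dec c' d with left _ => Some (PNF d' (l ++ l') c) | right _ => None end
    | _, _ => None
    end
  | ML o f =>
    match mnf f with
    | Some (PNF d l c) =>
      let X := oflat o in Some (PNF (X ++ d ++ []) (ptens X [] l) (X ++ c ++ []))
    | None => None
    end
  | MR f o =>
    match mnf f with
    | Some (PNF d l c) =>
      let X := oflat o in Some (PNF ([] ++ d ++ X) (ptens [] X l) ([] ++ c ++ X))
    | None => None
    end
  end.

Lemma mnf_ok e d l c : mnf e = Some (PNF d l c) ->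
  wtp d l = Some c /\ mev e = pev d l.
Proof.
elim: e d l c => [i|o|g IHg f IHf|o f IH|f IH o] d l c /=.
- move=> [<- <- <-]; rewrite /= /sdom /scod /= !app_nil_r.
  by case: word_dec.
- by move=> [<- <- <-]; rewrite /= oflatE.
- case: (mnf g) IHg => [[d1 l1 c1]|] // /(_ _ _ _ erefl) [w1 ->].
  case: (mnf f) IHf => [[d2 l2 c2]|] // /(_ _ _ _ erefl) [w2 ->].
  case: word_dec => // e [<- <- <-]; move: w2; rewrite {}e => w2.
  by have [-> ->] := pev_app w2 w1.
- case: (mnf f) IH => [[d1 l1 c1]|] // /(_ _ _ _ erefl) [w1 ->] [<- <- <-].
  have [-> ->] := pev_tens (oflat o) [] w1.
  by rewrite oflatE rtens_unit.
- case: (mnf f) IH => [[d1 l1 c1]|] // /(_ _ _ _ erefl) [w1 ->] [<- <- <-].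
  have [E1 E2] := pev_tens [] (oflat o) w1; rewrite -[d1 ++ _]/([] ++ d1 ++ oflat o) E1 E2.
  by rewrite oflatE ltens_unit.
Qed.

Record catom := CAtom {
  ca : Cell M; ca_src : mexpr; ca_tgt : mexpr;
  ca_srcE : src ca = mev ca_src; ca_tgtE : tgt ca = mev ca_tgt }.

Definition catom0 : catom :=
  @CAtom (id2 (id1 unitO)) (MId OUnit) (MId OUnit) (src_id2 _) (tgt_id2 _).

Variable ec : list catom.
Notation cat i := (nth i ec catom0).

Fixpoint cev (e : cexpr) : Cell M :=
  match e with
  | CVar i => ca (cat i)
  | CId f => id2 (mev f)
  | CComp s t => cev s ∙ cev t
  | CLW f s => mev f ◁ cev s
  | CRW s f => cev s ▷ mev f
  | CL o s => oev o ⋉₂ cev s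
  | CR s o => cev s ⋊₂ oev o
  end.

Definition lt2 (X : word) (s : Cell M) := match X with [] => s | _ => wev X ⋉₂ s end.
Definition rt2 (s : Cell M) (X : word) := match X with [] => s | _ => s ⋊₂ wev X end.
Definition lw (p : list slice) (s : Cell M) := match p with [] => s | _ => pev [] p ◁ s end.
Definition rw (s : Cell M) (q : list slice) := match q with [] => s | _ => s ▷ pev [] q end.
Definition csev (s : cslice) : Cell M :=
  lw (cs_p s) (rw (lt2 (cs_l s) (rt2 (ca (cat (cs_at s))) (cs_r s))) (cs_q s)).

Lemma lt2E X s : lt2 X s = wev X ⋉₂ s.
Proof. by case: X => //=; rewrite ltens2_unit. Qed.
Lemma rt2E X s : rt2 s X = s ⋊₂ wev X.
Proof. by case: X => //=; rewrite rtens2_unit. Qed.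
Lemma pev_nonnil d d' s l : pev d (s :: l) = pev d' (s :: l).
Proof.
elim: l s => [|a l IH] s //.
by rewrite -[LHS]/(sev s ∘ pev d (a :: l)) -[RHS]/(sev s ∘ pev d' (a :: l)) IH.
Qed.
Lemma lwE d p s : cod (src s) = wev d -> lw p s = pev d p ◁ s.
Proof.
case: p => [h|a p _]; first by rewrite /= -h lwhisk_id1.
by rewrite /lw (pev_nonnil _ d).
Qed.
Lemma rwE d q s c : wtp d q = Some c -> dom (src s) = wev c -> rw s q = s ▷ pev d q.
Proof.
case: q => [|a q] h hs; last by rewrite /rw (pev_nonnil _ d).
by case: h => ->; rewrite /= rwhisk_id1'.
Qed.

Definition cat_bd (i : nat) : option cnf :=
  match mnf (ca_src (cat i)), mnf (ca_tgt (cat i)) with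
  | Some (PNF d a c), Some (PNF d' b c') =>
    match word_dec d d', word_dec c c' with
    | left _, left _ => Some (CNF d c a b [CSlice [] [] i [] []])
    | _, _ => None
    end
  | _, _ => None
  end.

Lemma cat_bd_ok i n : cat_bd i = Some n ->
  [/\ wtp (c_dom n) (c_src n) = Some (c_cod n), wtp (c_dom n) (c_tgt n) = Some (c_cod n),
    src (ca (cat i)) = pev (c_dom n) (c_src n), tgt (ca (cat i)) = pev (c_dom n) (c_tgt n)
    & c_chain n = [CSlice [] [] i [] []]].
Proof.
rewrite /cat_bd; case E1: (mnf _) => [[d a c]|] //; case E2: (mnf _) => [[d' b c']|] //.
case: word_dec => // ed; case: word_dec => // ec' [<-] /=.
move: E2; rewrite -ed -ec' => E2.
by have [wa ea] := mnf_ok E1; have [wb eb] := mnf_ok E2; rewrite ca_srcE ca_tgtE ea eb.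
Qed.

(* codomain, source and target of a slice placed over the object d *)
Definition cbd (d : word) (s : cslice) : option (word * list slice * list slice) :=
  match cat_bd (cs_at s) with
  | Some n =>
    let X := cs_l s in let Y := cs_r s in
    match wtp d (cs_q s), wtp (X ++ c_cod n ++ Y) (cs_p s) with
    | Some w, Some c =>
      match word_dec w (X ++ c_dom n ++ Y) with
      | left _ => Some (c, cs_p s ++ ptens X Y (c_src n) ++ cs_q s,
                           cs_p s ++ ptens X Y (c_tgt n) ++ cs_q s)
      | right _ => None
      end
    | _, _ => None
    end
  | _ => None
  end.

Lemma cbdP d s c a b : cbd d s = Some (c, a, b) <->
  exists n, [/\ cat_bd (cs_at s) = Some n,
    wtp d (cs_q s) = Some (cs_l s ++ c_dom n ++ cs_r s),
    wtp (cs_l s ++ c_cod n ++ cs_r s) (cs_p s) = Some c,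
    a = cs_p s ++ ptens (cs_l s) (cs_r s) (c_src n) ++ cs_q s
    & b = cs_p s ++ ptens (cs_l s) (cs_r s) (c_tgt n) ++ cs_q s].
Proof.
rewrite /cbd; split.
- case E1: (cat_bd _) => [n|] //.
  case E3: (wtp _ _) => [w|] //; case E4: (wtp _ _) => [c'|] //.
  case: word_dec => // ew [<- <- <-]; move: E3; rewrite ew => E3.
  by exists n.
- by move=> [n [-> -> -> -> ->]]; case: word_dec.
Qed.

Lemma csev_ok d s c a b n : cbd d s = Some (c, a, b) -> cat_bd (cs_at s) = Some n ->
  let core := wev (cs_l s) ⋉₂ (ca (cat (cs_at s)) ⋊₂ wev (cs_r s)) in
  let p := pev (cs_l s ++ c_cod n ++ cs_r s) (cs_p s) in let q := pev d (cs_q s) in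
  [/\ wtp d a = Some c, wtp d b = Some c,
    dom (src core) = cod q /\ dom p = cod (src core),
    csev s = p ◁ (core ▷ q)
    & src (p ◁ (core ▷ q)) = pev d a /\ tgt (p ◁ (core ▷ q)) = pev d b].
Proof.
move=> /cbdP [n' [E0 E3 E4 -> ->]] E; move: E0 E3 E4; rewrite E => -[<-] E3 E4 core p q.
have [wa wb ea eb _] := cat_bd_ok E.
have [wta eta] := pev_tens (cs_l s) (cs_r s) wa.
have [wtb etb] := pev_tens (cs_l s) (cs_r s) wb.
have [wqa eqa] := pev_app E3 wta; have [wqb eqb] := pev_app E3 wtb.
have [wpa epa] := pev_app wqa E4; have [wpb epb] := pev_app wqb E4.
have [hda hca] := wtp_ok wa; have [hq1 hq2] := wtp_ok E3; have [hp1 hp2] := wtp_ok E4.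
have zs : src core = wev (cs_l s) ⋉ (pev (c_dom n) (c_src n) ⋊ wev (cs_r s)).
  by rewrite /core src_ltens2 src_rtens2 ea.
have zt : tgt core = wev (cs_l s) ⋉ (pev (c_dom n) (c_tgt n) ⋊ wev (cs_r s)).
  by rewrite /core tgt_ltens2 tgt_rtens2 eb.
have zd : dom (src core) = wev (cs_l s ++ c_dom n ++ cs_r s).
  by rewrite zs dom_ltens dom_rtens hda !wev_app.
have zc : cod (src core) = wev (cs_l s ++ c_cod n ++ cs_r s).
  by rewrite zs cod_ltens cod_rtens hca !wev_app.
have k : dom (src core) = cod q by rewrite zd hq2.
have k' : dom p = cod (src (core ▷ q)) by rewrite src_rwhisk // cod_comp // zc hp1.
have k'' : dom p = cod (src core) by rewrite zc hp1.
have e : csev s = p ◁ (core ▷ q).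
  by rewrite /csev lt2E rt2E (rwE E3) //; apply: lwE; rewrite src_rwhisk ?cod_comp ?zc.
split=> //; split.
- by rewrite src_lwhisk // src_rwhisk // zs epa eqa eta.
- by rewrite tgt_lwhisk // tgt_rwhisk // zt epb eqb etb.
Qed.

Lemma csev_bd d s c a b : cbd d s = Some (c, a, b) ->
  [/\ wtp d a = Some c, wtp d b = Some c, src (csev s) = pev d a & tgt (csev s) = pev d b].
Proof.
move=> h; have [n [E _ _ _ _]] := proj1 (cbdP _ _ _ _ _) h.
by have [? ? _ -> [? ?]] := csev_ok h E.
Qed.

Fixpoint chk (d : word) (sl : list slice) (L : list cslice) : option (list slice) :=
  match L with
  | [] => Some sl
  | s :: L' => match cbd d s with
    | Some (c, a, b) => match path_dec a sl with left _ => chk d b L' | right _ => None end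
    | None => None end
  end.

Fixpoint chev (d : word) (sl : list slice) (L : list cslice) : Cell M :=
  match L with
  | [] => id2 (pev d sl)
  | s :: L' => match L' with [] => csev s | _ => csev s ∙ chev d [] L' end
  end.

Lemma chk_cons d sl s L tl : chk d sl (s :: L) = Some tl <->
  exists c b, cbd d s = Some (c, sl, b) /\ chk d b L = Some tl.
Proof.
move=> /=; split.
- by case: (cbd d s) => [[[c a] b]|] //; case: path_dec => // -> h; exists c, b.
- by move=> [c [b [-> h]]]; case: path_dec.
Qed.

Lemma chev_cons d sl s L c b : cbd d s = Some (c, sl, b) -> 
  src (chev d b L) = pev d b -> chev d sl (s :: L) = csev s ∙ chev d b L.
Proof.
move=> h; case: L => [_|s' L h'] //=.
by have [_ _ _ <-] := csev_bd h; rewrite vcomp_id2_r.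
Qed.

Lemma chev_ok d sl L tl c : wtp d sl = Some c -> chk d sl L = Some tl ->
  [/\ wtp d tl = Some c, src (chev d sl L) = pev d sl & tgt (chev d sl L) = pev d tl].
Proof.
elim: L sl => [|s L IH] sl w.
  by move=> [<-]; rewrite /= src_id2 tgt_id2.
move=> /chk_cons [c' [b [h k]]]; have [w1 w2 hs ht] := csev_bd h.
move: w1; rewrite w => -[e]; move: w2; rewrite -e => w2.
have [w3 hs' ht'] := IH _ w2 k; rewrite (chev_cons h hs').
split=> //; rewrite ?src_vcomp ?tgt_vcomp ?ht ?hs' //.
Qed.

Lemma chev_app d sl L tl L' tl' c : wtp d sl = Some c ->
  chk d sl L = Some tl -> chk d tl L' = Some tl' ->
  chk d sl (L ++ L') = Some tl' /\ chev d sl (L ++ L') = chev d sl L ∙ chev d tl L'.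
Proof.
elim: L sl => [|s L IH] sl w.
  move=> [<-] h; split=> //=; rewrite vcomp_id2_l' //.
  by have [] := chev_ok w h.
move=> /chk_cons [c' [b [h k]]] h'; have [w1 w2 hs ht] := csev_bd h.
move: w1; rewrite w => -[e]; move: w2; rewrite -e => w2.
have [k2 e2] := IH _ w2 k h'; have [w3 h1 h2] := chev_ok w2 k2.
have [w4 h3 h4] := chev_ok w2 k; have [_ h5 h6] := chev_ok w4 h'.
split; first by apply/chk_cons; exists c', b.
rewrite (chev_cons h h3) [LHS](chev_cons h h1) e2 vcompA ?ht ?h3 ?h4 ?h5 //.
Qed.

Lemma chev_map d c sl L tl d' c' (F : cslice -> cslice) (B : list slice -> list slice)
    (phi : Cell M -> Cell M) :
  wtp d sl = Some c -> chk d sl L = Some tl ->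
  (forall s a b, cbd d s = Some (c, a, b) ->
    cbd d' (F s) = Some (c', B a, B b) /\ csev (F s) = phi (csev s)) ->
  (forall s t, tgt s = src t -> dom (src s) = wev d -> cod (src s) = wev c ->
    phi (s ∙ t) = phi s ∙ phi t) ->
  (forall l, wtp d l = Some c -> phi (id2 (pev d l)) = id2 (pev d' (B l)) /\
     wtp d' (B l) = Some c') ->
  wtp d' (B sl) = Some c' /\ chk d' (B sl) (map F L) = Some (B tl) /\
  chev d' (B sl) (map F L) = phi (chev d sl L).
Proof.
move=> w k HF Hphi Hid; split; first by case: (Hid _ w).
elim: L sl w k => [|s L IH] sl w.
  by move=> [<-]; split=> //=; case: (Hid _ w).
move=> /chk_cons [c1 [b [h k]]]; have [w1 w2 hs ht] := csev_bd h.
move: w1; rewrite w => -[e]; move: h w2; rewrite -e => h w2.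
have [k' e'] := IH _ w2 k; have [hF eF] := HF _ _ _ h.
split; first by apply/chk_cons; exists c', (B b).
have [_ hB] := Hid _ w2; have [_ h1 _] := chev_ok hB k'; have [_ h2 _] := chev_ok w2 k.
have [hd hc] := wtp_ok w.
by rewrite (chev_cons h h2) [LHS](chev_cons hF h1) e' eF Hphi // ?ht ?h2 ?hs ?hd ?hc.
Qed.

Definition ok (n : cnf) (s : Cell M) : Prop :=
  let: CNF d c sl tl L := n in
  [/\ wtp d sl = Some c, chk d sl L = Some tl & s = chev d sl L].

Lemma ok_lw f d' l c' d sl tl L s : mnf f = Some (PNF d' l c') ->
  ok (CNF d d' sl tl L) s ->
  ok (CNF d c' (l ++ sl) (l ++ tl) (map (caddp l) L)) (mev f ◁ s).
Proof.
move=> /mnf_ok [wl ->] [w k ->].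
have [hdl hcl] := wtp_ok wl.
have [] := @chev_map d d' sl L tl d c' (caddp l) (app l) (lwhisk (pev d' l)) w k.
- move=> {}s a b h; have [n [E E3 E4 Ea Eb]] := proj1 (cbdP _ _ _ _ _) h.
  have [w1 w2 [k1 k2] e [hs ht]] := csev_ok h E.
  have [wp ep] := pev_app E4 wl.
  have hh : cbd d (caddp l s) = Some (c', l ++ a, l ++ b).
    by apply/cbdP; exists n; split; rewrite /= ?Ea ?Eb -?app_assoc.
  split=> //; have [_ _ _ -> _] := csev_ok hh E.
  rewrite e /= ep lwhisk_comp //; first by rewrite hdl; have [] := wtp_ok E4.
  by rewrite src_rwhisk // cod_comp.
- by move=> s1 s2 h1 h2 h3; rewrite lwhisk_vcomp // h3.
- move=> l0 wl0; have [w1 e1] := pev_app wl0 wl; have [_ h] := wtp_ok wl0.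
  by rewrite w1 e1 lwhisk_id2 // h.
- by move=> w1 [w2 w3]; split.
Qed.

Lemma ok_rw f d' l c' c sl tl L s : mnf f = Some (PNF d' l c') ->
  ok (CNF c' c sl tl L) s ->
  ok (CNF d' c (sl ++ l) (tl ++ l) (map (caddq l) L)) (s ▷ mev f).
Proof.
move=> /mnf_ok [wl ->] [w k ->].
have [hdl hcl] := wtp_ok wl.
have [] := @chev_map c' c sl L tl d' c (caddq l) (fun z => z ++ l)
  (fun z => rwhisk z (pev d' l)) w k.
- move=> {}s a b h; have [n [E E3 E4 Ea Eb]] := proj1 (cbdP _ _ _ _ _) h.
  have [w1 w2 [k1 k2] e [hs ht]] := csev_ok h E.
  have [wp ep] := pev_app wl E3.
  have hh : cbd d' (caddq l s) = Some (c, a ++ l, b ++ l).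
    by apply/cbdP; exists n; split; rewrite /= ?Ea ?Eb -?app_assoc.
  split=> //; have [_ _ _ -> _] := csev_ok hh E.
  have [h3 h3'] := wtp_ok E3.
  by rewrite e /= ep rwhisk_comp ?lrwhisk // ?src_rwhisk ?cod_comp ?dom_comp // hcl h3.
- by move=> s1 s2 h1 h2 h3; rewrite rwhisk_vcomp // h2.
- move=> l0 wl0; have [w1 e1] := pev_app wl wl0; have [h _] := wtp_ok wl0.
  by rewrite w1 e1 rwhisk_id2 // h.
- by move=> w1 [w2 w3]; split.
Qed.

Lemma ptens_nil l : ptens [] [] l = l.
Proof. by elim: l => //= -[x y z] l ->; rewrite /stens /= app_nil_r. Qed.

Lemma stens_stens X Y X' Y' s :
  stens X Y (stens X' Y' s) = stens (X ++ X') (Y' ++ Y) s.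
Proof. by rewrite /stens /= !app_assoc. Qed.

Lemma ok_tens X Y d c sl tl L s : ok (CNF d c sl tl L) s ->
  ok (CNF (X ++ d ++ Y) (X ++ c ++ Y) (ptens X Y sl) (ptens X Y tl) (map (ctens X Y) L))
    (wev X ⋉₂ (s ⋊₂ wev Y)).
Proof.
move=> [w k ->].
have [] := @chev_map d c sl L tl (X ++ d ++ Y) (X ++ c ++ Y) (ctens X Y) (ptens X Y)
  (fun s => wev X ⋉₂ (s ⋊₂ wev Y)) w k.
- move=> {}s a b h; have [n [E E3 E4 Ea Eb]] := proj1 (cbdP _ _ _ _ _) h.
  have [w1 w2 [k1 k2] e [hs ht]] := csev_ok h E.
  have [wq eq] := pev_tens X Y E3; have [wp ep] := pev_tens X Y E4.
  have hh : cbd (X ++ d ++ Y) (ctens X Y s) = Some (X ++ c ++ Y, ptens X Y a, ptens X Y b).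
  { apply/cbdP; exists n; rewrite /=; split=> //.
    + by rewrite wq !app_assoc.
    + by rewrite -wp !app_assoc.
    + rewrite Ea !map_app map_map; congr (_ ++ _ ++ _); apply: map_ext => z; exact: stens_stens.
    + rewrite Eb !map_app map_map; congr (_ ++ _ ++ _); apply: map_ext => z; exact: stens_stens. }
  split=> //; have [_ _ _ -> _] := csev_ok hh E.
  rewrite e /= eq.
  have -> : (X ++ cs_l s) ++ c_cod n ++ cs_r s ++ Y = X ++ (cs_l s ++ c_cod n ++ cs_r s) ++ Y.
    by rewrite !app_assoc.
  rewrite ep !wev_app ltens2_tensO rtens2_tensO -lrtens2.
  rewrite rtens2_lwhisk ?ltens2_lwhisk ?rtens2_rwhisk ?ltens2_rwhisk //.
  all: move: k1 k2; set core := (wev (cs_l s) ⋉₂ _) => k1 k2.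
  all: have k3 : dom (src (core ⋊₂ wev Y)) = cod (pev d (cs_q s) ⋊ wev Y)
    by rewrite src_rtens2 dom_rtens cod_rtens k1.
  all: have k4 : cod (src (core ▷ pev d (cs_q s))) = cod (src core)
    by rewrite src_rwhisk // cod_comp.
  all: have k5 : cod (src ((core ⋊₂ wev Y) ▷ (pev d (cs_q s) ⋊ wev Y)))
      = cod (src core) ⊗ wev Y
    by rewrite src_rwhisk // cod_comp // src_rtens2 cod_rtens.
  all: by rewrite ?k5 ?src_rtens2 ?dom_rtens ?cod_rtens ?k4 ?k1 ?k2.
- move=> s1 s2 h1 h2 h3; rewrite rtens2_vcomp // ltens2_vcomp //.
  by rewrite tgt_rtens2 src_rtens2 h1.
- move=> l0 wl0; have [w1 e1] := pev_tens X Y wl0.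
  by rewrite w1 e1 rtens2_id2 ltens2_id2.
- by move=> w1 [w2 w3]; split.
Qed.

Fixpoint cnorm (e : cexpr) : option cnf :=
  match e with
  | CVar i => cat_bd i
  | CId f =>
    match mnf f with
    | Some (PNF d l c) => Some (CNF d c l l [])
    | None => None
    end
  | CComp s t =>
    match cnorm s, cnorm t with
    | Some (CNF d c sl tl L), Some (CNF d' _ sl' tl' L') =>
      match word_dec d d', path_dec tl sl' with
      | left _, left _ => Some (CNF d c sl tl' (L ++ L'))
      | _, _ => None
      end
    | _, _ => None
    end
  | CLW f s =>
    match mnf f, cnorm s with
    | Some (PNF d' l c'), Some (CNF d c sl tl L) =>
      match word_dec d' c with
      | left _ => Some (CNF d c' (l ++ sl) (l ++ tl) (map (caddp l) L))
      | right _ => None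
      end
    | _, _ => None
    end
  | CRW s f =>
    match mnf f, cnorm s with
    | Some (PNF d' l c'), Some (CNF d c sl tl L) =>
      match word_dec c' d with
      | left _ => Some (CNF d' c (sl ++ l) (tl ++ l) (map (caddq l) L))
      | right _ => None
      end
    | _, _ => None
    end
  | CL o s =>
    match cnorm s with
    | Some (CNF d c sl tl L) => let X := oflat o in
      Some (CNF (X ++ d ++ []) (X ++ c ++ []) (ptens X [] sl) (ptens X [] tl)
        (map (ctens X []) L))
    | None => None
    end
  | CR s o =>
    match cnorm s with
    | Some (CNF d c sl tl L) => let X := oflat o in
      Some (CNF ([] ++ d ++ X) ([] ++ c ++ X) (ptens [] X sl) (ptens [] X tl)
        (map (ctens [] X) L))
    | None => None
    end
  end.

Lemma cnorm_ok e n : cnorm e = Some n -> ok n (cev e).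
Proof.
elim: e n => [i|f|s IHs t IHt|f s IH|s IH f|o s IH|s IH o] n /=.
- move=> h; have [w1 w2 hs ht hL] := cat_bd_ok h.
  case: n h w1 w2 hs ht hL => d c sl tl L h /= w1 w2 hs ht ->.
  have hb : cbd d (CSlice [] [] i [] []) = Some (c, sl, tl).
    by apply/cbdP; exists (CNF d c sl tl L); rewrite /= !app_nil_r !ptens_nil.
  split=> //=.
  by rewrite hb; case: path_dec.
- case E: (mnf f) => [[d l c]|] // [<-].
  by have [w ->] := mnf_ok E.
- case: (cnorm s) IHs => [[d c sl tl L]|] // /(_ _ erefl) [w1 k1 ->].
  case: (cnorm t) IHt => [[d' c' sl' tl' L']|] // /(_ _ erefl) [w2 k2 ->].
  case: word_dec => // ed; case: path_dec => // el [<-].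
  move: w2 k2; rewrite -{}ed -{}el => w2 k2.
  have [k e] := chev_app w1 k1 k2.
  by split.
- case E: (mnf f) => [[d' l c']|] //.
  case: (cnorm s) IH => [[d c sl tl L]|] // /(_ _ erefl) h.
  by case: word_dec => // e [<-]; apply: (ok_lw E); rewrite e.
- case E: (mnf f) => [[d' l c']|] //.
  case: (cnorm s) IH => [[d c sl tl L]|] // /(_ _ erefl) h.
  by case: word_dec => // e [<-]; apply: (ok_rw E); rewrite e.
- case: (cnorm s) IH => [[d c sl tl L]|] // /(_ _ erefl) h [<-].
  by have := ok_tens (oflat o) [] h; rewrite oflatE /= rtens2_unit.
- case: (cnorm s) IH => [[d c sl tl L]|] // /(_ _ erefl) h [<-].
  by have := ok_tens [] (oflat o) h; rewrite oflatE /= ltens2_unit.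
Qed.

Fixpoint qw (w : word) : oexpr :=
  match w with [] => OUnit | i :: w' => OTens (OVar i) (qw w') end.
Definition qs (s : slice) : mexpr := ML (qw (sl_l s)) (MR (MVar (sl_at s)) (qw (sl_r s))).
Fixpoint qp (d : word) (l : list slice) : mexpr :=
  match l with [] => MId (qw d) | s :: l' => MComp (qs s) (qp d l') end.
Definition qctx (d c : word) (p : list slice) (X : word) (e : cexpr) (Y : word)
    (q : list slice) : cexpr :=
  CLW (qp (X ++ c ++ Y) p) (CRW (CL (qw X) (CR e (qw Y))) (qp d q)).
Definition qc (d : word) (s : cslice) : cexpr :=
  match cat_bd (cs_at s) with
  | Some n => qctx d (c_cod n) (cs_p s) (cs_l s) (CVar (cs_at s)) (cs_r s) (cs_q s)
  | None => CVar (cs_at s)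
  end.
Fixpoint qL (d : word) (sl : list slice) (L : list cslice) : cexpr :=
  match L with
  | [] => CId (qp d sl)
  | s :: L' =>
    match cbd d s with Some (_, _, b) => CComp (qc d s) (qL d b L') | None => qc d s end
  end.

Lemma oev_qw w : oev (qw w) = wev w.
Proof. by elim: w => //= i w ->; case: w => //=; rewrite tensO1r. Qed.

Lemma mev_qs s : mev (qs s) = sev s.
Proof. by rewrite /sev ltE rtE /= !oev_qw. Qed.

Lemma mev_qp d l c : wtp d l = Some c -> mev (qp d l) = pev d l.
Proof.
elim: l c => [|s l IH] c; first by rewrite /= oev_qw.
move=> /wtp_cons [h _]; have [_ hc] := wtp_ok h.
by rewrite pev_cons // -(IH _ h) -mev_qs.
Qed.

Record ctx := Ctx { x_p : list slice; x_l : word; x_r : word; x_q : list slice }.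
Definition ctx0 := Ctx [] [] [] [].

Definition plug (n : cnf) (k len : nat) (x : ctx) (e1 e2 : cexpr) : option (cexpr * cexpr) :=
  let: CNF d _ sl _ L := n in
  match cnorm e1, chk d sl (firstn k L), chk d sl (firstn (k + len) L) with
  | Some n1, Some a, Some b =>
    let E e := CComp (qL d sl (firstn k L))
      (CComp (qctx d (c_cod n1) (x_p x) (x_l x) e (x_r x) (x_q x))
        (qL d b (skipn (k + len) L))) in
    Some (E e1, E e2)
  | _, _, _ => None
  end.

Definition ocnf_dec : forall a b : option cnf, {a = b} + {a <> b}.
Proof. decide equality; apply: cnf_dec. Defined.

Definition apply_at (e : cexpr) (k len : nat) (x : ctx) (e1 e2 : cexpr) : option cexpr :=
  match cnorm e with
  | Some n =>
    match plug n k len x e1 e2 with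
    | Some (f1, f2) => match ocnf_dec (cnorm f1) (Some n) with
                       | left _ => Some f2 | right _ => None end
    | None => None
    end
  | None => None
  end.

Lemma cnorm_eq e f n : cnorm e = Some n -> cnorm f = Some n -> cev e = cev f.
Proof.
by case: n => d c sl tl L /cnorm_ok [_ _ ->] /cnorm_ok [_ _ ->].
Qed.

Lemma apply_at_ok e k len x e1 e2 e' : apply_at e k len x e1 e2 = Some e' ->
  cev e1 = cev e2 -> cev e = cev e'.
Proof.
rewrite /apply_at; case En: (cnorm e) => [n|] //.
case Ep: (plug _ _ _ _ _ _) => [[f1 f2]|] //; case: ocnf_dec => // Ef [<-] E.
rewrite (cnorm_eq En Ef); case: n En Ep {Ef} => d c sl tl L _ /=.
case: (cnorm e1) => [n1|] //; case: (chk _ _ _) => [a|] //; case: (chk _ _ _) => [b|] //.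
by move=> [<- <-] /=; rewrite E.
Qed.

(* the two sides of the exchange law for S outside and T inside *)
Definition exch (S T : cexpr) : option (cexpr * cexpr) :=
  match cnorm S, cnorm T with
  | Some (CNF d c sl tl _), Some (CNF d' c' sl' tl' _) =>
    match word_dec d c' with
    | left _ => Some (CComp (CRW S (qp d' sl')) (CLW (qp d tl) T),
                      CComp (CLW (qp d sl) T) (CRW S (qp d' tl')))
    | right _ => None
    end
  | _, _ => None
  end.

Lemma exch_ok S T a b : exch S T = Some (a, b) -> cev a = cev b.
Proof.
rewrite /exch; case ES: (cnorm S) => [[d c sl tl L]|] //.
case ET: (cnorm T) => [[d' c' sl' tl' L']|] //.
case: word_dec => // e [<- <-] /=.
have [w k ->] := cnorm_ok ES; have [w' k' ->] := cnorm_ok ET.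
have [wt hs ht] := chev_ok w k; have [wt' hs' ht'] := chev_ok w' k'.
rewrite (mev_qp w) (mev_qp w') (mev_qp wt) (mev_qp wt') -hs -hs' -ht -ht'.
apply: whisk_exchange; rewrite hs hs'.
by have [-> _] := wtp_ok w; have [_ ->] := wtp_ok w'; rewrite e.
Qed.

Fixpoint strip_prefix (a b : list slice) : option (list slice) :=
  match a, b with
  | [], _ => Some b
  | x :: a', y :: b' => match slice_dec x y with
                        | left _ => strip_prefix a' b' | right _ => None end
  | _, _ => None
  end.
Definition strip_suffix (a b : list slice) : option (list slice) :=
  match strip_prefix (rev a) (rev b) with Some r => Some (rev r) | None => None end.
Fixpoint strip_wprefix (a b : word) : option word :=
  match a, b with
  | [], _ => Some b
  | x :: a', y :: b' => if Nat.eqb x y then strip_wprefix a' b' else None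
  | _, _ => None
  end.
Definition strip_wsuffix (a b : word) : option word :=
  match strip_wprefix (rev a) (rev b) with Some r => Some (rev r) | None => None end.

Definition swap_eq (d : word) (s1 s2 : cslice) : option (cexpr * cexpr) :=
  match cat_bd (cs_at s1), cat_bd (cs_at s2) with
  | Some n1, Some n2 =>
    let b1 := cs_p s1 ++ ptens (cs_l s1) (cs_r s1) (c_tgt n1) in
    let a2 := cs_p s2 ++ ptens (cs_l s2) (cs_r s2) (c_src n2) in
    let w1 := cs_l s1 ++ c_dom n1 ++ cs_r s1 in
    let w2 := cs_l s2 ++ c_dom n2 ++ cs_r s2 in
    match strip_prefix b1 (cs_p s2) with
    | Some r => exch (qc w1 (CSlice (cs_p s1) (cs_l s1) (cs_at s1) (cs_r s1) []))
                     (qc d (CSlice r (cs_l s2) (cs_at s2) (cs_r s2) (cs_q s2)))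
    | None =>
      match strip_prefix a2 (cs_p s1) with
      | Some r =>
        match exch (qc w2 (CSlice (cs_p s2) (cs_l s2) (cs_at s2) (cs_r s2) []))
                   (qc d (CSlice r (cs_l s1) (cs_at s1) (cs_r s1) (cs_q s1))) with
        | Some (a, b) => Some (b, a)
        | None => None
        end
      | None => None
      end
    end
  | _, _ => None
  end.

Lemma swap_eq_ok d s1 s2 a b : swap_eq d s1 s2 = Some (a, b) -> cev a = cev b.
Proof.
rewrite /swap_eq; case: (cat_bd _) => [n1|] //; case: (cat_bd _) => [n2|] //.
case: (strip_prefix _ _) => [r|]; first exact: exch_ok.
case: (strip_prefix _ _) => [r|] //.
case E: (exch _ _) => [[a' b']|] // [<- <-].
by rewrite (exch_ok E).
Qed.

Definition swap_chain (d : word) (L : list cslice) (k : nat) : option (list cslice) :=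
  match skipn k L with
  | s1 :: s2 :: L' =>
    match swap_eq d s1 s2 with
    | Some (_, b) => match cnorm b with
                     | Some n => Some (firstn k L ++ c_chain n ++ L') | None => None end
    | None => None
    end
  | _ => None
  end.

Definition swap_at (e : cexpr) (k : nat) : option cexpr :=
  match cnorm e with
  | Some n =>
    match skipn k (c_chain n) with
    | s1 :: s2 :: _ =>
      match swap_eq (c_dom n) s1 s2 with
      | Some (a, b) => apply_at e k 2 ctx0 a b
      | None => None
      end
    | _ => None
    end
  | None => None
  end.

Lemma swap_at_ok e k e' : swap_at e k = Some e' -> cev e = cev e'.
Proof.
rewrite /swap_at; case: (cnorm e) => [n|] //; case: (skipn _ _) => [|s1 [|s2 _]] //.
case E: (swap_eq _ _ _) => [[a b]|] // h; exact: apply_at_ok h (swap_eq_ok E).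
Qed.

Fixpoint swaps (e : cexpr) (ks : list nat) : option cexpr :=
  match ks with
  | [] => Some e
  | k :: ks' => match swap_at e k with Some e' => swaps e' ks' | None => None end
  end.

Lemma swaps_ok ks e e' : swaps e ks = Some e' -> cev e = cev e'.
Proof.
elim: ks e => [|k ks IH] e /=; first by move=> [->].
by case E: (swap_at e k) => [f|] // /IH <-; exact: swap_at_ok E.
Qed.

(* The functions from [bubble] to [find] carry no correctness proof: they only propose
   adjacent exchanges, which [swaps] checks. *)
Fixpoint bubble (d : word) (fuel : nat) (L : list cslice) (j i : nat) (ks : list nat) :
    option (list cslice * list nat) :=
  match fuel with
  | 0 => None
  | S fuel' =>
    if Nat.leb j i then Some (L, ks) else
    match swap_chain d L (Nat.pred j) with
    | Some L' => bubble d fuel' L' (Nat.pred j) i (ks ++ [Nat.pred j])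
    | None => None
    end
  end.

Definition in_ctx (x : ctx) (s : cslice) : cslice :=
  CSlice (x_p x ++ ptens (x_l x) (x_r x) (cs_p s)) (x_l x ++ cs_l s) (cs_at s)
    (cs_r s ++ x_r x) (ptens (x_l x) (x_r x) (cs_q s) ++ x_q x).

Definition get_ctx (t s : cslice) : option ctx :=
  if Nat.eqb (cs_at t) (cs_at s) then
    match strip_wsuffix (cs_l t) (cs_l s), strip_wprefix (cs_r t) (cs_r s) with
    | Some X, Some Y =>
      match strip_suffix (ptens X Y (cs_p t)) (cs_p s),
            strip_prefix (ptens X Y (cs_q t)) (cs_q s) with
      | Some p, Some q => Some (Ctx p X Y q)
      | _, _ => None
      end
    | _, _ => None
    end
  else None.

Fixpoint gather1 (d : word) (x : ctx) (t : cslice) (L : list cslice) (i : nat)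
    (js : list nat) (ks : list nat) : option (list cslice * list nat) :=
  match js with
  | [] => None
  | j :: js' =>
    let next := gather1 d x t L i js' ks in
    match nth_error L j with
    | Some s =>
      if Nat.eqb (cs_at s) (cs_at t) then
        match bubble d (S (length L)) L j i ks with
        | Some (L', ks') =>
          match nth_error L' i with
          | Some s' => match cslice_dec s' (in_ctx x t) with
                       | left _ => Some (L', ks') | right _ => next end
          | None => next
          end
        | None => next
        end
      else next
    | None => next
    end
  end.

Fixpoint gather (d : word) (x : ctx) (ts : list cslice) (L : list cslice) (i : nat)
    (ks : list nat) : option (list nat) :=
  match ts with
  | [] => Some ks
  | t :: ts' =>
    match gather1 d x t L i (seq i (length L - i)) ks with
    | Some (L', ks') => gather d x ts' L' (S i) ks'
    | None => None
    end
  end.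

(* the chain ts starting at position i, possibly after moving slice i to the
   right or to the left *)
Fixpoint match_at (d : word) (fuel : nat) (left : bool) (ts : list cslice)
    (L : list cslice) (i : nat) (ks : list nat) : option (nat * ctx * list nat) :=
  match fuel with
  | 0 => None
  | S fuel' =>
    match ts, nth_error L i with
    | t :: ts', Some s =>
      let next :=
        if left then
          match i with
          | 0 => None
          | S i' =>
            match swap_chain d L i' with
            | Some L' => match_at d fuel' left ts L' i' (ks ++ [i'])
            | None => None
            end
          end
        else
          match swap_chain d L i with
          | Some L' => match_at d fuel' left ts L' (S i) (ks ++ [i])
          | None => None
          end in
      match get_ctx t s with
      | Some x => match gather d x ts' L (S i) ks with
                  | Some ks' => Some (i, x, ks')
                  | None => next
                  end
      | None => next
      end
    | _, _ => None
    end
  end.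

(* move to the left of slice i all the following slices that can go there *)
Fixpoint hoist (d : word) (L : list cslice) (i : nat) (js : list nat) (ks : list nat) :
    list cslice * nat * list nat :=
  match js with
  | [] => (L, i, ks)
  | j :: js' =>
    match bubble d (S (length L)) L j i ks with
    | Some (L', ks') => hoist d L' (S i) js' ks'
    | None => hoist d L i js' ks
    end
  end.

Definition match_any (d : word) (ts L : list cslice) (i : nat) :
    option (nat * ctx * list nat) :=
  let n := length L in
  match match_at d n false ts L i [] with
  | Some r => Some r
  | None =>
    match match_at d n true ts L i [] with
    | Some r => Some r
    | None =>
      let: (L', i', ks) := hoist d L i (seq (S i) (n - S i)) [] in
      match_at d n false ts L' i' ks
    end
  end.

Fixpoint find (d : word) (ts : list cslice) (L : list cslice) (ps : list nat) (occ : nat) :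
    option (nat * ctx * list nat) :=
  match ps with
  | [] => None
  | i :: ps' =>
    match ts, nth_error L i with
    | t :: _, Some s =>
      if Nat.eqb (cs_at t) (cs_at s) then
        match match_any d ts L i with
        | Some r => match occ with 0 => Some r | S occ' => find d ts L ps' occ' end
        | None => find d ts L ps' occ
        end
      else find d ts L ps' occ
    | _, _ => None
    end
  end.

Definition rewrite_step (occ : nat) (e e1 e2 : cexpr) : option cexpr :=
  match cnorm e, cnorm e1 with
  | Some n, Some n1 =>
    match find (c_dom n) (c_chain n1) (c_chain n) (seq 0 (length (c_chain n))) occ with
    | Some (i, x, ks) =>
      match swaps e ks with
      | Some e' => apply_at e' i (length (c_chain n1)) x e1 e2
      | None => None
      end
    | None => None
    end
  | _, _ => None
  end.

Lemma rewrite_step_ok occ e e1 e2 e' : rewrite_step occ e e1 e2 = Some e' ->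
  cev e1 = cev e2 -> cev e = cev e'.
Proof.
rewrite /rewrite_step; case: (cnorm e) => [n|] //; case: (cnorm e1) => [n1|] //.
case: (find _ _ _ _ _) => [[[i x] ks]|] //; case E: (swaps e ks) => [f|] // h h'.
by rewrite (swaps_ok E); exact: apply_at_ok h h'.
Qed.

Definition same (e f : cexpr) : bool :=
  match cnorm e, cnorm f with
  | Some n, Some n' =>
    match ocnf_dec (Some n) (Some n') with
    | left _ => true
    | right _ =>
      match gather (c_dom n) ctx0 (c_chain n') (c_chain n) 0 [] with
      | Some ks =>
        match swaps e ks with
        | Some e' => match ocnf_dec (cnorm e') (Some n') with
                     | left _ => true | right _ => false end
        | None => false
        end
      | None => false
      end
    end
  | _, _ => false
  end.

Lemma same_ok e f : same e f = true -> cev e = cev f.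
Proof.
rewrite /same; case E: (cnorm e) => [n|] //; case F: (cnorm f) => [n'|] //.
case: ocnf_dec => [h _|_]; first by apply: (cnorm_eq E); rewrite F h.
case: (gather _ _ _ _ _ _) => [ks|] //; case Ek: (swaps e ks) => [e'|] //.
by case: ocnf_dec => // h _; rewrite (swaps_ok Ek); apply: (cnorm_eq h).
Qed.

Definition src_is (e : cexpr) (f : mexpr) : bool :=
  match cnorm e, mnf f with
  | Some n, Some k =>
    match word_dec (c_dom n) (p_dom k), path_dec (c_src n) (p_path k) with
    | left _, left _ => true | _, _ => false end
  | _, _ => false
  end.
Definition tgt_is (e : cexpr) (f : mexpr) : bool :=
  match cnorm e, mnf f with
  | Some n, Some k =>
    match word_dec (c_dom n) (p_dom k), path_dec (c_tgt n) (p_path k) with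
    | left _, left _ => true | _, _ => false end
  | _, _ => false
  end.

Lemma src_is_ok e f : src_is e f = true -> src (cev e) = mev f.
Proof.
rewrite /src_is; case E: (cnorm e) => [[d c sl tl L]|] //; case F: (mnf f) => [[d' l c']|] //.
case: word_dec => //= ed; case: path_dec => //= el _.
have [w k ->] := cnorm_ok E; have [_ -> _] := chev_ok w k; have [_ ->] := mnf_ok F.
by rewrite ed el.
Qed.
Lemma tgt_is_ok e f : tgt_is e f = true -> tgt (cev e) = mev f.
Proof.
rewrite /tgt_is; case E: (cnorm e) => [[d c sl tl L]|] //; case F: (mnf f) => [[d' l c']|] //.
case: word_dec => //= ed; case: path_dec => //= el _.
have [w k ->] := cnorm_ok E; have [_ _ ->] := chev_ok w k; have [_ ->] := mnf_ok F.
by rewrite ed el.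
Qed.

Definition mor_eq (f g : mexpr) : bool :=
  match mnf f, mnf g with
  | Some k, Some k' =>
    match word_dec (p_dom k) (p_dom k'), path_dec (p_path k) (p_path k') with
    | left _, left _ => true | _, _ => false end
  | _, _ => false
  end.
Lemma mor_eq_ok f g : mor_eq f g = true -> mev f = mev g.
Proof.
rewrite /mor_eq; case E: (mnf f) => [[d l c]|] //; case F: (mnf g) => [[d' l' c']|] //.
case: word_dec => //= ed; case: path_dec => //= el _.
by have [_ ->] := mnf_ok E; have [_ ->] := mnf_ok F; rewrite ed el.
Qed.

Lemma cnorm_chev e d c sl tl L : cnorm e = Some (CNF d c sl tl L) ->
  cev e = chev d sl L.
Proof. by move=> /cnorm_ok [_ _ ->]. Qed.
End Eval.

(** * Gray monoids and pseudomonoids *)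

Section TypedCells.
Variable M : gray_monoid.
Implicit Types (W X Y Z : Ob M).

Definition hom_lt X (x y : Ob M) (f : hom x y) : hom (X ⊗ x) (X ⊗ y).
Proof. by exists (X ⋉ f); bd. Defined.
Definition hom_rt (x y : Ob M) (f : hom x y) X : hom (x ⊗ X) (y ⊗ X).
Proof. by exists (f ⋊ X); bd. Defined.

Definition hom_cast (x x' y : Ob M) (e : x = x') (f : hom x y) : hom x' y :=
  Hom (etrans (hom_dom f) e) (hom_cod f).

Definition hom_castr (x y y' : Ob M) (e : y = y') (f : hom x y) : hom x y' :=
  Hom (hom_dom f) (etrans (hom_cod f) e).

Lemma iso_ltK X (f g : Mor M) (s : cell f g) (t : cell g f) :
  s ∙ t = id2 f -> (X ⋉₂ s) ∙ (X ⋉₂ t) = id2 (X ⋉ f).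
Proof. by move=> E; rewrite -ltens2_vcomp ?E ?ltens2_id2 //; bd. Qed.
Lemma iso_rtK X (f g : Mor M) (s : cell f g) (t : cell g f) :
  s ∙ t = id2 f -> (s ⋊₂ X) ∙ (t ⋊₂ X) = id2 (f ⋊ X).
Proof. by move=> E; rewrite -rtens2_vcomp ?E ?rtens2_id2 //; bd. Qed.

Lemma ltens2_bd X (f g : Mor M) (s : cell f g) :
  src (X ⋉₂ s) = X ⋉ f /\ tgt (X ⋉₂ s) = X ⋉ g.
Proof. by split; bd. Qed.
Lemma rtens2_bd X (f g : Mor M) (s : cell f g) :
  src (s ⋊₂ X) = f ⋊ X /\ tgt (s ⋊₂ X) = g ⋊ X.
Proof. by split; bd. Qed.
Definition cell_lt X (f g : Mor M) (s : cell f g) : cell (X ⋉ f) (X ⋉ g) :=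
  MkCell (proj1 (ltens2_bd X s)) (proj2 (ltens2_bd X s)).
Definition cell_rt (f g : Mor M) (s : cell f g) X : cell (f ⋊ X) (g ⋊ X) :=
  MkCell (proj1 (rtens2_bd X s)) (proj2 (rtens2_bd X s)).
Definition iso_lt X (f g : Mor M) (s : iso2 f g) : iso2 (X ⋉ f) (X ⋉ g) :=
  Iso2 (iso_fwd := cell_lt X s) (iso_bwd := cell_lt X s^-1)
    (iso_ltK X (iso_fwdK s)) (iso_ltK X (iso_bwdK s)).
Definition iso_rt (f g : Mor M) (s : iso2 f g) X : iso2 (f ⋊ X) (g ⋊ X) :=
  Iso2 (iso_fwd := cell_rt s X) (iso_bwd := cell_rt s^-1 X)
    (iso_rtK X (iso_fwdK s)) (iso_rtK X (iso_bwdK s)).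

Definition ich (x x' y y' : Ob M) (f : hom x x') (g : hom y y') :
  iso2 ((f ⋊ y') ∘ (x ⋉ g)) ((x' ⋉ g) ∘ (f ⋊ y)).
Proof. apply: (iso_cast _ _ (interchange f g)); bd. Defined.

Section Laws.
Variables (x x' x'' y y' y'' : Ob M).
Implicit Types (f : hom x x') (g : hom y y').

Lemma ich_comp_l (f' : hom x' x'') f g :
  ich (hom_comp f' f) g = ((f' ⋊ y') ◁ ich f g) ∙ (ich f' g ▷ (f ⋊ y)) :> Cell M.
Proof.
case: g f f' => g gy gy' [f fx fx'] f' /=; case: _ / gy; case: _ / gy'.
move: f'; case: _ / fx' => f'.
exact/interchange_comp_l/hom_dom.
Qed.
Lemma ich_comp_r f (g' : hom y' y'') g :
  ich f (hom_comp g' g) = (ich f g' ▷ (x ⋉ g)) ∙ ((x' ⋉ g') ◁ ich f g) :> Cell M.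
Proof.
case: f g g' => f fx fx' [g gy gy'] g' /=; case: _ / fx; case: _ / fx'.
move: g'; case: _ / gy' => g'.
exact/interchange_comp_r/hom_dom.
Qed.
Lemma ich_lt X f g : ich (hom_lt X f) g = X ⋉₂ ich f g :> Cell M.
Proof. by rewrite /= interchange_ltens. Qed.
Lemma ich_mid f X g : ich (hom_rt f X) g = ich f (hom_lt X g) :> Cell M.
Proof. by rewrite /= interchange_mid. Qed.
Lemma ich_rt X f g : ich f (hom_rt g X) = ich f g ⋊₂ X :> Cell M.
Proof. by rewrite /= interchange_rtens. Qed.
Lemma ich_id_l X g : ich (hom_id X) g = id2 (X ⋉ g) :> Cell M.
Proof. by rewrite /= interchange_id1_l. Qed.
Lemma ich_id_r X f : ich f (hom_id X) = id2 (f ⋊ X) :> Cell M.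
Proof. by rewrite /= interchange_id1_r. Qed.
Lemma ich_nat_l (f f' : hom x x') (s : cell f f') g :
  ((s ⋊₂ y') ▷ (x ⋉ g)) ∙ ich f' g = ich f g ∙ ((x' ⋉ g) ◁ (s ⋊₂ y)).
Proof.
case: g f f' s => g gy gy' [f fx fx'] [f' fy fy'] [s sf sg] /=; simpl in *.
by subst; exact: interchange_nat_l.
Qed.
Lemma ich_nat_r f (g g' : hom y y') (s : cell g g') :
  ((f ⋊ y') ◁ (x ⋉₂ s)) ∙ ich f g' = ich f g ∙ ((x' ⋉₂ s) ▷ (f ⋊ y)).
Proof.
case: f g g' s => f fx fx' [g gy gy'] [g' gz gz'] [s sf sg] /=; simpl in *.
by subst; exact: interchange_nat_r.
Qed.
End Laws.
End TypedCells.

Section Star.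
Variables (M : gray_monoid) (A : Ob M) (P : pseudomonoid A).
Notation m := (pm_mul P).

(* stl and str are the two whiskerings of 2-cells by *, res is the restriction isomorphism
   (x f) * y ≅ (x * y)(f ⊗ Y), and al below is the associativity isomorphism. *)
Definition star (X Y : Ob M) (x : hom X A) (y : hom Y A) : hom (X ⊗ Y) A.
Proof. by exists (m ∘ ((x ⋊ A) ∘ (X ⋉ y))); bd. Defined.
Definition stl (X : Ob M) (a : Cell M) (y : Mor M) : Cell M := m ◁ ((a ⋊₂ A) ▷ (X ⋉ y)).
Definition str (X : Ob M) (x : Mor M) (b : Cell M) : Cell M := (m ∘ (x ⋊ A)) ◁ (X ⋉₂ b).

Definition iso_str (X Y : Ob M) (x : hom X A) (y y' : hom Y A) (s : iso2 y y') :
  iso2 (star x y) (star x y').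
Proof.
refine (iso_cast _ _ (iso_lwhisk (k := m ∘ (x ⋊ A)) (iso_lt X s) _)); rewrite /=; bd.
Defined.
Definition iso_stl (X Y : Ob M) (x x' : hom X A) (s : iso2 x x') (y : hom Y A) :
  iso2 (star x y) (star x' y).
Proof.
refine (iso_cast erefl erefl (iso_lwhisk (k := m)
  (iso_rwhisk (iso_rt s A) (k := X ⋉ y) _) _)); rewrite /=; bd.
Defined.
Definition res (W X Y : Ob M) (x : hom X A) (f : hom W X) (y : hom Y A) :
  iso2 (star (hom_comp x f) y) (star x y ∘ (f ⋊ Y)).
Proof.
refine (iso_cast _ _ (iso_lwhisk (k := m ∘ (x ⋊ A)) (ich f y) _)); rewrite /=; bd.
Defined.

End Star.

Ltac addto x l :=
  match l with
  | context [cons x _] => l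
  | _ => constr:(cons x l)
  end.
Ltac index x l :=
  match l with
  | cons x _ => constr:(0)
  | cons _ ?l' => let n := index x l' in constr:(S n)
  end.

Ltac colO t os :=
  match t with
  | tensO ?a ?b => let os := colO a os in colO b os
  | unitO => os
  | _ => addto t os
  end.
(* st is a triple (objects, 1-cell atoms, 2-cell atoms) *)
Ltac colOs t st :=
  match st with (?os, ?ms, ?cs) => let os := colO t os in constr:((os, ms, cs)) end.
Ltac colM t st :=
  match t with
  | comp ?g ?f => let st := colM g st in colM f st
  | id1 ?X => colOs X st
  | ltens ?X ?f => let st := colOs X st in colM f st
  | rtens ?f ?X => let st := colOs X st in colM f st
  | hom_mor ?h => colH h st
  end
with colH h st :=
  match h with
  | @star ?M ?A ?P ?X ?Y ?x ?y =>
    let st := colOs A st in let st := colOs X st in let st := colH (pm_mul P) st in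
    let st := colH x st in colH y st
  | hom_comp ?g ?f => let st := colH g st in colH f st
  | hom_id ?X => colOs X st
  | hom_cast _ ?f => colH f st
  | hom_castr _ ?f => colH f st
  | hom_lt ?X ?f => let st := colOs X st in colH f st
  | hom_rt ?f ?X => let st := colOs X st in colH f st
  | cp_mor (cp_restrict ?u ?f) => let st := colH (cp_mor u) st in colH f st
  | _ =>
    match type of h with hom ?X ?Y =>
      let st := colOs X st in let st := colOs Y st in
      match st with (?os, ?ms, ?cs) =>
        let ms := addto (hom_mor h) ms in constr:((os, ms, cs)) end end
  end.
Ltac colC t st :=
  match t with
  | vcomp ?a ?b => let st := colC a st in colC b st
  | lwhisk ?f ?a => let st := colM f st in colC a st
  | rwhisk ?a ?f => let st := colM f st in colC a st
  | ltens2 ?X ?a => let st := colOs X st in colC a st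
  | rtens2 ?a ?X => let st := colOs X st in colC a st
  | id2 ?f => colM f st
  | @stl ?M ?A ?P ?X ?a ?y =>
    let st := colOs A st in let st := colOs X st in let st := colH (pm_mul P) st in
    let st := colC a st in colM y st
  | @str ?M ?A ?P ?X ?x ?b =>
    let st := colOs A st in let st := colOs X st in let st := colH (pm_mul P) st in
    let st := colM x st in colC b st
  | cell_val ?s => colS s st
  end
with colS s st :=
  match s with
  | iso_fwd (iso_inv ?i) => colS (iso_bwd i) st
  | iso_bwd (iso_inv ?i) => colS (iso_fwd i) st
  | iso_fwd (iso_cast _ _ ?i) => colS (iso_fwd i) st
  | iso_bwd (iso_cast _ _ ?i) => colS (iso_bwd i) st
  | iso_fwd (iso_vcomp ?i ?j) => let st := colS (iso_fwd i) st in colS (iso_fwd j) st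
  | iso_bwd (iso_vcomp ?i ?j) => let st := colS (iso_bwd i) st in colS (iso_bwd j) st
  | iso_fwd (@iso_lwhisk _ ?f _ _ ?i _) => let st := colM f st in colS (iso_fwd i) st
  | iso_bwd (@iso_lwhisk _ ?f _ _ ?i _) => let st := colM f st in colS (iso_bwd i) st
  | iso_fwd (@iso_rwhisk _ _ _ ?i ?f _) => let st := colM f st in colS (iso_fwd i) st
  | iso_bwd (@iso_rwhisk _ _ _ ?i ?f _) => let st := colM f st in colS (iso_bwd i) st
  | iso_fwd (@res ?M ?A ?P ?W ?X ?Y ?x ?f ?y) =>
    colC (((pm_mul P) ∘ (x ⋊ A)) ◁ cell_val (iso_fwd (ich f y))) st
  | iso_bwd (@res ?M ?A ?P ?W ?X ?Y ?x ?f ?y) =>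
    colC (((pm_mul P) ∘ (x ⋊ A)) ◁ cell_val (iso_bwd (ich f y))) st
  | iso_fwd (@iso_str ?M ?A ?P ?X ?Y ?x _ _ ?i) => colC (@str M A P X x (iso_fwd i)) st
  | iso_bwd (@iso_str ?M ?A ?P ?X ?Y ?x _ _ ?i) => colC (@str M A P X x (iso_bwd i)) st
  | iso_fwd (@iso_stl ?M ?A ?P ?X ?Y _ _ ?i ?y) => colC (@stl M A P X (iso_fwd i) y) st
  | iso_bwd (@iso_stl ?M ?A ?P ?X ?Y _ _ ?i ?y) => colC (@stl M A P X (iso_bwd i) y) st
  | iso_fwd (iso_lt ?X ?i) => let st := colOs X st in colS (iso_fwd i) st
  | iso_bwd (iso_lt ?X ?i) => let st := colOs X st in colS (iso_bwd i) st
  | iso_fwd (iso_rt ?i ?X) => let st := colOs X st in colS (iso_fwd i) st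
  | iso_bwd (iso_rt ?i ?X) => let st := colOs X st in colS (iso_bwd i) st
  | cell_cast _ _ ?a => colS a st
  | @cell_lwhisk _ ?f _ _ ?a _ => let st := colM f st in colS a st
  | @cell_rwhisk _ _ _ ?a ?f _ => let st := colM f st in colS a st
  | cell_vcomp ?a ?b => let st := colS a st in colS b st
  | cell_id ?f => colM f st
  | _ =>
    match type of s with cell ?f ?g =>
      let st := colM f st in let st := colM g st in
      match st with (?os, ?ms, ?cs) =>
        let cs := addto (cell_val s) cs in constr:((os, ms, cs)) end end
  end.

Ltac trO t os :=
  match t with
  | tensO ?a ?b => let a := trO a os in let b := trO b os in constr:(OTens a b)
  | unitO => constr:(OUnit)
  | _ => let n := index t os in constr:(OVar n)
  end.
Ltac trM t os ms :=
  match t with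
  | comp ?g ?f => let g := trM g os ms in let f := trM f os ms in constr:(MComp g f)
  | id1 ?X => let X := trO X os in constr:(MId X)
  | ltens ?X ?f => let X := trO X os in let f := trM f os ms in constr:(ML X f)
  | rtens ?f ?X => let X := trO X os in let f := trM f os ms in constr:(MR f X)
  | hom_mor ?h => trH h os ms
  end
with trH h os ms :=
  match h with
  | @star ?M ?A ?P ?X ?Y ?x ?y =>
    let A := trO A os in let X := trO X os in let p := trH (pm_mul P) os ms in
    let x := trH x os ms in let y := trH y os ms in
    constr:(MComp p (MComp (MR x A) (ML X y)))
  | hom_comp ?g ?f => let g := trH g os ms in let f := trH f os ms in constr:(MComp g f)
  | hom_id ?X => let X := trO X os in constr:(MId X)
  | hom_cast _ ?f => trH f os ms
  | hom_castr _ ?f => trH f os ms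
  | hom_lt ?X ?f => let X := trO X os in let f := trH f os ms in constr:(ML X f)
  | hom_rt ?f ?X => let X := trO X os in let f := trH f os ms in constr:(MR f X)
  | cp_mor (cp_restrict ?u ?f) =>
    let g := trH (cp_mor u) os ms in let f := trH f os ms in constr:(MComp g f)
  | _ => let n := index (hom_mor h) ms in constr:(MVar n)
  end.
Ltac trC t os ms cs :=
  match t with
  | vcomp ?a ?b =>
    let a := trC a os ms cs in let b := trC b os ms cs in constr:(CComp a b)
  | lwhisk ?f ?a => let f := trM f os ms in let a := trC a os ms cs in constr:(CLW f a)
  | rwhisk ?a ?f => let f := trM f os ms in let a := trC a os ms cs in constr:(CRW a f)
  | ltens2 ?X ?a => let X := trO X os in let a := trC a os ms cs in constr:(CL X a)
  | rtens2 ?a ?X => let X := trO X os in let a := trC a os ms cs in constr:(CR a X)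
  | id2 ?f => let f := trM f os ms in constr:(CId f)
  | @stl ?M ?A ?P ?X ?a ?y =>
    let A := trO A os in let X := trO X os in let p := trH (pm_mul P) os ms in
    let a := trC a os ms cs in let y := trM y os ms in
    constr:(CLW p (CRW (CR a A) (ML X y)))
  | @str ?M ?A ?P ?X ?x ?b =>
    let A := trO A os in let X := trO X os in let p := trH (pm_mul P) os ms in
    let x := trM x os ms in let b := trC b os ms cs in
    constr:(CLW (MComp p (MR x A)) (CL X b))
  | cell_val ?s => trS s os ms cs
  end
with trS s os ms cs :=
  match s with
  | iso_fwd (iso_inv ?i) => trS (iso_bwd i) os ms cs
  | iso_bwd (iso_inv ?i) => trS (iso_fwd i) os ms cs
  | iso_fwd (iso_cast _ _ ?i) => trS (iso_fwd i) os ms cs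
  | iso_bwd (iso_cast _ _ ?i) => trS (iso_bwd i) os ms cs
  | iso_fwd (iso_vcomp ?i ?j) =>
    let a := trS (iso_fwd i) os ms cs in let b := trS (iso_fwd j) os ms cs in
    constr:(CComp a b)
  | iso_bwd (iso_vcomp ?i ?j) =>
    let a := trS (iso_bwd i) os ms cs in let b := trS (iso_bwd j) os ms cs in
    constr:(CComp b a)
  | iso_fwd (@iso_lwhisk _ ?f _ _ ?i _) =>
    let f := trM f os ms in let a := trS (iso_fwd i) os ms cs in constr:(CLW f a)
  | iso_bwd (@iso_lwhisk _ ?f _ _ ?i _) =>
    let f := trM f os ms in let a := trS (iso_bwd i) os ms cs in constr:(CLW f a)
  | iso_fwd (@iso_rwhisk _ _ _ ?i ?f _) =>
    let f := trM f os ms in let a := trS (iso_fwd i) os ms cs in constr:(CRW a f)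
  | iso_bwd (@iso_rwhisk _ _ _ ?i ?f _) =>
    let f := trM f os ms in let a := trS (iso_bwd i) os ms cs in constr:(CRW a f)
  | iso_fwd (@res ?M ?A ?P ?W ?X ?Y ?x ?f ?y) =>
    trC (((pm_mul P) ∘ (x ⋊ A)) ◁ cell_val (iso_fwd (ich f y))) os ms cs
  | iso_bwd (@res ?M ?A ?P ?W ?X ?Y ?x ?f ?y) =>
    trC (((pm_mul P) ∘ (x ⋊ A)) ◁ cell_val (iso_bwd (ich f y))) os ms cs
  | iso_fwd (@iso_str ?M ?A ?P ?X ?Y ?x _ _ ?i) => trC (@str M A P X x (iso_fwd i)) os ms cs
  | iso_bwd (@iso_str ?M ?A ?P ?X ?Y ?x _ _ ?i) => trC (@str M A P X x (iso_bwd i)) os ms cs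
  | iso_fwd (@iso_stl ?M ?A ?P ?X ?Y _ _ ?i ?y) => trC (@stl M A P X (iso_fwd i) y) os ms cs
  | iso_bwd (@iso_stl ?M ?A ?P ?X ?Y _ _ ?i ?y) => trC (@stl M A P X (iso_bwd i) y) os ms cs
  | iso_fwd (iso_lt ?X ?i) =>
    let X := trO X os in let a := trS (iso_fwd i) os ms cs in constr:(CL X a)
  | iso_bwd (iso_lt ?X ?i) =>
    let X := trO X os in let a := trS (iso_bwd i) os ms cs in constr:(CL X a)
  | iso_fwd (iso_rt ?i ?X) =>
    let X := trO X os in let a := trS (iso_fwd i) os ms cs in constr:(CR a X)
  | iso_bwd (iso_rt ?i ?X) =>
    let X := trO X os in let a := trS (iso_bwd i) os ms cs in constr:(CR a X)
  | cell_cast _ _ ?a => trS a os ms cs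
  | @cell_lwhisk _ ?f _ _ ?a _ =>
    let f := trM f os ms in let a := trS a os ms cs in constr:(CLW f a)
  | @cell_rwhisk _ _ _ ?a ?f _ =>
    let f := trM f os ms in let a := trS a os ms cs in constr:(CRW a f)
  | cell_vcomp ?a ?b =>
    let a := trS a os ms cs in let b := trS b os ms cs in constr:(CComp a b)
  | cell_id ?f => let f := trM f os ms in constr:(CId f)
  | _ => let n := index (cell_val s) cs in constr:(CVar n)
  end.

Ltac mkem M os ms0 ms :=
  match ms with
  | nil => constr:(@nil (@matom M os))
  | cons (hom_mor ?h) ?ms' =>
    match type of h with hom ?X ?Y =>
      let X := trO X os in let Y := trO Y os in
      let r := mkem M os ms0 ms' in
      constr:(cons (@MAtom M os (hom_mor h) X Y (hom_dom h) (hom_cod h)) r)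
    end
  end.
Ltac mkec M os em ms cs :=
  match cs with
  | nil => constr:(@nil (@catom M os em))
  | cons (cell_val ?s) ?cs' =>
    match type of s with cell ?f ?g =>
      let f := trM f os ms in let g := trM g os ms in
      let r := mkec M os em ms cs' in
      constr:(cons (@CAtom M os em (cell_val s) f g (cell_src s) (cell_tgt s)) r)
    end
  end.

Ltac gray_of C := match C with gm_2cat ?M => M end.

Ltac readable :=
  cbv beta iota zeta delta [chev csev lw rw lt2 rt2 pev sev ltw rtw wev ca ma nth
    cs_p cs_l cs_at cs_r cs_q sl_l sl_at sl_r].

Ltac shownf :=
  match goal with
  | |- @cev ?M ?eo ?em ?ec ?e = _ =>
    let n := eval vm_compute in (@cnorm M eo em ec e) in
    match n with Some (CNF ?d ?c ?sl ?tl ?L) =>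
      refine (eq_trans (@cnorm_chev M eo em ec e d c sl tl L _) _);
      [ vm_cast_no_check (@eq_refl (option cnf) n) | readable ]
    end
  end.

(* Rewrites the left-hand side along the whiskering of E that is found, up to exchange, at
   occurrence [occ]. *)
Ltac rwn occ E :=
  let T := type of E in
  match goal with |- @eq ?CT ?l ?r =>
  match T with ?a = ?b =>
  match CT with @Cell ?C => let M := gray_of C in
    let st := constr:((@nil (Ob C), @nil (Mor C), @nil (Cell C))) in
    let st := colC l st in let st := colC a st in let st := colC b st in
    match st with (?os, ?ms, ?cs) =>
      let em := mkem M os ms ms in
      let ec := mkec M os em ms cs in
      let el := trC l os ms cs in let ea := trC a os ms cs in let eb := trC b os ms cs in
      let res := eval vm_compute in (@rewrite_step M os em ec occ el ea eb) in
      match res with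
      | Some ?e' =>
        refine (@eq_trans _ l (@cev M os em ec e') r
          (@rewrite_step_ok M os em ec occ el ea eb e' _ E) _);
        [ vm_cast_no_check (@eq_refl (option cexpr) res) | shownf ]
      | _ => fail 1 "no instance"
      end
    end
  end end end.
Ltac rw E := rwn 0 E.
Ltac rwr E := rwn 0 (esym E).

Ltac nrm :=
  match goal with |- @eq ?CT ?l ?r =>
  match CT with @Cell ?C => let M := gray_of C in
    let st := constr:((@nil (Ob C), @nil (Mor C), @nil (Cell C))) in
    let st := colC l st in
    match st with (?os, ?ms, ?cs) =>
      let em := mkem M os ms ms in
      let ec := mkec M os em ms cs in
      let el := trC l os ms cs in
      change (@cev M os em ec el = r); shownf
    end
  end end.

Ltac pasting :=
  match goal with |- @eq ?CT ?l ?r =>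
  match CT with @Cell ?C => let M := gray_of C in
    let st := constr:((@nil (Ob C), @nil (Mor C), @nil (Cell C))) in
    let st := colC l st in let st := colC r st in
    match st with (?os, ?ms, ?cs) =>
      let em := mkem M os ms ms in
      let ec := mkec M os em ms cs in
      let el := trC l os ms cs in let er := trC r os ms cs in
      refine (@same_ok M os em ec el er _);
      vm_cast_no_check (@eq_refl bool true)
    end
  end end.

Ltac bnd :=
  match goal with
  | |- @eq (@Mor ?C) ?s ?f => let M := gray_of C in
    let st := constr:((@nil (Ob C), @nil (Mor C), @nil (Cell C))) in
    let st := colM f st in
    match s with
    | src ?t =>
      let st := colC t st in
      match st with (?os, ?ms, ?cs) =>
        let em := mkem M os ms ms in let ec := mkec M os em ms cs in
        let et := trC t os ms cs in let ef := trM f os ms in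
        refine (@src_is_ok M os em ec et ef _); vm_cast_no_check (@eq_refl bool true)
      end
    | tgt ?t =>
      let st := colC t st in
      match st with (?os, ?ms, ?cs) =>
        let em := mkem M os ms ms in let ec := mkec M os em ms cs in
        let et := trC t os ms cs in let ef := trM f os ms in
        refine (@tgt_is_ok M os em ec et ef _); vm_cast_no_check (@eq_refl bool true)
      end
    | _ =>
      let st := colM s st in
      match st with (?os, ?ms, ?cs) =>
        let em := mkem M os ms ms in
        let es := trM s os ms in let ef := trM f os ms in
        refine (@mor_eq_ok M os em es ef _); vm_cast_no_check (@eq_refl bool true)
      end
    end
  end.

Lemma iso_conj (C : two_category) (p q p' q' : Mor C) (f : iso2 p q) (g : iso2 p' q')
  (a b : Cell C) : a ∙ g = f ∙ b -> src a = p -> tgt a = p' -> src b = q -> tgt b = q' ->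
  f^-1 ∙ a = b ∙ g^-1.
Proof.
move=> E sa ta sb tb; apply: (iso_swap (a := f) (b := g)) => //; try bd.
- by rewrite iso_bwdK; congr id2; bd.
- by rewrite iso_fwdK; congr id2; bd.
Qed.

(* inverse form of the square E along the isomorphisms f and g *)
Ltac conj_sq f g := apply: (iso_conj (f := f) (g := g)); try (by bnd).

Lemma iso_inv_eq (C : two_category) (p q p' q' : Mor C) (f : iso2 p q) (g : iso2 p' q') :
  f = g :> Cell C -> f^-1 = g^-1 :> Cell C.
Proof.
move=> E; have ep : p = p' by rewrite -(cell_src f) E cell_src.
have eq : q = q' by rewrite -(cell_tgt f) E cell_tgt.
subst p' q'; apply: iso_inv_uniq; first exact: cell_src.
by rewrite -E iso_fwdK.
Qed.
Ltac inv_sq f g :=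
  transitivity (cell_val (iso_bwd f)); [by pasting|];
  transitivity (cell_val (iso_bwd g)); [apply: (iso_inv_eq (f := f) (g := g))|by pasting].

Section InverseInterchange.
Variables (M : gray_monoid) (x x' x'' y y' y'' : Ob M).
Implicit Types (f : hom x x') (g : hom y y') (X : Ob M).

Lemma ichV_comp_l (f' : hom x' x'') f g :
  (ich (hom_comp f' f) g)^-1
  = ((ich f' g)^-1 ▷ (f ⋊ y)) ∙ ((f' ⋊ y') ◁ (ich f g)^-1) :> Cell M.
Proof.
symmetry; apply: iso_inv_uniq; first by bnd.
rewrite ich_comp_l; rw (iso_fwdK (ich f' g)); rw (iso_fwdK (ich f g)); pasting.
Qed.
Lemma ichV_comp_r f (g' : hom y' y'') g :
  (ich f (hom_comp g' g))^-1
  = ((x' ⋉ g') ◁ (ich f g)^-1) ∙ ((ich f g')^-1 ▷ (x ⋉ g)) :> Cell M.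
Proof.
symmetry; apply: iso_inv_uniq; first by bnd.
rewrite ich_comp_r; rw (iso_fwdK (ich f g)); rw (iso_fwdK (ich f g')); pasting.
Qed.
Lemma ichV_lt X f g : (ich (hom_lt X f) g)^-1 = X ⋉₂ (ich f g)^-1 :> Cell M.
Proof.
symmetry; apply: iso_inv_uniq; first by bnd.
rewrite ich_lt; rw (iso_fwdK (ich f g)); pasting.
Qed.
Lemma ichV_mid f X g : (ich (hom_rt f X) g)^-1 = (ich f (hom_lt X g))^-1 :> Cell M.
Proof.
symmetry; apply: iso_inv_uniq; first by bnd.
rewrite ich_mid; rw (iso_fwdK (ich f (hom_lt X g))); pasting.
Qed.
Lemma ichV_rt X f g : (ich f (hom_rt g X))^-1 = (ich f g)^-1 ⋊₂ X :> Cell M.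
Proof.
symmetry; apply: iso_inv_uniq; first by bnd.
rewrite ich_rt; rw (iso_fwdK (ich f g)); pasting.
Qed.
Lemma ichV_id_l X g : (ich (hom_id X) g)^-1 = id2 (X ⋉ g) :> Cell M.
Proof.
symmetry; apply: iso_inv_uniq; first by bnd.
rewrite ich_id_l; pasting.
Qed.
Lemma ichV_id_r X f : (ich f (hom_id X))^-1 = id2 (f ⋊ X) :> Cell M.
Proof.
symmetry; apply: iso_inv_uniq; first by bnd.
rewrite ich_id_r; pasting.
Qed.
Lemma ichV_nat_l (f f' : hom x x') (s : cell f f') g :
  (ich f g)^-1 ∙ ((s ⋊₂ y') ▷ (x ⋉ g)) = ((x' ⋉ g) ◁ (s ⋊₂ y)) ∙ (ich f' g)^-1.
Proof. by apply: (iso_conj (ich_nat_l s g)); bnd. Qed.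
Lemma ichV_nat_r f (g g' : hom y y') (s : cell g g') :
  (ich f g)^-1 ∙ ((f ⋊ y') ◁ (x ⋉₂ s)) = ((x' ⋉₂ s) ▷ (f ⋊ y)) ∙ (ich f g')^-1.
Proof. by apply: (iso_conj (ich_nat_r f s)); bnd. Qed.
End InverseInterchange.

Section Primitives.
Variables (M : gray_monoid) (A : Ob M) (P : pseudomonoid A).
Notation m := (pm_mul P).
Notation "x * y" := (star P x y).
Notation stl := (stl P).
Notation str := (str P).
Notation res := (res P).

Definition al (X Y Z : Ob M) (x : hom X A) (y : hom Y A) (z : hom Z A) :
  iso2 ((x * y) * z) (x * (y * z)).
Proof.
refine (iso_vcomp
  (iso_cast _ _ (iso_rwhisk (pm_assoc P)
    (k := (x ⋊ (A ⊗ A)) ∘ ((X ⋉ (y ⋊ A)) ∘ ((X ⊗ Y) ⋉ z))) _))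
  (iso_cast erefl _ (iso_lwhisk (k := m)
    (iso_rwhisk (ich x m)^-1 (k := (X ⋉ (y ⋊ A)) ∘ ((X ⊗ Y) ⋉ z)) _) _))); rewrite /=; bd.
Defined.

Lemma alE (X Y Z : Ob M) (x : hom X A) (y : hom Y A) (z : hom Z A) : al x y z =
  (pm_assoc P ▷ ((x ⋊ (A ⊗ A)) ∘ ((X ⋉ (y ⋊ A)) ∘ ((X ⊗ Y) ⋉ z)))) ∙
  (m ◁ ((ich x m)^-1 ▷ ((X ⋉ (y ⋊ A)) ∘ ((X ⊗ Y) ⋉ z)))) :> Cell M.
Proof. by []. Qed.

Lemma resE (W X Y : Ob M) (x : hom X A) (f : hom W X) (y : hom Y A) :
  res x f y = (m ∘ (x ⋊ A)) ◁ ich f y :> Cell M.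
Proof. by []. Qed.

Section Laws.
Variables (U V W X Y Z : Ob M).
Implicit Types (x : hom X A) (y : hom Y A) (z : hom Z A) (w : hom W A).

Lemma resN1 (f : hom W X) x x' y (a : cell x x') :
  stl W (a ▷ f) y ∙ res x' f y = res x f y ∙ (stl X a y ▷ (f ⋊ Y)).
Proof. rewrite !resE; pasting. Qed.

Lemma resN2 (f : hom W X) x y y' (b : cell y y') :
  str W (x ∘ f) b ∙ res x f y' = res x f y ∙ (str X x b ▷ (f ⋊ Y)).
Proof. rewrite !resE; rw (ich_nat_r f b); pasting. Qed.

Lemma resN3 (f f' : hom W X) (s : cell f f') x y :
  stl W (x ◁ s) y ∙ res x f' y = res x f y ∙ ((x * y) ◁ (s ⋊₂ Y)).
Proof. rewrite !resE; rw (ich_nat_l s y); pasting. Qed.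

Lemma res_comp_l (f : hom W X) (g : hom V W) x y :
  res x (hom_comp f g) y = res (hom_comp x f) g y ∙ (res x f y ▷ (g ⋊ Y)) :> Cell M.
Proof. rewrite !resE ich_comp_l; pasting. Qed.

Lemma al_comp_r x y z (g : hom W Z) :
  al x y (hom_comp z g) = al x y z ▷ ((X ⊗ Y) ⋉ g) :> Cell M.
Proof. rewrite !alE; pasting. Qed.

Lemma alN3 x y z z' (b : cell z z') :
  str (X ⊗ Y) (x * y) b ∙ al x y z' = al x y z ∙ str X x (str Y y b).
Proof. rewrite !alE; pasting. Qed.

Lemma alN2 x y y' (b : cell y y') z :
  stl (X ⊗ Y) (str X x b) z ∙ al x y' z = al x y z ∙ str X x (stl Y b z).
Proof. rewrite !alE; pasting. Qed.

Lemma alN1 x x' (a : cell x x') y z :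
  stl (X ⊗ Y) (stl X a y) z ∙ al x' y z = al x y z ∙ stl X a (y * z).
Proof.
rewrite !alE; rwr (ichV_nat_l a m); pasting.
Qed.

Lemma al_res2 x y (g : hom W Y) z :
  al x (hom_comp y g) z ∙ str X x (res y g z)
  = res (x * y) (hom_lt X g) z ∙ (al x y z ▷ (X ⋉ (g ⋊ Z))).
Proof. rewrite !alE !resE ich_lt; pasting. Qed.

Lemma ich_star (f : hom W X) y z :
  ich f (y * z) = (ich f m ▷ (W ⋉ ((y ⋊ A) ∘ (Y ⋉ z))))
    ∙ ((X ⋉ m) ◁ ((ich f y ⋊₂ A) ▷ (W ⋉ (Y ⋉ z))))
    ∙ ((X ⋉ (m ∘ (y ⋊ A))) ◁ ich f (hom_lt Y z)) :> Cell M.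
Proof.
rewrite -[LHS]/(cell_val (ich f (hom_comp m (hom_comp (hom_rt y A) (hom_lt Y z))))).
rewrite ich_comp_r; rw (ich_comp_r f (hom_rt y A) (hom_lt Y z)).
rw (ich_rt A f y); pasting.
Qed.

Lemma al_res1 x (f : hom W X) y z :
  stl (W ⊗ Y) (res x f y) z ∙ res (x * y) (hom_rt f Y) z ∙ (al x y z ▷ (f ⋊ (Y ⊗ Z)))
  = al (hom_comp x f) y z ∙ res x f (y * z).
Proof.
rewrite !alE !resE; symmetry; rw (ich_star f y z); rw (ichV_comp_l x f m).
rw (iso_bwdK (ich f m)); rwr (ich_mid f Y z); pasting.
Qed.

Lemma ichV_star_l x y w :
  (ich (x * y) w)^-1 = ((ich m w)^-1 ▷ ((x ⋊ (A ⊗ W)) ∘ (X ⋉ (y ⋊ W))))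
    ∙ ((m ⋊ A) ◁ ((ich x (hom_lt A w))^-1 ▷ (X ⋉ (y ⋊ W))))
    ∙ (((m ∘ (x ⋊ A)) ⋊ A) ◁ (X ⋉₂ (ich y w)^-1)) :> Cell M.
Proof.
rewrite -[LHS]/(cell_val (ich (hom_comp m (hom_comp (hom_rt x A) (hom_lt X y))) w)^-1).
rewrite ichV_comp_l; rw (ichV_comp_l (hom_rt x A) (hom_lt X y) w).
rw (ichV_mid x A w); rw (ichV_lt X y w); pasting.
Qed.
End Laws.

Lemma pm_pentagonE :
  (pm_assoc P ▷ (m ⋊ (A ⊗ A))) ∙ (m ◁ (ich m m)^-1) ∙ (pm_assoc P ▷ ((A ⊗ A) ⋉ m))
  = (m ◁ (pm_assoc P ⋊₂ A)) ∙ (pm_assoc P ▷ (A ⋉ (m ⋊ A))) ∙ (m ◁ (A ⋉₂ pm_assoc P)).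
Proof. exact: pm_pentagon. Qed.

Lemma ichV_assoc (X : Ob M) (x : hom X A) :
  ((A ⋉₂ pm_assoc P) ▷ (x ⋊ (A ⊗ A ⊗ A))) ∙ ((A ⋉ m) ◁ (ich x (hom_lt A m))^-1)
    ∙ ((ich x m)^-1 ▷ (X ⋉ (A ⋉ m)))
  = ((A ⋉ m) ◁ (ich x (hom_rt m A))^-1) ∙ ((ich x m)^-1 ▷ (X ⋉ (m ⋊ A)))
    ∙ ((x ⋊ A) ◁ (X ⋉₂ pm_assoc P)).
Proof.
have E : (ich x (hom_comp m (hom_rt m A)))^-1
      ∙ ((x ⋊ A) ◁ (X ⋉₂ pm_assoc P))
    = ((A ⋉₂ pm_assoc P) ▷ (x ⋊ (A ⊗ A ⊗ A))) ∙ (ich x (hom_comp m (hom_lt A m)))^-1.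
  exact: (@ichV_nat_r _ _ _ _ _ x (hom_comp m (hom_rt m A))
    (hom_cast (tensOA A A A) (hom_comp m (hom_lt A m))) (pm_assoc P)).
rwr (ichV_comp_r x m (hom_lt A m)); rwr E; rw (ichV_comp_r x m (hom_rt m A)); pasting.
Qed.

Lemma al_pentagon (X Y Z W : Ob M) (x : hom X A) (y : hom Y A) (z : hom Z A) (w : hom W A) :
  al (x * y) z w ∙ al x y (z * w)
  = stl (X ⊗ Y ⊗ Z) (al x y z) w ∙ al x (y * z) w ∙ str X x (al y z w).
Proof.
rewrite !alE. rw (ichV_star_l x y m). rw pm_pentagonE. rw (ichV_assoc x).
rw (ichV_rt A x m); pasting.
Qed.
End Primitives.

(** * Half-braidings and centre pieces *)

Section TypedBraiding.
Variable M : braided_gray_monoid.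
Implicit Types (W X Y Z : Ob M).

Definition bl X X' (f : hom X X') Y : iso2 (br X' Y ∘ (f ⋊ Y)) ((Y ⋉ f) ∘ br X Y).
Proof. apply: (iso_cast _ _ (brl f Y)); rewrite ?(hom_dom f) ?(hom_cod f); bd. Defined.
Definition bR X Y Y' (g : hom Y Y') : iso2 (br X Y' ∘ (X ⋉ g)) ((g ⋊ X) ∘ br X Y).
Proof. apply: (iso_cast _ _ (brr X g)); rewrite ?(hom_dom g) ?(hom_cod g); bd. Defined.

Section Laws.
Variables (X X' X'' Y Y' Y'' Z Z' : Ob M).
Implicit Types (f : hom X X') (g : hom Y Y') (h : hom Z Z').

Ltac unhom f fx fx' := case: f => f fx fx' /=; case: _ / fx; case: _ / fx'.

Lemma bl_comp (f' : hom X' X'') f :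
  bl (hom_comp f' f) Y = (bl f' Y ▷ (f ⋊ Y)) ∙ ((Y ⋉ f') ◁ bl f Y) :> Cell M.
Proof.
case: f f' => f fx fx' f' /=; case: _ / fx; move: f'; case: _ / fx' => f'.
exact/brl_comp/hom_dom.
Qed.
Lemma bR_comp (g' : hom Y' Y'') g :
  bR X (hom_comp g' g) = (bR X g' ▷ (X ⋉ g)) ∙ ((g' ⋊ X) ◁ bR X g) :> Cell M.
Proof.
case: g g' => f fx fx' f' /=; case: _ / fx; move: f'; case: _ / fx' => f'.
exact/brr_comp/hom_dom.
Qed.
Lemma bR_nat (g g' : hom Y Y') (s : cell g g') :
  (br X Y' ◁ (X ⋉₂ s)) ∙ bR X g' = bR X g ∙ ((s ⋊₂ X) ▷ br X Y).
Proof.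
case: g g' s => [f fx fx'] [f' fy fy'] [s sf sg] /=; simpl in *.
by subst; exact: brr_nat.
Qed.
Lemma bl_id : bl (hom_id X) Y = id2 (br X Y) :> Cell M.
Proof. exact: brl_id1. Qed.
Lemma bR_id : bR X (hom_id Y) = id2 (br X Y) :> Cell M.
Proof. exact: brr_id1. Qed.
Lemma bl_bR f g : (bl f Y' ▷ (X ⋉ g)) ∙ ((Y' ⋉ f) ◁ bR X g)
  = (br X' Y' ◁ ich f g) ∙ (bR X' g ▷ (f ⋊ Y)) ∙ ((g ⋊ X') ◁ bl f Y) ∙ (ich g f ▷ br X Y).
Proof. unhom f fx fx'; unhom g gx gx'; exact: br_interchange. Qed.

Lemma hexR_bR1 g :
  bR X (hom_rt g Z) ∙ ((g ⋊ (Z ⊗ X)) ◁ hexR X Y Z)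
  = (hexR X Y' Z ▷ (X ⋉ (g ⋊ Z))) ∙ ((Y' ⋉ br X Z) ◁ (bR X g ⋊₂ Z))
    ∙ ((ich g (br X Z))^-1 ▷ (br X Y ⋊ Z)).
Proof. unhom g fx fx'; exact: hexR_mod2. Qed.
Lemma hexR_bR2 h :
  bR X (hom_lt Y h) ∙ ((Y ⋉ (h ⋊ X)) ◁ hexR X Y Z)
  = (hexR X Y Z' ▷ ((X ⊗ Y) ⋉ h)) ∙ ((Y ⋉ br X Z') ◁ ich (br X Y) h)
    ∙ ((Y ⋉₂ bR X h) ▷ (br X Y ⋊ Z)).
Proof. unhom h fx fx'; exact: hexR_mod3. Qed.

Lemma hexRV_bR1 g :
  ((hexR X Y' Z)^-1 ▷ (X ⋉ (g ⋊ Z))) ∙ bR X (hom_rt g Z)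
  = ((Y' ⋉ br X Z) ◁ (bR X g ⋊₂ Z)) ∙ ((ich g (br X Z))^-1 ▷ (br X Y ⋊ Z))
    ∙ ((g ⋊ (Z ⊗ X)) ◁ (hexR X Y Z)^-1).
Proof.
have e1 : dom (br X (Y' ⊗ Z)) = cod (X ⋉ (g ⋊ Z)) by bd.
have e2 : dom (g ⋊ (Z ⊗ X)) = cod (br X (Y ⊗ Z)) by bd.
conj_sq (iso_rwhisk (hexR X Y' Z) e1) (iso_lwhisk (hexR X Y Z) e2).
by rw (hexR_bR1 g); pasting.
Qed.
Lemma hexRV_bR2 h :
  ((hexR X Y Z')^-1 ▷ ((X ⊗ Y) ⋉ h)) ∙ bR X (hom_lt Y h)
  = ((Y ⋉ br X Z') ◁ ich (br X Y) h) ∙ ((Y ⋉₂ bR X h) ▷ (br X Y ⋊ Z))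
    ∙ ((Y ⋉ (h ⋊ X)) ◁ (hexR X Y Z)^-1).
Proof.
have e1 : dom (br X (Y ⊗ Z')) = cod ((X ⊗ Y) ⋉ h) by bd.
have e2 : dom (Y ⋉ (h ⋊ X)) = cod (br X (Y ⊗ Z)) by bd.
conj_sq (iso_rwhisk (hexR X Y Z') e1) (iso_lwhisk (hexR X Y Z) e2).
by rw (hexR_bR2 h); pasting.
Qed.

Lemma hexS_bl1 f :
  bl (hom_rt f Y) Z ∙ ((Z ⋉ (f ⋊ Y)) ◁ hexS X Y Z)
  = (hexS X' Y Z ▷ (f ⋊ (Y ⊗ Z))) ∙ ((br X' Z ⋊ Y) ◁ (ich f (br Y Z))^-1)
    ∙ ((bl f Z ⋊₂ Y) ▷ (X ⋉ br Y Z)).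
Proof. unhom f fx fx'; exact: hexS_mod1. Qed.
Lemma hexS_bl2 g :
  bl (hom_lt X g) Z ∙ (((Z ⊗ X) ⋉ g) ◁ hexS X Y Z)
  = (hexS X Y' Z ▷ (X ⋉ (g ⋊ Z))) ∙ ((br X Z ⋊ Y') ◁ (X ⋉₂ bl g Z))
    ∙ (ich (br X Z) g ▷ (X ⋉ br Y Z)).
Proof. unhom g fx fx'; exact: hexS_mod2. Qed.
Lemma hexS_bR h :
  bR (X ⊗ Y) h ∙ ((h ⋊ (X ⊗ Y)) ◁ hexS X Y Z)
  = (hexS X Y Z' ▷ ((X ⊗ Y) ⋉ h)) ∙ ((br X Z' ⋊ Y) ◁ (X ⋉₂ bR Y h))
    ∙ ((bR X h ⋊₂ Y) ▷ (X ⋉ br Y Z)).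
Proof. unhom h fx fx'; exact: hexS_mod3. Qed.
Lemma hexSV_bl1 f :
  ((hexS X' Y Z)^-1 ▷ (f ⋊ (Y ⊗ Z))) ∙ bl (hom_rt f Y) Z
  = ((br X' Z ⋊ Y) ◁ (ich f (br Y Z))^-1) ∙ ((bl f Z ⋊₂ Y) ▷ (X ⋉ br Y Z))
    ∙ ((Z ⋉ (f ⋊ Y)) ◁ (hexS X Y Z)^-1).
Proof.
have e1 : dom (br (X' ⊗ Y) Z) = cod (f ⋊ (Y ⊗ Z)) by bd.
have e2 : dom (Z ⋉ (f ⋊ Y)) = cod (br (X ⊗ Y) Z) by bd.
conj_sq (iso_rwhisk (hexS X' Y Z) e1) (iso_lwhisk (hexS X Y Z) e2).
by rw (hexS_bl1 f); pasting.
Qed.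
Lemma hexSV_bl2 g :
  ((hexS X Y' Z)^-1 ▷ (X ⋉ (g ⋊ Z))) ∙ bl (hom_lt X g) Z
  = ((br X Z ⋊ Y') ◁ (X ⋉₂ bl g Z)) ∙ (ich (br X Z) g ▷ (X ⋉ br Y Z))
    ∙ (((Z ⊗ X) ⋉ g) ◁ (hexS X Y Z)^-1).
Proof.
have e1 : dom (br (X ⊗ Y') Z) = cod (X ⋉ (g ⋊ Z)) by bd.
have e2 : dom ((Z ⊗ X) ⋉ g) = cod (br (X ⊗ Y) Z) by bd.
conj_sq (iso_rwhisk (hexS X Y' Z) e1) (iso_lwhisk (hexS X Y Z) e2).
by rw (hexS_bl2 g); pasting.
Qed.
Lemma hexSV_bR h :
  ((hexS X Y Z')^-1 ▷ ((X ⊗ Y) ⋉ h)) ∙ bR (X ⊗ Y) h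
  = ((br X Z' ⋊ Y) ◁ (X ⋉₂ bR Y h)) ∙ ((bR X h ⋊₂ Y) ▷ (X ⋉ br Y Z))
    ∙ ((h ⋊ (X ⊗ Y)) ◁ (hexS X Y Z)^-1).
Proof.
have e1 : dom (br (X ⊗ Y) Z') = cod ((X ⊗ Y) ⋉ h) by bd.
have e2 : dom (h ⋊ (X ⊗ Y)) = cod (br (X ⊗ Y) Z) by bd.
conj_sq (iso_rwhisk (hexS X Y Z') e1) (iso_lwhisk (hexS X Y Z) e2).
by rw (hexS_bR h); pasting.
Qed.
End Laws.

Lemma br_coh3E X Y Z W :
  hexR (X ⊗ Y) Z W
    ∙ ((Z ⋉ br (X ⊗ Y) W) ◁ (hexS X Y Z ⋊₂ W))
    ∙ ((Z ⋉₂ hexS X Y W) ▷ ((br X Z ⋊ (Y ⊗ W)) ∘ (X ⋉ (br Y Z ⋊ W))))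
  = hexS X Y (Z ⊗ W)
    ∙ ((br X (Z ⊗ W) ⋊ Y) ◁ (X ⋉₂ hexR Y Z W))
    ∙ ((hexR X Z W ⋊₂ Y) ▷ (((X ⊗ Z) ⋉ br Y W) ∘ (X ⋉ (br Y Z ⋊ W))))
    ∙ ((Z ⋉ (br X W ⋊ Y)) ◁ (ich (br X Z) (br Y W) ▷ (X ⋉ (br Y Z ⋊ W)))).
Proof. exact: br_coh3. Qed.
Lemma br_coh4E X Y Z :
  ((br Y Z ⋊ X) ◁ (hexR X Y Z)^-1) ∙ (bR X (br Y Z))^-1 ∙ (hexR X Z Y ▷ (X ⋉ br Y Z))
  = ((hexS Y X Z)^-1 ▷ (br X Y ⋊ Z)) ∙ bl (br X Y) Z ∙ ((Z ⋉ br X Y) ◁ hexS X Y Z).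
Proof. exact: br_coh4. Qed.
End TypedBraiding.

Section Pieces.
Variables (M : braided_gray_monoid) (A : Ob M) (P : pseudomonoid A).
Notation m := (pm_mul P).
Notation "x * y" := (star P x y).
Notation stl := (stl P).
Notation str := (str P).
Notation al := (al P).
Notation res := (res P).

Notation half_braiding U u := (iso2 (m ∘ (u ⋊ A)) (m ∘ (A ⋉ u) ∘ br U A)).

Definition hb_at (U X : Ob M) (u : hom U A) (g : half_braiding U u) (x : hom X A) :
  iso2 (u * x) ((x * u) ∘ br U X).
Proof.
refine (iso_vcomp (iso_cast _ erefl (iso_rwhisk g (k := U ⋉ x) _))
  (iso_vcomp (iso_cast _ erefl (iso_lwhisk (k := m ∘ (A ⋉ u)) (bR U x) _))
    (iso_cast _ _ (iso_lwhisk (k := m) (iso_rwhisk (ich x u)^-1 (k := br U X) _) _))));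
  rewrite /=; bd.
Defined.

Lemma hb_atE (U X : Ob M) (u : hom U A) (g : half_braiding U u) (x : hom X A) :
  hb_at g x = (g ▷ (U ⋉ x)) ∙ (((m ∘ (A ⋉ u)) ◁ bR U x) ∙ (m ◁ ((ich x u)^-1 ▷ br U X)))
  :> Cell M.
Proof. by []. Qed.

Lemma hb_atN (U X : Ob M) (u : hom U A) (g : half_braiding U u) (x x' : hom X A) (b : cell x x') :
  str U u b ∙ hb_at g x' = hb_at g x ∙ (stl X b u ▷ br U X).
Proof.
rewrite !hb_atE; rw (bR_nat U b); rwr (ichV_nat_l b u); pasting.
Qed.

Lemma resVE (W X Y : Ob M) (x : hom X A) (f : hom W X) (y : hom Y A) :
  (res x f y)^-1 = (m ∘ (x ⋊ A)) ◁ (ich f y)^-1 :> Cell M.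
Proof. by []. Qed.

Lemma hb_at_comp (U X W : Ob M) (u : hom U A) (g : half_braiding U u) (x : hom X A) (f : hom W X) :
  hb_at g (hom_comp x f) = (hb_at g x ▷ (U ⋉ f)) ∙ ((x * u) ◁ bR U f) ∙ ((res x f u)^-1 ▷ br U W)
  :> Cell M.
Proof.
rewrite !hb_atE resVE. rw (bR_comp U x f); rw (ichV_comp_l x f u); pasting.
Qed.

Lemma hb_at_id (U : Ob M) (u : hom U A) (g : half_braiding U u) :
  hb_at g (hom_id A) = g :> Cell M.
Proof.
rewrite !hb_atE. rw (bR_id U A); rw (ichV_id_l A u); pasting.
Qed.

Lemma cp_axiomE (U : Ob M) (u : centre_piece P U) :
  (pm_assoc P ▷ (u ⋊ (A ⊗ A))) ∙ (m ◁ (ich u m)^-1) ∙ (cp_iso u ▷ (U ⋉ m))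
    ∙ ((m ∘ (A ⋉ u)) ◁ bR U m) ∙ (m ◁ ((ich m u)^-1 ▷ br U (A ⊗ A)))
    ∙ (pm_assoc P ▷ (((A ⊗ A) ⋉ u) ∘ br U (A ⊗ A)))
  = (m ◁ (cp_iso u ⋊₂ A)) ∙ (pm_assoc P ▷ ((A ⋉ (u ⋊ A)) ∘ (br U A ⋊ A)))
    ∙ (m ◁ ((A ⋉₂ cp_iso u) ▷ (br U A ⋊ A)))
    ∙ ((m ∘ (A ⋉ m) ∘ ((A ⊗ A) ⋉ u)) ◁ (hexR U A A)^-1).
Proof. exact: cp_axiom. Qed.

Lemma bR_star (U X Y : Ob M) (x : hom X A) (y : hom Y A) :
  bR U (x * y) = (bR U m ▷ (U ⋉ ((x ⋊ A) ∘ (X ⋉ y))))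
    ∙ ((m ⋊ U) ◁ (bR U (hom_rt x A) ▷ (U ⋉ (X ⋉ y))))
    ∙ (((m ∘ (x ⋊ A)) ⋊ U) ◁ bR U (hom_lt X y)) :> Cell M.
Proof.
rewrite -[LHS]/(cell_val (bR U (hom_comp m (hom_comp (hom_rt x A) (hom_lt X y))))).
rewrite bR_comp; rw (bR_comp U (hom_rt x A) (hom_lt X y)); pasting.
Qed.

Lemma ichV_half (U X : Ob M) (u : hom U A) (g : half_braiding U u) (x : hom X A) :
  ((A ⋉₂ g) ▷ (x ⋊ (U ⊗ A))) ∙ ((A ⋉ (m ∘ (A ⋉ u))) ◁ (ich x (br U A))^-1)
    ∙ ((A ⋉ m) ◁ ((ich x (hom_lt A u))^-1 ▷ (X ⋉ br U A)))
    ∙ ((ich x m)^-1 ▷ (X ⋉ ((A ⋉ u) ∘ br U A)))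
  = ((A ⋉ m) ◁ (ich x (hom_rt u A))^-1) ∙ ((ich x m)^-1 ▷ (X ⋉ (u ⋊ A)))
    ∙ ((x ⋊ A) ◁ (X ⋉₂ g)).
Proof.
have E : (ich x (hom_comp m (hom_rt u A)))^-1 ∙ ((x ⋊ A) ◁ (X ⋉₂ g))
    = ((A ⋉₂ g) ▷ (x ⋊ (U ⊗ A)))
      ∙ (ich x (hom_comp (hom_comp m (hom_lt A u)) (br U A)))^-1.
  exact: (@ichV_nat_r _ _ _ _ _ x (hom_comp m (hom_rt u A))
    (hom_comp (hom_comp m (hom_lt A u)) (br U A)) g).
symmetry; rwr (ichV_comp_r x m (hom_rt u A)); rw E.
rw (ichV_comp_r x (hom_comp m (hom_lt A u)) (br U A)).
rw (ichV_comp_r x m (hom_lt A u)); pasting.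
Qed.

Lemma hb_at_hexagon (U X Y : Ob M) (u : centre_piece P U) (x : hom X A) (y : hom Y A) :
  al u x y ∙ hb_at (cp_iso u) (x * y) ∙ (al x y u ▷ br U (X ⊗ Y))
  = stl (U ⊗ X) (hb_at (cp_iso u) x) y ∙ res (x * u) (br U X) y ∙ (al x u y ▷ (br U X ⋊ Y))
    ∙ (str X x (hb_at (cp_iso u) y) ▷ (br U X ⋊ Y))
    ∙ ((x * (y * u)) ◁ (hexR U X Y)^-1).
Proof.
rewrite !alE !hb_atE !resE.
rw (bR_star U x y); rw (ichV_star_l P x y u).
rw (cp_axiomE u); rw (hexRV_bR1 U A x); rw (hexRV_bR2 U X y).
rw (ichV_half (cp_iso u) x); rw (ichV_rt A x u); pasting.
Qed.
End Pieces.

Lemma hom_inj (C : two_category) (x y : Ob C) (f g : hom x y) : f = g :> Mor C -> f = g.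
Proof.
case: f g => [f a b] [g c d] /= E; case: g / E c d => c d.
by rewrite (ProofIrrelevance.proof_irrelevance _ a c) (ProofIrrelevance.proof_irrelevance _ b d).
Qed.

Section Tensor.
Variables (M : braided_gray_monoid) (A : Ob M) (P : pseudomonoid A).
Notation m := (pm_mul P).
Notation "x * y" := (star P x y).
Notation stl := (stl P).
Notation str := (str P).
Notation al := (al P).
Notation res := (res P).
Notation iso_str := (iso_str P).
Notation iso_stl := (iso_stl P).
Notation half_braiding U u := (iso2 (m ∘ (u ⋊ A)) (m ∘ (A ⋉ u) ∘ br U A)).

Lemma star_comp_r X Y W (x : hom X A) (y : hom Y A) (g : hom W Y) :
  x * hom_comp y g = (x * y) ∘ (X ⋉ g) :> Mor M.
Proof. bnd. Qed.

Section InverseLaws.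
Variables (U V W X Y Z : Ob M).
Implicit Types (x : hom X A) (y : hom Y A) (z : hom Z A).

Lemma alV_res2 x y (g : hom W Y) z :
  str X x (res y g z)^-1 ∙ (al x (hom_comp y g) z)^-1
  = ((al x y z)^-1 ▷ (X ⋉ (g ⋊ Z))) ∙ (res (x * y) (hom_lt X g) z)^-1.
Proof.
have e : dom ((x * y) * z) = cod (hom_rt (hom_lt X g) Z) by rewrite !hom_dom hom_cod.
inv_sq
  (iso_vcomp (al x (hom_comp y g) z)
    (iso_str x (y' := hom_comp (y * z) (hom_rt g Z)) (res y g z)))
  (iso_vcomp (res (x * y) (hom_lt X g) z) (iso_rwhisk (al x y z) e)).
by rw (al_res2 P x y g z); pasting.
Qed.

Lemma resV_N1 (f : hom W X) x x' y (a : cell x x') :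
  (res x f y)^-1 ∙ stl W (a ▷ f) y = (stl X a y ▷ (f ⋊ Y)) ∙ (res x' f y)^-1.
Proof. conj_sq (res x f y) (res x' f y); exact: resN1. Qed.

Lemma res_square (f : hom W X) (g : hom V W) (f' : hom U X) (g' : hom V U)
    (s : cell (hom_comp f g) (hom_comp f' g')) x y :
  stl V (x ◁ s) y ∙ res (hom_comp x f') g' y ∙ (res x f' y ▷ (g' ⋊ Y))
  = res (hom_comp x f) g y ∙ (res x f y ▷ (g ⋊ Y)) ∙ ((x * y) ◁ (s ⋊₂ Y)).
Proof.
rwr (res_comp_l P f' g' x y); rw (resN3 P s x y); rw (res_comp_l P f g x y); pasting.
Qed.

Lemma resV_square (f : hom W X) (g : hom V W) (f' : hom U X) (g' : hom V U)
    (s : cell (hom_comp f g) (hom_comp f' g')) x y :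
  (res (hom_comp x f) g y)^-1 ∙ (stl V (x ◁ s) y ∙ res (hom_comp x f') g' y)
  = ((res x f y ▷ (g ⋊ Y)) ∙ ((x * y) ◁ (s ⋊₂ Y))) ∙ ((res x f' y)^-1 ▷ (g' ⋊ Y)).
Proof.
have e : dom (hom_comp x f' * y) = cod (g' ⋊ Y) by rewrite hom_dom cod_rtens hom_cod.
conj_sq (res (hom_comp x f) g y) (iso_rwhisk (res x f' y) e).
by rw (res_square s x y); pasting.
Qed.

Lemma alV_res1 x (f : hom W X) y z :
  (res (x * y) (hom_rt f Y) z)^-1 ∙ stl (W ⊗ Y) (res x f y)^-1 z ∙ al (hom_comp x f) y z
  = (al x y z ▷ (f ⋊ (Y ⊗ Z))) ∙ (res x f (y * z))^-1.
Proof.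
conj_sq (iso_vcomp (iso_stl (x' := hom_comp (x * y) (hom_rt f Y)) (res x f y) z)
  (res (x * y) (hom_rt f Y) z)) (res x f (y * z)).
by symmetry; rw (al_res1 P x f y z); pasting.
Qed.
End InverseLaws.

Section TensorPiece.
Variables (U V : Ob M) (u : hom U A) (v : hom V A).
Variables (gu : half_braiding U u) (gv : half_braiding V v).

Definition hb_tens_at X (x : hom X A) : iso2 ((u * v) * x) ((x * (u * v)) ∘ br (U ⊗ V) X).
Proof.
refine (iso_vcomp (al u v x) (iso_vcomp
  (iso_str u (y' := hom_comp (x * v) (br V X)) (hb_at gv x)) (iso_vcomp
  (iso_cast (esym (star_comp_r u (x * v) (br V X))) erefl
    (iso_rwhisk (al u x v)^-1 (k := U ⋉ br V X) _)) (iso_vcomp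
  (iso_rwhisk (k := U ⋉ br V X) (iso_stl (x' := hom_comp (x * u) (br U X)) (hb_at gu x) v) _)
  (iso_vcomp (iso_cast erefl _ (iso_rwhisk (k := U ⋉ br V X) (res (x * u) (br U X) v) _))
  (iso_vcomp (iso_lwhisk (k := (x * u) * v) (hexS U V X)^-1 _)
  (iso_rwhisk (k := br (U ⊗ V) X) (al x u v) _))))))); (bnd || bd).
Defined.

Lemma hb_tens_atE X (x : hom X A) : hb_tens_at x =
  al u v x ∙ (str U u (hb_at gv x) ∙ (((al u x v)^-1 ▷ (U ⋉ br V X))
    ∙ ((stl (U ⊗ X) (hb_at gu x) v ▷ (U ⋉ br V X))
    ∙ ((res (x * u) (br U X) v ▷ (U ⋉ br V X))
    ∙ ((((x * u) * v) ◁ (hexS U V X)^-1) ∙ (al x u v ▷ br (U ⊗ V) X)))))) :> Cell M.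
Proof. by []. Qed.

Lemma hb_tens_at_comp X W (x : hom X A) (f : hom W X) :
  hb_tens_at (hom_comp x f) = (hb_tens_at x ▷ ((U ⊗ V) ⋉ f)) ∙ ((x * (u * v)) ◁ bR (U ⊗ V) f)
    ∙ ((res x f (u * v))^-1 ▷ br (U ⊗ V) W) :> Cell M.
Proof.
rewrite !hb_tens_atE; rw (al_comp_r P u v x f).
rw (hb_at_comp gv x f); rw (hb_at_comp gu x f).
rw (alV_res2 u x f v).
rw (resV_N1 (hom_lt U f) (x' := hom_comp (x * u) (br U X)) v (hb_at gu x)).
rw (resN1 P (br U W) (x := hom_comp (x * u) (hom_rt f U)) v (res x f u)^-1).
rw (resV_square (f := br U X) (g := hom_lt U f) (f' := hom_rt f U) (g' := br U W)
  (bR U f) (x * u) v).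
rwr (hexSV_bR U V f).
rw (alV_res1 x f u v); pasting.
Qed.
End TensorPiece.
End Tensor.

Lemma iso_cancel_l (C : two_category) (p q : Mor C) (f : iso2 p q) (a b : Cell C) :
  f ∙ a = f ∙ b -> src a = q -> src b = q -> a = b.
Proof.
move=> E ha hb; rewrite -[a]vcomp_id2_l -[b]vcomp_id2_l ha hb -(iso_bwdK f).
rewrite -!vcompA ?E //; bd.
Qed.
Lemma iso_cancel_r (C : two_category) (p q : Mor C) (f : iso2 p q) (a b : Cell C) :
  a ∙ f = b ∙ f -> tgt a = p -> tgt b = p -> a = b.
Proof.
move=> E ha hb; rewrite -[a]vcomp_id2_r -[b]vcomp_id2_r ha hb -(iso_fwdK f).
rewrite !vcompA ?E //; bd.
Qed.
Ltac cancel_l f := apply: (iso_cancel_l (f := f)); [|by bnd|by bnd].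
Ltac cancel_r f := apply: (iso_cancel_r (f := f)); [|by bnd|by bnd].

Section Tensor.
Variables (M : braided_gray_monoid) (A : Ob M) (P : pseudomonoid A).
Notation "x * y" := (star P x y).
Notation stl := (stl P).
Notation str := (str P).
Notation al := (al P).
Notation res := (res P).
Notation iso_str := (iso_str P).
Notation iso_stl := (iso_stl P).

Section Pentagons.
Variables (X Y Z W : Ob M) (x : hom X A) (y : hom Y A) (z : hom Z A) (w : hom W A).

Lemma pent_mid : al x (y * z) w ∙ str X x (al y z w) ∙ (al x y (z * w))^-1
  = stl (X ⊗ Y ⊗ Z) (al x y z)^-1 w ∙ al (x * y) z w.
Proof.
cancel_l (iso_stl (x' := hom_cast (tensOA X Y Z) (x * (y * z))) (al x y z) w).
rwr (al_pentagon P x y z w).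
rw (iso_fwdK (al x y (z * w))); symmetry; rw (iso_fwdK (al x y z)); pasting.
Qed.
Lemma pent_mid' : (al (x * y) z w)^-1 ∙ stl (X ⊗ Y ⊗ Z) (al x y z) w ∙ al x (y * z) w
  = al x y (z * w) ∙ str X x (al y z w)^-1.
Proof.
cancel_l (al (x * y) z w). rw (iso_fwdK (al (x * y) z w)).
symmetry; rw (al_pentagon P x y z w); rw (iso_fwdK (al y z w)); pasting.
Qed.
Lemma pent_inv : str X x (al y z w)^-1 ∙ (al x (y * z) w)^-1 ∙ stl (X ⊗ Y ⊗ Z) (al x y z)^-1 w
  = (al x y (z * w))^-1 ∙ (al (x * y) z w)^-1.
Proof.
have e : hom_cast (tensOA X Y Z) (x * (y * z)) * w = (x * (y * z)) * w :> Mor M by bnd.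
inv_sq (iso_vcomp (iso_cast erefl e
    (iso_stl (x' := hom_cast (tensOA X Y Z) (x * (y * z))) (al x y z) w)) (iso_vcomp (al x (y * z) w)
    (iso_str x (y' := hom_cast (tensOA Y Z W) (y * (z * w))) (al y z w))))
  (iso_vcomp (al (x * y) z w) (al x y (z * w))).
by symmetry; rw (al_pentagon P x y z w); pasting.
Qed.
End Pentagons.

Section Naturality.
Variables (W X Y Z : Ob M).
Implicit Types (x : hom X A) (y : hom Y A) (z : hom Z A).
Lemma alV_N1 x x' (a : cell x x') y z :
  (al x y z)^-1 ∙ stl (X ⊗ Y) (stl X a y) z = stl X a (y * z) ∙ (al x' y z)^-1.
Proof. conj_sq (al x y z) (al x' y z); exact: alN1. Qed.
Lemma alV_N3 x y z z' (b : cell z z') :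
  (al x y z)^-1 ∙ str (X ⊗ Y) (x * y) b = str X x (str Y y b) ∙ (al x y z')^-1.
Proof. conj_sq (al x y z) (al x y z'); exact: alN3. Qed.
Lemma alV_comp_r x y z (g : hom W Z) :
  (al x y (hom_comp z g))^-1 = (al x y z)^-1 ▷ ((X ⊗ Y) ⋉ g) :> Cell M.
Proof.
have e : dom ((x * y) * z) = cod ((X ⊗ Y) ⋉ g) by rewrite hom_dom cod_ltens hom_cod.
inv_sq (al x y (hom_comp z g)) (iso_rwhisk (al x y z) e).
by rw (al_comp_r P x y z g); pasting.
Qed.
Lemma alV_res1_l x (f : hom W X) y z :
  (al (hom_comp x f) y z)^-1 ∙ stl (W ⊗ Y) (res x f y) z
  = res x f (y * z) ∙ ((al x y z)^-1 ▷ (f ⋊ (Y ⊗ Z))) ∙ (res (x * y) (hom_rt f Y) z)^-1.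
Proof.
cancel_l (al (hom_comp x f) y z).
rw (iso_fwdK (al (hom_comp x f) y z)); symmetry.
rwr (al_res1 P x f y z); rw (iso_fwdK (al x y z)).
rw (iso_fwdK (res (x * y) (hom_rt f Y) z)); pasting.
Qed.
End Naturality.

Section Naturality2.
Variables (W X Y Z : Ob M).
Implicit Types (x : hom X A) (y : hom Y A) (z : hom Z A).
Lemma alN3_r x y z (z' : hom W A) (g : hom W Z) (b : cell z' (hom_comp z g)) :
  str (X ⊗ Y) (x * y) b ∙ (al x y z ▷ ((X ⊗ Y) ⋉ g))
  = al x y z' ∙ str X x (str Y y b).
Proof. rwr (al_comp_r P x y z g); rw (alN3 P x y (z' := hom_comp z g) b); pasting. Qed.
Lemma alV_N3_r x y z (z' : hom W A) (g : hom W Z) (b : cell z' (hom_comp z g)) :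
  (al x y z')^-1 ∙ str (X ⊗ Y) (x * y) b
  = str X x (str Y y b) ∙ ((al x y z)^-1 ▷ ((X ⊗ Y) ⋉ g)).
Proof. rw (alV_N3 x y (z' := hom_comp z g) b); rw (alV_comp_r x y z g); pasting. Qed.
End Naturality2.

Lemma ich_nat_rV (X X' Y Z W : Ob M) (f : hom X X') (y : hom Y Z) (z : hom W Z)
    (g : hom Y W) (b : cell y (hom_comp z g)) :
  ((f ⋊ Z) ◁ (X ⋉₂ b)) ∙ (ich f z ▷ (X ⋉ g))
  = ich f y ∙ ((X' ⋉₂ b) ▷ (f ⋊ Y)) ∙ ((X' ⋉ z) ◁ (ich f g)^-1).
Proof.
have e : dom (X' ⋉ z) = cod ((f ⋊ W) ∘ (X ⋉ g)) by bd.
cancel_r (iso_lwhisk (ich f g) e).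
rwr (ich_comp_r f z g); rw (ich_nat_r f (g' := hom_comp z g) b).
by symmetry; rw (iso_bwdK (ich f g)); pasting.
Qed.

Section Hexagon.
Variables (U X Y : Ob M) (u : centre_piece P U) (x : hom X A) (y : hom Y A).
Notation gu := (hb_at (cp_iso u)).
Lemma hb_at_hexagon_l :
  al u x y ∙ gu (x * y)
  = stl (U ⊗ X) (gu x) y ∙ res (x * u) (br U X) y ∙ (al x u y ▷ (br U X ⋊ Y))
    ∙ (str X x (gu y) ▷ (br U X ⋊ Y)) ∙ ((x * (y * u)) ◁ (hexR U X Y)^-1)
    ∙ ((al x y u)^-1 ▷ br U (X ⊗ Y)).
Proof.
have e : dom ((x * y) * u) = cod (br U (X ⊗ Y)) by bd.
cancel_r (iso_rwhisk (al x y u) e).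
symmetry; rw (iso_bwdK (al x y u)); rwr (hb_at_hexagon u x y); pasting.
Qed.
Lemma hb_at_hexagon_r :
  gu (x * y) ∙ (al x y u ▷ br U (X ⊗ Y))
  = (al u x y)^-1 ∙ stl (U ⊗ X) (gu x) y ∙ res (x * u) (br U X) y
    ∙ (al x u y ▷ (br U X ⋊ Y)) ∙ (str X x (gu y) ▷ (br U X ⋊ Y))
    ∙ ((x * (y * u)) ◁ (hexR U X Y)^-1).
Proof.
cancel_l (al u x y); symmetry; rw (iso_fwdK (al u x y)); rwr (hb_at_hexagon u x y); pasting.
Qed.
End Hexagon.

Lemma hexRV_ich (U X Y V B : Ob M) (v : hom V B) :
  (((hexR U X Y)^-1 ⋊₂ B) ▷ ((U ⊗ (X ⊗ Y)) ⋉ v)) ∙ ich (br U (X ⊗ Y)) v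
  = (((X ⋉ br U Y) ⋊ B) ◁ ich (hom_rt (br U X) Y) v)
    ∙ (ich (hom_lt X (br U Y)) v ▷ ((br U X ⋊ Y) ⋊ V))
    ∙ (((X ⊗ (Y ⊗ U)) ⋉ v) ◁ ((hexR U X Y)^-1 ⋊₂ V)).
Proof.
pose f1 := hom_cast (esym (tensOA U X Y)) (hom_rt (br U X) Y).
pose f2 := hom_castr (tensOA X Y U) (hom_cast (tensOA X U Y) (hom_lt X (br U Y))).
have E := @ich_nat_l _ _ _ _ _ (hom_comp f2 f1) (br U (X ⊗ Y)) (hexR U X Y)^-1 v.
have E1 : ich (hom_comp f2 f1) v
    = (((X ⋉ br U Y) ⋊ B) ◁ ich (hom_rt (br U X) Y) v)
      ∙ (ich (hom_lt X (br U Y)) v ▷ ((br U X ⋊ Y) ⋊ V)) :> Cell M.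
  exact: (ich_comp_l f2 f1 v).
move: E E1; rewrite /f1 /f2 => E E1; rw E; rw E1; pasting.
Qed.

Lemma hexSV_ich (U V X Y B : Ob M) (y : hom Y B) :
  (((hexS U V X)^-1 ⋊₂ B) ▷ ((U ⊗ V ⊗ X) ⋉ y)) ∙ ich (br (U ⊗ V) X) y
  = (((br U X ⋊ V) ⋊ B) ◁ ich (hom_lt U (br V X)) y)
    ∙ (ich (hom_rt (br U X) V) y ▷ ((U ⋉ br V X) ⋊ Y))
    ∙ (((X ⊗ (U ⊗ V)) ⋉ y) ◁ ((hexS U V X)^-1 ⋊₂ Y)).
Proof.
pose f1 := hom_cast (tensOA U V X) (hom_lt U (br V X)).
pose f2 := hom_castr (esym (tensOA X U V)) (hom_cast (esym (tensOA U X V)) (hom_rt (br U X) V)).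
have E := @ich_nat_l _ _ _ _ _ (hom_comp f2 f1) (br (U ⊗ V) X) (hexS U V X)^-1 y.
have E1 : ich (hom_comp f2 f1) y
    = (((br U X ⋊ V) ⋊ B) ◁ ich (hom_lt U (br V X)) y)
      ∙ (ich (hom_rt (br U X) V) y ▷ ((U ⋉ br V X) ⋊ Y)) :> Cell M.
  exact: (ich_comp_l f2 f1 y).
move: E E1; rewrite /f1 /f2 => E E1; rw E; rw E1; pasting.
Qed.

Lemma br_coh3V (X Y Z W : Ob M) :
  ((Z ⋉ ((br X W ⋊ Y) ∘ (X ⋉ br Y W))) ◁ ((hexS X Y Z)^-1 ⋊₂ W))
    ∙ ((Z ⋉₂ (hexS X Y W)^-1) ▷ (br (X ⊗ Y) Z ⋊ W)) ∙ (hexR (X ⊗ Y) Z W)^-1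
  = ((Z ⋉ (br X W ⋊ Y)) ◁ ((ich (br X Z) (br Y W))^-1 ▷ (X ⋉ (br Y Z ⋊ W))))
    ∙ (((hexR X Z W)^-1 ⋊₂ Y) ▷ (((X ⊗ Z) ⋉ br Y W) ∘ (X ⋉ (br Y Z ⋊ W))))
    ∙ ((br X (Z ⊗ W) ⋊ Y) ◁ (X ⋉₂ (hexR Y Z W)^-1)) ∙ (hexS X Y (Z ⊗ W))^-1.
Proof.
cancel_l (iso_lwhisk (k := Z ⋉ (br X W ⋊ Y))
  (iso_rwhisk (k := X ⋉ (br Y Z ⋊ W)) (ich (br X Z) (br Y W)) ltac:(bd)) ltac:(rewrite /=; bd)).
symmetry; rw (iso_fwdK (ich (br X Z) (br Y W))); symmetry.
cancel_l (iso_rwhisk (k := ((X ⊗ Z) ⋉ br Y W) ∘ (X ⋉ (br Y Z ⋊ W)))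
  (iso_rt (hexR X Z W) Y) ltac:(bd)).
symmetry; rw (iso_fwdK (hexR X Z W)); symmetry.
cancel_l (iso_lwhisk (k := br X (Z ⊗ W) ⋊ Y) (iso_lt X (hexR Y Z W)) ltac:(bd)).
symmetry; rw (iso_fwdK (hexR Y Z W)); symmetry.
cancel_l (hexS X Y (Z ⊗ W)).
symmetry; rw (iso_fwdK (hexS X Y (Z ⊗ W))); symmetry.
rwr (br_coh3E X Y Z W).
rw (iso_fwdK (hexS X Y W)); rw (iso_fwdK (hexS X Y Z)); rw (iso_fwdK (hexR (X ⊗ Y) Z W)).
pasting.
Qed.

Section TensorHexagon.
Variables (U V X Y : Ob M) (u : centre_piece P U) (v : centre_piece P V).
Variables (x : hom X A) (y : hom Y A).
Notation gu := (hb_at (cp_iso u)).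
Notation gv := (hb_at (cp_iso v)).
Notation T := (hb_tens_at (cp_iso u) (cp_iso v)).
Lemma hb_tens_at_hexagon :
  al (u * v) x y ∙ T (x * y) ∙ (al x y (u * v) ▷ br (U ⊗ V) (X ⊗ Y))
  = stl (U ⊗ V ⊗ X) (T x) y ∙ res (x * (u * v)) (br (U ⊗ V) X) y
    ∙ (al x (u * v) y ▷ (br (U ⊗ V) X ⋊ Y)) ∙ (str X x (T y) ▷ (br (U ⊗ V) X ⋊ Y))
    ∙ ((x * (y * (u * v))) ◁ (hexR (U ⊗ V) X Y)^-1).
Proof.
rewrite !hb_tens_atE.
rw (al_pentagon P u v x y); rw (al_pentagon P x y u v).
rw (hb_at_hexagon_l v x y).
rw (hb_at_hexagon_r u x y).
rw (pent_inv u x y v).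
rw (hexRV_ich U X Y v).
rwr (alN2 P u (y' := hom_comp (x * v) (br V X)) (gv x) y).
rw (al_res2 P u (x * v) (br V X) y).
rwr (alV_N3_r u x (z := y * v) (g := br V Y) (gv y)).
rw (pent_mid u x v y).
rw (alV_N1 (x' := hom_comp (x * u) (br U X)) (gu x) y v).
rw (alV_res1_l (x * u) (br U X) y v).
rw (iso_bwdK (ich (hom_rt (br U X) Y) v)).
rwr (al_res2 P x (y * u) (br U Y) v).
rw (alN2 P x (y' := hom_comp (y * u) (br U Y)) (gu y) v).
rw (pent_mid' x u y v).
rw (ich_nat_rV (br U X) (z := y * v) (g := br V Y) (gv y)).
rwr (alN1 P (x' := hom_comp (x * u) (br U X)) (gu x) v y).
rwr (al_res1 P (x * u) (br U X) v y).
rw (alN3_r x u (z := y * v) (g := br V Y) (gv y)).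
rw (al_pentagon P x u v y).
symmetry; rw (hexSV_ich U V X y); rw (br_coh3V U V X Y).
symmetry; pasting.
Qed.
End TensorHexagon.
End Tensor.

Section TensorPiece.
Variables (M : braided_gray_monoid) (A : Ob M) (P : pseudomonoid A).
Notation m := (pm_mul P).
Notation "x * y" := (star P x y).
Notation stl := (stl P).
Notation str := (str P).
Notation al := (al P).
Notation res := (res P).
Notation half_braiding U u := (iso2 (m ∘ (u ⋊ A)) (m ∘ (A ⋉ u) ∘ br U A)).
Notation one := (hom_id A).

Lemma hexagon_axiom U (u : hom U A) (g : half_braiding U u) :
  al u one one ∙ hb_at g (one * one) ∙ (al one one u ▷ br U (A ⊗ A))
  = stl (U ⊗ A) (hb_at g one) one ∙ res (one * u) (br U A) one
    ∙ (al one u one ▷ (br U A ⋊ A)) ∙ (str A one (hb_at g one) ▷ (br U A ⋊ A))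
    ∙ ((one * (one * u)) ◁ (hexR U A A)^-1) ->
  (pm_assoc P ▷ (u ⋊ (A ⊗ A))) ∙ (m ◁ (ich u m)^-1) ∙ (g ▷ (U ⋉ m))
    ∙ ((m ∘ (A ⋉ u)) ◁ bR U m) ∙ (m ◁ ((ich m u)^-1 ▷ br U (A ⊗ A)))
    ∙ (pm_assoc P ▷ (((A ⊗ A) ⋉ u) ∘ br U (A ⊗ A)))
  = (m ◁ (g ⋊₂ A)) ∙ (pm_assoc P ▷ ((A ⋉ (u ⋊ A)) ∘ (br U A ⋊ A)))
    ∙ (m ◁ ((A ⋉₂ g) ▷ (br U A ⋊ A)))
    ∙ ((m ∘ (A ⋉ m) ∘ ((A ⊗ A) ⋉ u)) ◁ (hexR U A A)^-1).
Proof.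
have E1 : one * one = m by apply: hom_inj; bnd.
have E2 : hb_at g (one * one) = hb_at g m :> Cell M by rewrite E1.
rewrite E2 !alE => H.
transitivity ((pm_assoc P ▷ (u ⋊ (A ⊗ A))) ∙ (m ◁ (ich u m)^-1) ∙ hb_at g m
    ∙ (pm_assoc P ▷ (((A ⊗ A) ⋉ u) ∘ br U (A ⊗ A)))).
  by symmetry; rw (hb_atE g m); pasting.
have E3 : (ich one m)^-1 = id2 (A ⋉ m) :> Cell M by exact: ichV_id_l.
have E4 : ich (br U A) one = id2 (br U A ⋊ A) :> Cell M by exact: ich_id_r.
transitivity ((pm_assoc P ▷ (u ⋊ (A ⊗ A))) ∙ (m ◁ (ich u m)^-1) ∙ hb_at g m
    ∙ (pm_assoc P ▷ (((A ⊗ A) ⋉ u) ∘ br U (A ⊗ A)))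
    ∙ (m ◁ ((ich one m)^-1 ▷ ((A ⊗ A) ⋉ u ∘ br U (A ⊗ A))))).
  by symmetry; rw E3; pasting.
rw H; do 2 rw (hb_at_id g); rw E3; rw E4; pasting.
Qed.

Definition mk_piece U (u : hom U A) (g : half_braiding U u) H : centre_piece P U :=
  @CentrePiece _ _ _ _ u g (@hexagon_axiom U u g H).

Section TensorIso.
Variables (U V : Ob M) (u : hom U A) (v : hom V A).
Variables (gu : half_braiding U u) (gv : half_braiding V v).

Definition hb_tens : half_braiding (U ⊗ V) (u * v).
Proof. apply: (iso_cast _ _ (hb_tens_at gu gv one)); bnd. Defined.

Lemma hb_tensE : hb_tens = hb_tens_at gu gv one :> Cell M.
Proof. by []. Qed.

Lemma hb_at_tens X (x : hom X A) : hb_at hb_tens x = hb_tens_at gu gv x :> Cell M.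
Proof.
have <- : hom_comp one x = x by apply: hom_inj; bnd.
rewrite hb_at_comp hb_tens_at_comp; rw (hb_at_id hb_tens); rw hb_tensE; pasting.
Qed.
End TensorIso.

Section Tensor.
Variables (U V : Ob M) (u : centre_piece P U) (v : centre_piece P V).
Notation hb_tens := (hb_tens (cp_iso u) (cp_iso v)).

Lemma tens_hexagon : let w := u * v in
  al w one one ∙ hb_at hb_tens (one * one) ∙ (al one one w ▷ br (U ⊗ V) (A ⊗ A))
  = stl (U ⊗ V ⊗ A) (hb_at hb_tens one) one ∙ res (one * w) (br (U ⊗ V) A) one
    ∙ (al one w one ▷ (br (U ⊗ V) A ⋊ A))
    ∙ (str A one (hb_at hb_tens one) ▷ (br (U ⊗ V) A ⋊ A))
    ∙ ((one * (one * w)) ◁ (hexR (U ⊗ V) A A)^-1).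
Proof.
move=> w; rewrite /w !hb_at_tens; exact: hb_tens_at_hexagon.
Qed.

Definition cp_tens : centre_piece P (U ⊗ V) := mk_piece tens_hexagon.
End Tensor.
End TensorPiece.

Section PieceMaps.
Variables (M : braided_gray_monoid) (A : Ob M) (P : pseudomonoid A).
Notation m := (pm_mul P).
Notation "x * y" := (star P x y).
Notation stl := (stl P).
Notation str := (str P).
Notation al := (al P).
Notation res := (res P).
Notation iso_stl := (iso_stl P).
Notation half_braiding U u := (iso2 (m ∘ (u ⋊ A)) (m ∘ (A ⋉ u) ∘ br U A)).
Notation one := (hom_id A).

Definition piece_map (U : Ob M) (u v : hom U A) (g : half_braiding U u) (h : half_braiding U v)
    (s : Cell M) : Prop :=
  stl U s one ∙ hb_at h one = hb_at g one ∙ (str A one s ▷ br U A).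

Definition hb_restr (U V : Ob M) (u : hom U A) (g : half_braiding U u) (f : hom V U) :
  half_braiding V (hom_comp u f).
Proof.
refine (iso_vcomp (iso_cast _ erefl (iso_rwhisk (k := f ⋊ A) g _))
  (iso_cast _ _ (iso_lwhisk (k := m ∘ (A ⋉ u)) (bl f A) _))); (bnd || rewrite /=; bd).
Defined.

Lemma hb_restr_val (U V : Ob M) (u : hom U A) (g : half_braiding U u) (f : hom V U) :
  hb_restr g f = (g ▷ (f ⋊ A)) ∙ ((m ∘ (A ⋉ u)) ◁ bl f A) :> Cell M.
Proof. by []. Qed.

Lemma hb_restrE (U V : Ob M) (u : hom U A) (g : half_braiding U u) (f : hom V U) :
  hb_at (hb_restr g f) one = (hb_at g one ▷ (f ⋊ A)) ∙ ((one * u) ◁ bl f A) :> Cell M.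
Proof.
rw (hb_at_id (hb_restr g f)); rw (hb_restr_val g f); symmetry; rw (hb_at_id g); pasting.
Qed.

Lemma ich_one X Y (f : hom X Y) : ich f one = id2 (f ⋊ A) :> Cell M.
Proof. exact: ich_id_r. Qed.

Section Basic.
Variables (U V W : Ob M).
Implicit Types (u v : hom U A) (w : hom W A).

Lemma piece_map_vcomp (u1 u2 u3 : hom U A) (g1 : half_braiding U u1) (g2 : half_braiding U u2)
    (g3 : half_braiding U u3) (s : cell u1 u2) (t : cell u2 u3) :
  piece_map g1 g2 s -> piece_map g2 g3 t -> piece_map g1 g3 (s ∙ t).
Proof.
rewrite /piece_map => Hs Ht; nrm; rw Ht; rw Hs; pasting.
Qed.

Lemma piece_map_inv u v (g : half_braiding U u) (h : half_braiding U v) (s : iso2 u v) :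
  piece_map g h s -> piece_map h g s^-1.
Proof.
rewrite /piece_map => Hs; cancel_l (iso_stl s one).
rw (iso_fwdK s); symmetry; rw Hs; rw (iso_fwdK s); pasting.
Qed.

Lemma piece_map_restr u v (g : half_braiding U u) (h : half_braiding U v) (s : cell u v)
    (f : hom V U) : piece_map g h s -> piece_map (hb_restr g f) (hb_restr h f) (s ▷ f).
Proof.
rewrite /piece_map => Hs; rw (hb_restrE h f); rw Hs; symmetry; rw (hb_restrE g f); pasting.
Qed.

Lemma piece_map_stl u v (g : half_braiding U u) (h : half_braiding U v) (s : cell u v)
    w (k : half_braiding W w) : piece_map g h s -> piece_map (hb_tens g k) (hb_tens h k) (stl U s w).
Proof.
rewrite /piece_map !hb_at_tens !hb_tens_atE => Hs.
rw (alN1 P s w one); rwr (alV_N1 P s one w); rw Hs; rw (alN2 P one s w); pasting.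
Qed.

Lemma piece_map_str u (g : half_braiding U u) w w' (k : half_braiding W w)
    (l : half_braiding W w') (t : cell w w') :
  piece_map k l t -> piece_map (hb_tens g k) (hb_tens g l) (str U u t).
Proof.
rewrite /piece_map !hb_at_tens !hb_tens_atE => Ht.
rw (alN2 P u t one); rw Ht; rwr (alV_N3 P u one t); rw (ich_nat_r (br U A) t).
rw (alN3 P one u t); pasting.
Qed.
End Basic.

Section RestrictTensor.
Variables (U V W : Ob M) (u : hom U A) (f : hom V U).

Lemma al_res1_one (w : hom W A) :
  stl (V ⊗ W) (res u f w) one ∙ (al u w one ▷ (f ⋊ (W ⊗ A)))
  = al (hom_comp u f) w one ∙ res u f (w * one).
Proof.
symmetry; rwr (al_res1 P u f w one); rw (ich_one (hom_rt f W)); pasting.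
Qed.

Lemma alV_res1_one (w : hom W A) :
  res u f (one * w) ∙ ((al u one w)^-1 ▷ (f ⋊ (A ⊗ W)))
  = (al (hom_comp u f) one w)^-1 ∙ res (u * one) (hom_rt f A) w.
Proof.
cancel_r (iso_inv (res (u * one) (hom_rt f A) w)).
rwr (alV_res1_l P u f one w); rw (ich_one f).
by symmetry; rw (iso_fwdK (ich (hom_rt f A) w)); pasting.
Qed.

Lemma piece_map_res (g : half_braiding U u) (w : hom W A) (k : half_braiding W w) :
  piece_map (hb_tens (hb_restr g f) k) (hb_restr (hb_tens g k) (hom_rt f W)) (res u f w).
Proof.
have E := ich_nat_l (f := hom_comp (br U A) (hom_rt f A))
  (f' := hom_comp (hom_lt A f) (br V A)) (bl f A) w.
rewrite /piece_map; rw (hb_restrE (hb_tens g k) (hom_rt f W)); rewrite !hb_at_tens !hb_tens_atE.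
rw (al_res1_one w). rwr (ich_nat_r f (g' := hom_comp (one * w) (br W A)) (hb_at k one)).
rw (ich_comp_r f (one * w) (br W A)).
rw (alV_res1_one w).
rw (@hexSV_bl1 _ V U W A f).
rw (iso_fwdK (ich f (br W A))).
symmetry.
rw (hb_restrE g f).
rw (al_res2 P one u f w).
rwr (ich_comp_l (hom_lt A f) (br V A) w).
rw E.
rw (ich_comp_l (br U A) (hom_rt f A) w).
symmetry; pasting.
Qed.
End RestrictTensor.

End PieceMaps.

Section PieceMaps.
Variables (M : braided_gray_monoid) (A : Ob M) (P : pseudomonoid A).
Notation m := (pm_mul P).
Notation "x * y" := (star P x y).
Notation stl := (stl P).
Notation str := (str P).
Notation al := (al P).
Notation res := (res P).
Notation half_braiding U u := (iso2 (m ∘ (u ⋊ A)) (m ∘ (A ⋉ u) ∘ br U A)).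
Notation one := (hom_id A).

Lemma piece_map_res_r U V W (u : hom U A) (g : half_braiding U u) (w : hom W A)
    (k : half_braiding W w) (f : hom V W) :
  piece_map (hb_tens g (hb_restr k f)) (hb_restr (hb_tens g k) (hom_lt U f)) (id2 (u * hom_comp w f)).
Proof.
rewrite /piece_map; rw (hb_restrE (hb_tens g k) (hom_lt U f)); rewrite !hb_at_tens !hb_tens_atE.
rw (hexSV_bl2 U A f).
have E : al u (hom_comp w f) one = al u w one ▷ (U ⋉ (f ⋊ A)) :> Cell M.
  have H := al_res2 P u w f one; transitivity (al u (hom_comp w f) one ∙ str U u (res w f one)).
    by symmetry; rw (ich_one A f); pasting.
  by rw H; rw (ich_one A (hom_lt U f)); pasting.
symmetry; rw E; rw (hb_restrE k f); rw (alV_comp_r P u one w f); rw (ich_comp_r (br U A) w f).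
rw (al_comp_r P one u w f).
symmetry; pasting.
Qed.

Lemma br_eq (X X' Y : Ob M) : X = X' -> br X Y = br X' Y :> Mor M.
Proof. by move=> ->. Qed.

Section Assoc.
Variables (U V W : Ob M).

(* hexS retyped along (U ⊗ V) ⊗ W = U ⊗ (V ⊗ W), as a constant that the reification of
   pasting diagrams treats as atomic. *)
Definition hexS_assoc (X : Ob M) :
  iso2 (br ((U ⊗ V) ⊗ W) X) ((br U X ⋊ (V ⊗ W)) ∘ (U ⋉ br (V ⊗ W) X)) :=
  iso_cast (br_eq X (tensOA U V W)) erefl (hexS U (V ⊗ W) X).

Lemma hexS_assoc_coh X :
  hexS (U ⊗ V) W X ∙ ((hexS U V X ⋊₂ W) ▷ ((U ⊗ V) ⋉ br W X))
  = hexS_assoc X ∙ ((br U X ⋊ (V ⊗ W)) ◁ (U ⋉₂ hexS V W X)).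
Proof. exact: br_coh2. Qed.

Lemma hexS_assoc_cohV X :
  (((hexS U V X)^-1 ⋊₂ W) ▷ ((U ⊗ V) ⋉ br W X)) ∙ (hexS (U ⊗ V) W X)^-1
  = ((br U X ⋊ (V ⊗ W)) ◁ (U ⋉₂ (hexS V W X)^-1)) ∙ (hexS_assoc X)^-1.
Proof.
cancel_l (iso_lwhisk (k := br U X ⋊ (V ⊗ W)) (iso_lt U (hexS V W X)) ltac:(bd)).
symmetry; rw (iso_fwdK (hexS V W X)); symmetry.
cancel_l (hexS_assoc X).
symmetry; rw (iso_fwdK (hexS_assoc X)); symmetry.
rwr (hexS_assoc_coh X); rw (iso_fwdK (hexS U V X)); rw (iso_fwdK (hexS (U ⊗ V) W X)).
pasting.
Qed.

Variables (u : hom U A) (v : hom V A) (w : hom W A).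
Variables (gu : half_braiding U u) (gv : half_braiding V v) (gw : half_braiding W w).

Definition hb_assoc : half_braiding ((U ⊗ V) ⊗ W) (hom_cast (tensOA U V W) (u * (v * w))) :=
  iso_cast erefl (congr1 (comp (m ∘ (A ⋉ (u * (v * w))))) (br_eq A (tensOA U V W)))
    (hb_tens gu (hb_tens gv gw)).

Lemma hb_at_assocE : hb_at hb_assoc one = al u (v * w) one ∙ (str U u (hb_at (hb_tens gv gw) one)
  ∙ (((al u one (v * w))^-1 ▷ (U ⋉ br (V ⊗ W) A))
  ∙ ((stl (U ⊗ A) (hb_at gu one) (v * w) ▷ (U ⋉ br (V ⊗ W) A))
  ∙ ((res (one * u) (br U A) (v * w) ▷ (U ⋉ br (V ⊗ W) A))
  ∙ ((((one * u) * (v * w)) ◁ (hexS_assoc A)^-1)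
  ∙ (al one u (v * w) ▷ br ((U ⊗ V) ⊗ W) A)))))) :> Cell M.
Proof.
rewrite (hb_at_id hb_assoc).
rewrite -[LHS]/(cell_val (hb_tens_at gu (hb_tens gv gw) one)) hb_tens_atE.
congr (_ ∙ (_ ∙ (_ ∙ (_ ∙ (_ ∙ (_ ∙ (_ ▷ _))))))); exact: br_eq (tensOA U V W).
Qed.

Lemma piece_map_al : piece_map (hb_tens (hb_tens gu gv) gw) hb_assoc (al u v w).
Proof.
rewrite /piece_map hb_at_assocE.
rewrite !hb_at_tens !hb_tens_atE.
rwr (al_pentagon P u v w one).
rwr (alN3_r P u v (z := one * w) (g := br W A) (hb_at gw one)).
rwr (pent_mid' P u v one w).
rwr (alN2 P u (y' := hom_comp (one * v) (br V A)) (hb_at gv one) w).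
rw (al_res2 P u (one * v) (br V A) w).
rw (pent_mid P u one v w).
rwr (alN1 P (x' := hom_comp (one * u) (br U A)) (hb_at gu one) v w).
rwr (al_res1 P (one * u) (br U A) v w).
rw (al_pentagon P one u v w).
rwr (hexS_assoc_cohV A).
symmetry; rw (hb_at_tens gu gv one); rw (hb_tens_atE gu gv one); rw (hexSV_ich U V A w); symmetry; pasting.
Qed.
End Assoc.
End PieceMaps.

Section Braid.
Variables (M : braided_gray_monoid) (A : Ob M) (P : pseudomonoid A).
Notation m := (pm_mul P).
Notation "x * y" := (star P x y).
Notation stl := (stl P).
Notation str := (str P).
Notation al := (al P).
Notation res := (res P).
Notation half_braiding U u := (iso2 (m ∘ (u ⋊ A)) (m ∘ (A ⋉ u) ∘ br U A)).
Notation one := (hom_id A).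

Lemma br_coh4V (X Y Z : Ob M) :
  ((hexR X Z Y)^-1 ▷ (X ⋉ br Y Z)) ∙ bR X (br Y Z) ∙ ((br Y Z ⋊ X) ◁ hexR X Y Z)
    ∙ ((hexS Y X Z)^-1 ▷ (br X Y ⋊ Z)) ∙ bl (br X Y) Z
  = (Z ⋉ br X Y) ◁ (hexS X Y Z)^-1.
Proof.
cancel_l (iso_rwhisk (k := X ⋉ br Y Z) (hexR X Z Y) ltac:(bd)).
rw (iso_fwdK (hexR X Z Y)).
cancel_l (iso_inv (bR X (br Y Z))).
rw (iso_bwdK (bR X (br Y Z))).
cancel_l (iso_lwhisk (k := br Y Z ⋊ X) (iso_inv (hexR X Y Z)) ltac:(bd)).
rw (iso_bwdK (hexR X Y Z)).
symmetry; rw (br_coh4E X Y Z); rw (iso_fwdK (hexS X Y Z)); pasting.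
Qed.

Lemma piece_map_braid (U V : Ob M) (u : centre_piece P U) (v : hom V A)
    (gv : half_braiding V v) :
  piece_map (hb_tens (cp_iso u) gv) (hb_restr (hb_tens gv (cp_iso u)) (br U V)) (hb_at (cp_iso u) v).
Proof.
rewrite /piece_map; rw (hb_restrE (hb_tens gv (cp_iso u)) (br U V)); rewrite !hb_at_tens !hb_tens_atE.
have E1 : stl (U ⊗ V) (hb_at (cp_iso u) v) one ∙ (al v u one ▷ (br U V ⋊ A))
    ∙ (str V v (hb_at (cp_iso u) one) ▷ (br U V ⋊ A))
  = al u v one ∙ hb_at (cp_iso u) (v * one) ∙ (al v one u ▷ br U (V ⊗ A))
    ∙ ((v * (one * u)) ◁ hexR U V A).
  symmetry; rw (hb_at_hexagon u v one); rw (iso_bwdK (hexR U V A)); rw (ich_one A (br U V)).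
  pasting.
rw E1; rw (iso_fwdK (al v one u)).
rwr (hb_atN (cp_iso u) (x' := hom_comp (one * v) (br V A)) (hb_at gv one)).
rw (hb_at_comp (cp_iso u) (one * v) (br V A)).
rw (iso_bwdK (ich (br V A) u)).
have E2 : hb_at (cp_iso u) (one * v) ∙ (al one v u ▷ br U (A ⊗ V))
  = (al u one v)^-1 ∙ stl (U ⊗ A) (hb_at (cp_iso u) one) v ∙ res (one * u) (br U A) v
    ∙ (al one u v ▷ (br U A ⋊ V))
    ∙ (str A one (hb_at (cp_iso u) v) ▷ (br U A ⋊ V))
    ∙ ((one * (v * u)) ◁ (hexR U A V)^-1) by exact: hb_at_hexagon_r.
rw E2; rw (br_coh4V U V A); pasting.
Qed.
End Braid.

(** * The unit *)

Section Equivalences.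
Variables (M : gray_monoid).

Lemma lwhisk_faithful (x y w : Ob M) (e : hom x y) (e' : hom y x) (eta : iso2 (e' ∘ e) (id1 x))
  (f g : hom w x) (a b : cell f g) : e ◁ a = e ◁ b -> a = b :> Cell M.
Proof.
move=> E; have ef : dom (e' ∘ e) = cod f by bd.
cancel_l (iso_rwhisk eta ef).
transitivity ((e' ◁ (e ◁ a)) ∙ (eta ▷ g)); first by pasting.
rewrite E; pasting.
Qed.
Lemma rwhisk_faithful (x y w : Ob M) (e : hom w x) (e' : hom x w) (eps : iso2 (e ∘ e') (id1 x))
  (f g : hom x y) (a b : cell f g) : a ▷ e = b ▷ e -> a = b :> Cell M.
Proof.
move=> E; have ef : dom f = cod (e ∘ e') by bd.
cancel_l (iso_lwhisk eps ef).
transitivity (((a ▷ e) ▷ e') ∙ (g ◁ eps)); first by pasting.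
rewrite E; pasting.
Qed.
Lemma lwhisk_full (x y w : Ob M) (e : hom x y) (e' : hom y x) (eta : iso2 (e' ∘ e) (id1 x))
  (eps : iso2 (e ∘ e') (id1 y)) (f g : hom w x) (s : iso2 (e ∘ f) (e ∘ g)) :
  exists t : iso2 f g, e ◁ t = s.
Proof.
have ef : dom (e' ∘ e) = cod f by bd.
have eg : dom (e' ∘ e) = cod g by bd.
have es : dom e' = cod (e ∘ f) by bd.
have e1 : id1 x ∘ f = f by bnd.
have e2 : id1 x ∘ g = g by bnd.
have e3 : e' ∘ (e ∘ f) = e' ∘ e ∘ f by bnd.
have e4 : e' ∘ (e ∘ g) = e' ∘ e ∘ g by bnd.
exists (iso_vcomp (iso_inv (iso_cast erefl e1 (iso_rwhisk eta ef)))
  (iso_vcomp (iso_cast e3 e4 (iso_lwhisk s es)) (iso_cast erefl e2 (iso_rwhisk eta eg)))).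
set t := iso_vcomp _ _.
have Et : (eta ▷ f) ∙ t = (e' ◁ s) ∙ (eta ▷ g).
  rewrite /t; rw (iso_fwdK eta); pasting.
have E : e' ◁ (e ◁ t) = e' ◁ s.
  cancel_r (iso_rwhisk eta eg).
  transitivity ((eta ▷ f) ∙ t); first by pasting.
  by rw Et; pasting.
have es' : dom e = cod f by bd.
exact: (@lwhisk_faithful y x w e' e eps (hom_comp e f) (hom_comp e g)
  (cell_lwhisk t es') s E).
Qed.
End Equivalences.

Section Units.
Variables (M : gray_monoid) (A : Ob M) (P : pseudomonoid A).
Notation m := (pm_mul P).
Notation j := (pm_unit P).
Notation "x * y" := (star P x y).
Notation stl := (stl P).
Notation str := (str P).
Notation al := (al P).
Notation res := (res P).
Notation iso_str := (iso_str P).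
Notation iso_stl := (iso_stl P).
Notation I := (@unitO M).

Definition lam X (x : hom X A) : iso2 (j * x) x.
Proof.
refine (iso_cast _ _ (iso_rwhisk (pm_lunit P) (k := x) _)); (bnd || bd).
Defined.
Definition rho X (x : hom X A) : iso2 (x * j) x.
Proof.
refine (iso_vcomp (iso_cast _ erefl (iso_lwhisk (k := m) (ich x j) _))
  (iso_cast _ _ (iso_rwhisk (pm_runit P) (k := x) _))); (bnd || bd || (rewrite /=; bd)).
Defined.

Lemma lamE X (x : hom X A) : lam x = pm_lunit P ▷ x :> Cell M.
Proof. by []. Qed.
Lemma rhoE X (x : hom X A) : rho x = (m ◁ ich x j) ∙ (pm_runit P ▷ x) :> Cell M.
Proof. by []. Qed.

Lemma lam_nat X (x x' : hom X A) (b : cell x x') : str I j b ∙ lam x' = lam x ∙ b.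
Proof. rewrite !lamE; pasting. Qed.
Lemma rho_nat X (x x' : hom X A) (b : cell x x') : stl X b j ∙ rho x' = rho x ∙ b.
Proof. rewrite !rhoE; rw (ich_nat_l b j); pasting. Qed.
Lemma rho_comp X Y (x : hom X A) (f : hom Y X) :
  rho (hom_comp x f) = res x f j ∙ (rho x ▷ f) :> Cell M.
Proof. rewrite !rhoE resE; rw (ich_comp_l x f j); pasting. Qed.

Lemma pm_triangleE :
    (pm_assoc P ▷ (A ⋉ (j ⋊ A))) ∙ (m ◁ (A ⋉₂ pm_lunit P))
    = m ◁ (pm_runit P ⋊₂ A).
Proof. exact: pm_triangle. Qed.

Lemma triangle X Y (x : hom X A) (y : hom Y A) :
  al x j y ∙ str X x (lam y) = stl X (rho x) y.
Proof.
rewrite alE lamE rhoE.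
have E : (ich x (hom_comp m (hom_rt j A)))^-1 ∙ ((x ⋊ A) ◁ (X ⋉₂ pm_lunit P))
    = ((A ⋉₂ pm_lunit P) ▷ (x ⋊ (I ⊗ A))) ∙ (ich x (hom_id A))^-1.
  exact: (@ichV_nat_r _ _ _ _ _ x (hom_comp m (hom_rt j A))
    (hom_cast (esym (tensO1l A)) (hom_id A)) (pm_lunit P)).
symmetry; rwr pm_triangleE; rwr (ich_rt A x j); symmetry.
have E2 : ((ich x m)^-1 ▷ (X ⋉ (j ⋊ A))) ∙ ((x ⋊ A) ◁ (X ⋉₂ pm_lunit P))
  = ((A ⋉ m) ◁ ich x (hom_rt j A)) ∙ ((A ⋉₂ pm_lunit P) ▷ (x ⋊ A)).
  cancel_l (iso_inv (iso_lwhisk (k := A ⋉ m) (ich x (hom_rt j A)) ltac:(rewrite /=; bd))).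
  rwr (ichV_comp_r x m (hom_rt j A)); rw E; symmetry; rw (iso_bwdK (ich x (hom_rt j A))).
  symmetry; rw (ichV_id_r A x); pasting.
rw E2; pasting.
Qed.

Lemma str_unit_inj X (x x' : hom X A) (a b : cell x x') : str I j a = str I j b -> a = b :> Cell M.
Proof.
move=> E; cancel_l (lam x); rwr (lam_nat a); rw E; rw (lam_nat b); pasting.
Qed.
Lemma stl_unit_inj X (x x' : hom X A) (a b : cell x x') : stl X a j = stl X b j -> a = b :> Cell M.
Proof.
move=> E; cancel_l (rho x); rwr (rho_nat a); rw E; rw (rho_nat b); pasting.
Qed.

Lemma al_cast1 X X' Y Z (e : X = X') (x : hom X A) (y : hom Y A) (z : hom Z A) :
  al (hom_cast e x) y z = al x y z :> Cell M.
Proof. by case: _ / e. Qed.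
Lemma al_cast2 X Y Y' Z (e : Y = Y') (x : hom X A) (y : hom Y A) (z : hom Z A) :
  al x (hom_cast e y) z = al x y z :> Cell M.
Proof. by case: _ / e. Qed.
Lemma al_cast3 X Y Z Z' (e : Z = Z') (x : hom X A) (y : hom Y A) (z : hom Z A) :
  al x y (hom_cast e z) = al x y z :> Cell M.
Proof. by case: _ / e. Qed.

Lemma kelly_l X Y (x : hom X A) (y : hom Y A) :
  al j x y ∙ lam (x * y) = stl X (lam x) y.
Proof.
have e : I ⊗ X ⊗ Y = X ⊗ Y by rewrite tensO1l.
have e' : hom_cast (esym (tensO1l X)) x * y = x * y :> Mor M by bnd.
pose b := iso_cast erefl e' (iso_stl (x' := hom_cast (esym (tensO1l X)) x) (lam x) y).
transitivity (cell_val b); last by rewrite /b; pasting.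
apply: (str_unit_inj (X := X ⊗ Y) (x := hom_cast e ((j * x) * y)) (x' := x * y)
  (a := cell_vcomp (al j x y) (lam (x * y))) (b := b)); rewrite /b.
cancel_l (al j (j * x) y).
cancel_l (iso_stl (x' := hom_cast (tensOA I I X) (j * (j * x))) (al j j x) y).
transitivity (al (j * j) x y ∙ al j j (x * y) ∙ str I j (lam (x * y))).
  by symmetry; rw (al_pentagon P j j x y); pasting.
rw (triangle j (x * y)); symmetry.
rwr (alN2 P j (y' := hom_cast (esym (tensO1l X)) x) (lam x) y); rw (triangle j x).
rw (al_cast2 (esym (tensO1l X)) j x y).
rwr (al_cast1 (esym (tensO1l I)) j x y).
rw (alN1 P (x' := hom_cast (esym (tensO1l I)) j) (rho j) x y); pasting.
Qed.
Lemma kelly_r X Y (x : hom X A) (y : hom Y A) :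
  al x y j ∙ str X x (rho y) = rho (x * y).
Proof.
have e : X ⊗ Y ⊗ I = X ⊗ Y by rewrite tensO1r.
have e' : x * hom_cast (esym (tensO1r Y)) y = x * y :> Mor M by bnd.
pose a := iso_vcomp (al x y j)
  (iso_cast erefl e' (iso_str x (y' := hom_cast (esym (tensO1r Y)) y) (rho y))).
transitivity (cell_val a); first by rewrite /a; pasting.
apply: (stl_unit_inj (X := X ⊗ Y) (x := hom_cast e ((x * y) * j)) (x' := x * y)
  (a := a) (b := rho (x * y))); rewrite /a.
cancel_r (al x y j).
symmetry; rwr (triangle (x * y) j).
rwr (al_cast3 (esym (tensO1l I)) x y j).
rw (alN3 P x y (z' := hom_cast (esym (tensO1l I)) j) (lam j)); rw (al_pentagon P x y j j).
rw (triangle y j); rwr (alN2 P x (y' := hom_cast (esym (tensO1r Y)) y) (rho y) j).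
rw (al_cast2 (esym (tensO1r Y)) x y j); pasting.
Qed.
End Units.

Section UnitBraiding.
Variable M : braided_gray_monoid.
Notation I := (@unitO M).
Implicit Types (V W X Y Z : Ob M).

(* The components of hexS at the unit, retyped along I ⊗ X = X = X ⊗ I. *)
Definition hexS_unit X : iso2 (br I X) (br I X ∘ br I X).
Proof. by apply: (iso_cast _ _ (hexS I I X)); [apply: br_eq; bd | bnd]. Defined.
Definition hexS_unit_l V X : iso2 (br V X) ((br I X ⋊ V) ∘ br V X).
Proof. by apply: (iso_cast _ _ (hexS I V X)); [apply: br_eq; bd | bnd]. Defined.
Definition hexS_unit_r V X : iso2 (br V X) (br V X ∘ (V ⋉ br I X)).
Proof. by apply: (iso_cast _ _ (hexS V I X)); [apply: br_eq; bd | bnd]. Defined.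

Lemma bR_eq X X' Y Z (h : hom Y Z) : X = X' -> bR X h = bR X' h :> Cell M.
Proof. by move=> ->. Qed.
Lemma hexR_eq X X' Y Z : X = X' -> hexR X Y Z = hexR X' Y Z :> Cell M.
Proof. by move=> ->. Qed.
Lemma hexS_eq1 X X' Y Z : X = X' -> hexS X Y Z = hexS X' Y Z :> Cell M.
Proof. by move=> ->. Qed.
Lemma hexS_eq2 X Y Y' Z : Y = Y' -> hexS X Y Z = hexS X Y' Z :> Cell M.
Proof. by move=> ->. Qed.

Definition is_nu X (n : Cell M) : Prop := br I X ◁ n = hexS_unit X.

Lemma br_faithful X Y W (f g : hom W (X ⊗ Y)) (a b : cell f g) :
  br X Y ◁ a = br X Y ◁ b -> a = b :> Cell M.
Proof. by case: (br_equiv X Y) => e' [[eta] _]; exact: (lwhisk_faithful eta). Qed.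

Lemma nu_exists X : exists n : iso2 (id1 X) (br I X), is_nu X n.
Proof.
have [e' [[eta] [eps]]] := br_equiv I X.
have e1 : br I X = br I X ∘ id1 (I ⊗ X) :> Mor M by bnd.
have [n En] := lwhisk_full (f := hom_id (I ⊗ X))
  (g := hom_castr (etrans (tensO1r X) (esym (tensO1l X))) (br I X)) eta eps (iso_cast e1 erefl (hexS_unit X)).
have e2 : id1 (I ⊗ X) = id1 X by rewrite tensO1l.
by exists (iso_cast e2 erefl n).
Qed.

Lemma nu_r X (n : iso2 (id1 X) (br I X)) : is_nu X n -> n ▷ br I X = hexS_unit X.
Proof.
move=> En.
pose f := hom_castr (etrans (tensO1r X) (esym (tensO1l X))) (br I X).
have e : dom (id1 X) = cod (br I X) by bd.
have e1 : id1 X ∘ br I X = br I X :> Mor M by bnd.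
apply: (@br_faithful I X _ f (hom_comp f f)
  (iso_cast e1 erefl (iso_rwhisk n e)) (hexS_unit X)).
transitivity ((br I X ◁ n) ▷ br I X); first by pasting.
rewrite En.
cancel_l (hexS_unit X).
have E := br_coh2 I I I X.
rewrite (hexS_eq1 _ _ (tensO1l I)) (hexS_eq2 _ _ (tensO1l I)) in E.
have {}E : hexS_unit X ∙ ((hexS_unit X ⋊₂ I) ▷ ((I ⊗ I) ⋉ br I X))
  = hexS_unit X ∙ ((br I X ⋊ (I ⊗ I)) ◁ (I ⋉₂ hexS_unit X)) := E.
transitivity (hexS_unit X ∙ ((hexS_unit X ⋊₂ I) ▷ ((I ⊗ I) ⋉ br I X))); first by pasting.
rewrite E; pasting.
Qed.

Lemma nu_natural X Y (f : hom X Y) (n : iso2 (id1 X) (br I X)) (k : iso2 (id1 Y) (br I Y)) :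
  is_nu X n -> is_nu Y k -> (k ▷ f) ∙ bR I f = f ◁ n.
Proof.
move=> En Ek.
have E := hexS_bR I I f; rewrite (bR_eq f (tensO1l I)) in E.
have {}E : bR I f ∙ ((f ⋊ (I ⊗ I)) ◁ hexS_unit X)
  = (hexS_unit Y ▷ ((I ⊗ I) ⋉ f)) ∙ ((br I Y ⋊ I) ◁ (I ⋉₂ bR I f))
    ∙ ((bR I f ⋊₂ I) ▷ (I ⋉ br I X)) := E.
have e1 : dom (id1 Y) = cod f by bd.
have e2 : dom f = cod (id1 X) by bd.
have e3 : dom (br I Y ∘ (I ⋉ f)) = cod (br I X) by bd.
have e4 : id1 Y ∘ f = f by bnd.
have e5 : f ∘ id1 X = f by bnd.
have e6 : br I Y ∘ (I ⋉ f) = br I Y ∘ f by bnd.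
have e7 : (f ⋊ I) ∘ br I X = f ∘ br I X by bnd.
pose f' := hom_castr (esym (tensO1l Y)) f.
pose g' := hom_castr (esym (tensO1l Y)) (hom_comp f (hom_castr (tensO1r X) (hom_cast (tensO1l X) (br I X)))).
apply: (@br_faithful I Y X f' g' (iso_vcomp (iso_cast e4 erefl (iso_rwhisk k e1)) (iso_cast e6 e7 (bR I f)))
  (iso_cast e5 erefl (iso_lwhisk n e2))).
cancel_r (iso_rwhisk (bR I f) e3).
transitivity ((br I Y ◁ k) ▷ f ∙ (br I Y ◁ bR I f) ∙ (bR I f ▷ br I X)); first by pasting.
rewrite Ek; transitivity (bR I f ∙ (f ◁ hexS_unit X)).
  by symmetry; rw E; pasting.
rewrite -En; pasting.
Qed.

Lemma rt_faithful (X Y V W : Ob M) (e : hom X Y) (f g : hom W (X ⊗ V)) (a b : cell f g) :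
  equivalence1 e -> (e ⋊ V) ◁ a = (e ⋊ V) ◁ b -> a = b :> Cell M.
Proof.
move=> [e' [[eta] _]].
have e1 : (e' ∘ e) ⋊ V = (e' ⋊ V) ∘ (e ⋊ V) by bnd.
have e2 : id1 X ⋊ V = id1 (X ⊗ V) by bnd.
exact: (@lwhisk_faithful _ _ _ _ (hom_rt e V) (hom_rt e' V) (iso_cast e1 e2 (iso_rt eta V))).
Qed.
Lemma lt_faithful (X Y V W : Ob M) (e : hom X Y) (f g : hom (V ⊗ Y) W) (a b : cell f g) :
  equivalence1 e -> a ▷ (V ⋉ e) = b ▷ (V ⋉ e) -> a = b :> Cell M.
Proof.
move=> [e' [_ [eps]]].
have e1 : V ⋉ (e ∘ e') = (V ⋉ e) ∘ (V ⋉ e') by bnd.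
have e2 : V ⋉ id1 Y = id1 (V ⊗ Y) by bnd.
exact: (@rwhisk_faithful _ _ _ _ (hom_lt V e) (hom_lt V e') (iso_cast e1 e2 (iso_lt V eps))).
Qed.

Lemma nu_hexS_l V X (n : iso2 (id1 X) (br I X)) : is_nu X n ->
  hexS_unit_l V X = (n ⋊₂ V) ▷ br V X :> Cell M.
Proof.
move=> En.
have E := br_coh2 I I V X.
rewrite (hexS_eq1 _ _ (tensO1l I)) (hexS_eq2 _ _ (tensO1l V)) in E.
have {}E : hexS_unit_l V X ∙ ((hexS_unit X ⋊₂ V) ▷ ((I ⊗ I) ⋉ br V X))
  = hexS_unit_l V X ∙ ((br I X ⋊ (I ⊗ V)) ◁ (I ⋉₂ hexS_unit_l V X)) := E.
have e1 : dom (id1 X ⋊ V) = cod (br V X) by bd.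
have e2 : (id1 X ⋊ V) ∘ br V X = br V X by bnd.
pose c := hom_castr (esym (congr1 (fun z => z ⊗ V) (tensO1l X))) (br V X).
pose d := hom_castr (etrans (esym (tensOA X I V)) (congr2 tensO (esym (tensO1l X)) (tensO1l V)))
 (hom_comp (hom_rt (br I X) V) c).
apply: (@rt_faithful _ _ V _ (br I X) c d (hexS_unit_l V X)
  (iso_cast e2 erefl (iso_rwhisk (iso_rt n V) e1)) (br_equiv I X)).
cancel_l (hexS_unit_l V X).
transitivity (hexS_unit_l V X ∙ ((br I X ⋊ (I ⊗ V)) ◁ (I ⋉₂ hexS_unit_l V X))); first by pasting.
rewrite -E -En; pasting.
Qed.

Lemma nu_hexS_r V X (n : iso2 (id1 X) (br I X)) : is_nu X n ->
  hexS_unit_r V X = br V X ◁ (V ⋉₂ n) :> Cell M.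
Proof.
move=> En.
have E := br_coh2 V I I X.
rewrite (hexS_eq1 _ _ (tensO1r V)) (hexS_eq2 _ _ (tensO1l I)) in E.
have {}E : hexS_unit_r V X ∙ ((hexS_unit_r V X ⋊₂ I) ▷ ((V ⊗ I) ⋉ br I X))
  = hexS_unit_r V X ∙ ((br V X ⋊ (I ⊗ I)) ◁ (V ⋉₂ hexS_unit X)) := E.
have e1 : dom (br V X) = cod (V ⋉ id1 X) by bd.
have e2 : br V X ∘ (V ⋉ id1 X) = br V X by bnd.
pose c := hom_cast (congr1 (tensO V) (esym (tensO1r X))) (br V X).
pose d := hom_comp c (hom_lt V (hom_cast (etrans (tensO1l X) (esym (tensO1r X))) (br I X))).
apply: (@lt_faithful _ _ V _ (br I X) c d (hexS_unit_r V X)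
  (iso_cast e2 erefl (iso_lwhisk (iso_lt V n) e1)) (br_equiv I X)).
cancel_l (hexS_unit_r V X).
transitivity (hexS_unit_r V X ∙ ((hexS_unit_r V X ⋊₂ I) ▷ ((V ⊗ I) ⋉ br I X))); first by pasting.
rewrite E -(nu_r En); pasting.
Qed.
Lemma nu_tens X Y (n : iso2 (id1 X) (br I X)) (k : iso2 (id1 Y) (br I Y))
    (l : iso2 (id1 (X ⊗ Y)) (br I (X ⊗ Y))) :
  is_nu X n -> is_nu Y k -> is_nu (X ⊗ Y) l ->
  l ∙ hexR I X Y = (n ⋊₂ Y) ∙ ((X ⋉₂ k) ▷ (br I X ⋊ Y)).
Proof.
move=> En Ek El.
have E := br_coh3E I I X Y.
rewrite (hexR_eq _ _ (tensO1l I)) in E.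
have {}E : hexR I X Y ∙ ((X ⋉ br (I ⊗ I) Y) ◁ (hexS_unit X ⋊₂ Y))
      ∙ ((X ⋉₂ hexS_unit Y) ▷ ((br I X ⋊ (I ⊗ Y)) ∘ (I ⋉ (br I X ⋊ Y))))
    = hexS_unit (X ⊗ Y) ∙ ((br I (X ⊗ Y) ⋊ I) ◁ (I ⋉₂ hexR I X Y))
      ∙ ((hexR I X Y ⋊₂ I) ▷ (((I ⊗ X) ⋉ br I Y) ∘ (I ⋉ (br I X ⋊ Y))))
      ∙ ((X ⋉ (br I Y ⋊ I)) ◁ (ich (br I X) (br I Y) ▷ (I ⋉ (br I X ⋊ Y)))) := E.
rewrite (br_eq Y (tensO1l I)) in E.
have Ei : ((br I X ⋊ Y) ◁ ((I ⊗ X) ⋉₂ k)) ∙ ich (br I X) (br I Y)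
  = ich (br I X) (hom_id Y) ∙ (((X ⊗ I) ⋉₂ k) ▷ (br I X ⋊ Y)).
  exact: (ich_nat_r (br I X) (g := hom_id Y)
    (g' := hom_castr (tensO1r Y) (hom_cast (tensO1l Y) (br I Y))) k).
have Ej : ich (br I X) (hom_id Y) = id2 (br I X ⋊ Y) :> Cell M by exact: ich_id_r.
have e2 : dom (X ⋉ id1 Y) = cod (br I X ⋊ Y) by bd.
have h1 : X ⊗ (Y ⊗ I) = I ⊗ (X ⊗ Y) by bd.
have h2 : (X ⊗ I) ⊗ Y = X ⊗ (I ⊗ Y) by bd.
have h3 : (I ⊗ X) ⊗ Y = X ⊗ Y by bd.
pose f := hom_castr (esym (tensO1l (X ⊗ Y))) (hom_id (X ⊗ Y)).
pose g := hom_castr h1 (hom_comp (hom_lt X (br I Y)) (hom_castr h2 (hom_cast h3 (hom_rt (br I X) Y)))).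
have f1 : id1 (X ⊗ Y) = id1 X ⋊ Y by bnd.
have f2 : br I X ⋊ Y = (X ⋉ id1 Y) ∘ (br I X ⋊ Y) by bnd.
apply: (@br_faithful I (X ⊗ Y) _ f g (iso_vcomp l (hexR I X Y))
  (iso_vcomp (iso_cast (esym f1) f2 (iso_rt n Y)) (iso_rwhisk (iso_lt X k) e2))).
have e3 : dom (X ⋉ br I Y) = cod ((br I X ⋊ (Y ⊗ I)) ∘ ((I ⊗ X) ⋉ br I Y)) by bd.
have e4 : dom ((X ⋉ br I Y) ∘ ((br I X ⋊ (Y ⊗ I)) ∘ ((I ⊗ X) ⋉ br I Y)))
  = cod (I ⋉ (br I X ⋊ Y)) by bd.
have e5 : dom (br I (X ⊗ Y)) = cod (((I ⊗ X) ⋉ br I Y) ∘ (I ⋉ (br I X ⋊ Y))) by bd.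
cancel_r (iso_rwhisk (hexR I X Y) e5).
cancel_r (iso_rwhisk (iso_lwhisk (ich (br I X) (br I Y)) e3) e4).
transitivity ((br I (X ⊗ Y) ◁ l) ∙ ((br I (X ⊗ Y) ⋊ I) ◁ (I ⋉₂ hexR I X Y))
      ∙ ((hexR I X Y ⋊₂ I) ▷ (((I ⊗ X) ⋉ br I Y) ∘ (I ⋉ (br I X ⋊ Y))))
      ∙ ((X ⋉ (br I Y ⋊ I)) ◁ (ich (br I X) (br I Y) ▷ (I ⋉ (br I X ⋊ Y))))); first by pasting.
rewrite El -E -En -Ek; symmetry.
rw Ei; rw Ej; pasting.
Qed.

End UnitBraiding.

Section UnitPiece.
Variables (M : braided_gray_monoid) (A : Ob M) (P : pseudomonoid A).
Notation m := (pm_mul P).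
Notation j := (pm_unit P).
Notation "x * y" := (star P x y).
Notation stl := (stl P).
Notation str := (str P).
Notation al := (al P).
Notation res := (res P).
Notation lam := (lam P).
Notation rho := (rho P).
Notation half_braiding U u := (iso2 (m ∘ (u ⋊ A)) (m ∘ (A ⋉ u) ∘ br U A)).
Notation one := (hom_id A).
Notation I := (@unitO M).

Lemma kelly_rV X Y (x : hom X A) (y : hom Y A) :
  (rho (x * y))^-1 ∙ al x y j = str X x (rho y)^-1.
Proof.
cancel_l (rho (x * y)); rw (iso_fwdK (rho (x * y))); symmetry.
rwr (kelly_r P x y); rw (iso_fwdK (rho y)); pasting.
Qed.
Lemma kelly_rV' X Y (x : hom X A) (y : hom Y A) :
  str X x (rho y)^-1 ∙ (al x y j)^-1 = (rho (x * y))^-1.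
Proof.
rwr (kelly_rV x y); rw (iso_fwdK (al x y j)); pasting.
Qed.
Lemma kelly_l' X Y (x : hom X A) (y : hom Y A) :
  (al j x y)^-1 ∙ stl X (lam x) y = lam (x * y).
Proof. rwr (kelly_l P x y); rw (iso_bwdK (al j x y)); pasting. Qed.
Lemma lam_comp X Y (x : hom X A) (f : hom Y X) : lam (hom_comp x f) = lam x ▷ f :> Cell M.
Proof. rewrite !lamE; pasting. Qed.
Lemma triangleV X Y (x : hom X A) (y : hom Y A) :
  stl X (rho x)^-1 y ∙ al x j y ∙ str X x (lam y) = id2 (x * y).
Proof. rw (triangle P x y); rw (iso_bwdK (rho x)); pasting. Qed.
Lemma rhoV_nat X (x x' : hom X A) (b : cell x x') :
  (rho x)^-1 ∙ stl X b j = b ∙ (rho x')^-1.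
Proof. conj_sq (rho x) (rho x'); exact: rho_nat. Qed.
Lemma rhoV_res X Y (x : hom X A) (f : hom Y X) :
  (rho (hom_comp x f))^-1 ∙ res x f j = (rho x)^-1 ▷ f.
Proof.
cancel_l (rho (hom_comp x f)); rw (iso_fwdK (rho (hom_comp x f))).
symmetry; rw (rho_comp P x f); rw (iso_fwdK (rho x)); pasting.
Qed.

Variables (n : iso2 (id1 A) (br I A)) (En : is_nu A n).

Definition hb_unit : half_braiding I j.
Proof.
refine (iso_vcomp (iso_cast _ erefl (pm_lunit P)) (iso_vcomp
  (iso_cast erefl erefl (pm_runit P)^-1)
  (iso_cast _ erefl (iso_lwhisk (k := m ∘ (A ⋉ j)) n _)))); (bnd || rewrite /=; bd).
Defined.

Lemma hb_unitE : hb_unit = pm_lunit P ∙ ((pm_runit P)^-1 ∙ ((m ∘ (A ⋉ j)) ◁ n)) :> Cell M.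
Proof. by []. Qed.

Lemma rhoVE X (x : hom X A) :
  (rho x)^-1 = ((pm_runit P)^-1 ▷ x) ∙ (m ◁ (ich x j)^-1) :> Cell M.
Proof. by []. Qed.

Lemma hb_at_unit X (x : hom X A) (k : iso2 (id1 X) (br I X)) : is_nu X k ->
  hb_at hb_unit x = lam x ∙ ((rho x)^-1 ∙ ((x * j) ◁ k)) :> Cell M.
Proof.
move=> Ek.
rewrite !hb_atE; rw hb_unitE; rw (nu_natural x Ek En); symmetry; rw (lamE P x); rw (rhoVE x); pasting.
Qed.

Lemma unit_hexagon (l : iso2 (id1 (A ⊗ A)) (br I (A ⊗ A))) : is_nu (A ⊗ A) l ->
  al j one one ∙ hb_at hb_unit (one * one) ∙ (al one one j ▷ br I (A ⊗ A))
  = stl (I ⊗ A) (hb_at hb_unit one) one ∙ res (one * j) (br I A) one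
    ∙ (al one j one ▷ (br I A ⋊ A)) ∙ (str A one (hb_at hb_unit one) ▷ (br I A ⋊ A))
    ∙ ((one * (one * j)) ◁ (hexR I A A)^-1).
Proof.
move=> El.
rewrite (hb_at_unit _ El).
rw (kelly_l P one one); rw (kelly_rV one one).
symmetry; rw (hb_at_unit one En); rw (hb_at_unit one En).
rw (ich_one A (br I A)).

rw (triangleV one one).
have E : (n ⋊₂ A) ∙ ((A ⋉₂ n) ▷ (br I A ⋊ A)) ∙ (hexR I A A)^-1 = l.
  rwr (nu_tens En En El); rw (iso_fwdK (hexR I A A)); pasting.
rw E; pasting.
Qed.

Section Maps.
Variables (U : Ob M) (u : hom U A) (g : half_braiding U u).

Definition hb_unit_l : half_braiding (I ⊗ U) (hom_cast (esym (tensO1l U)) u).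
Proof. by apply: (iso_cast _ _ g); [bnd | congr (_ ∘ _); apply: br_eq; bd]. Defined.
Definition hb_unit_r : half_braiding (U ⊗ I) (hom_cast (esym (tensO1r U)) u).
Proof. by apply: (iso_cast _ _ g); [bnd | congr (_ ∘ _); apply: br_eq; bd]. Defined.

Lemma piece_map_lam : piece_map (hb_tens hb_unit g) hb_unit_l (lam u).
Proof.
have E : hb_at hb_unit_l one = hb_at g one :> Cell M by rewrite !hb_at_id.
rewrite /piece_map E !hb_at_tens !hb_tens_atE.
rewrite -[cell_val (hexS I U A)^-1]/(cell_val (hexS_unit_l U A)^-1) (br_eq A (tensO1l U)).
rwr (kelly_l P u one); rwr (lam_nat P (x' := hom_comp (one * u) (br U A)) (hb_at g one)).
rw (lam_comp (one * u) (br U A)); rwr (kelly_l' one u).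
symmetry; rw (hb_at_unit one En).
have E2 : ((n ⋊₂ U) ▷ br U A) ∙ (hexS_unit_l U A)^-1 = id2 (br U A).
  by rwr (nu_hexS_l U En); rw (iso_fwdK (hexS_unit_l U A)); pasting.
have Ei : ((n ⋊₂ A) ▷ (A ⋉ u)) ∙ ich (br I A) u = ich one u ∙ ((A ⋉ u) ◁ (n ⋊₂ U)).
  exact: (ich_nat_l (f := one)
    (f' := hom_castr (tensO1r A) (hom_cast (tensO1l A) (br I A))) n u).
rw Ei; rw (ich_id_l A u).
rw E2. rw (triangleV one u); pasting.
Qed.
Lemma piece_map_rho : piece_map (hb_tens g hb_unit) hb_unit_r (rho u).
Proof.
have E : hb_at hb_unit_r one = hb_at g one :> Cell M by rewrite !hb_at_id.
rewrite /piece_map E !hb_at_tens !hb_tens_atE.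
rewrite -[cell_val (hexS U I A)^-1]/(cell_val (hexS_unit_r U A)^-1) (br_eq A (tensO1r U)).
symmetry; rw (hb_at_unit one En).
rw (triangle P u one). rw (kelly_rV' u one). 
have E2 : (br U A ◁ (U ⋉₂ n)) ∙ (hexS_unit_r U A)^-1 = id2 (br U A).
  by rwr (nu_hexS_r U En); rw (iso_fwdK (hexS_unit_r U A)); pasting.
rw E2.
rw (rhoV_nat (x' := hom_comp (one * u) (br U A)) (hb_at g one)).
rw (rhoV_res (one * u) (br U A)); rw (kelly_rV one u); rw (iso_bwdK (rho u)); pasting.
Qed.
End Maps.
End UnitPiece.

(** * The universal property *)

Section Equivalence.
Variables (C D : category) (F : functor C D) (H : functor D C).

Lemma retract_faithful (k : natural_iso (functor_comp H F) (functor_id C)) (x y : C)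
  (s t : cat_hom x y) : fun_hom F s = fun_hom F t -> s = t.
Proof.
move=> E; rewrite -(cat_id_l s) -(cat_id_l t).
have <- := ni_bwdK k x; rewrite -!cat_compA.
by rewrite -(ni_nat k s) -(ni_nat k t) /= E.
Qed.
End Equivalence.

Lemma equivalence_faithful (C D : category) (F : functor C D) (x y : C) (s t : cat_hom x y) :
  equivalence_of_categories F -> fun_hom F s = fun_hom F t -> s = t.
Proof. move=> [H [[k] _]]; exact: retract_faithful k _ _ s t. Qed.

Lemma equivalence_full (C D : category) (F : functor C D) (x y : C)
    (s : cat_hom (F x) (F y)) :
  equivalence_of_categories F -> exists t, fun_hom F t = s.
Proof.
move=> [H [[k] [l]]].
exists (cat_comp (ni_bwd k x) (cat_comp (fun_hom H s) (ni_fwd k y))).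
apply: (retract_faithful l).
set t := cat_comp _ _.
have E : cat_comp (fun_hom (functor_comp H F) t) (ni_fwd k y)
    = cat_comp (fun_hom H s) (ni_fwd k y).
  by rewrite (ni_nat k t) /= {}/t (cat_compA (ni_fwd k x)) ni_fwdK cat_id_l.
have {}E := congr1 (fun z => cat_comp z (ni_bwd k y)) E.
by rewrite -!cat_compA !ni_fwdK !cat_id_r in E.
Qed.

Lemma equivalence_ess (C D : category) (F : functor C D) (w : D) :
  equivalence_of_categories F -> exists (x : C) (s : cat_hom (F x) w) (t : cat_hom w (F x)),
    cat_comp s t = cat_id (F x) /\ cat_comp t s = cat_id w.
Proof.
move=> [H [_ [l]]]; exists (H w), (ni_fwd l w), (ni_bwd l w).
by split; [exact: (ni_fwdK l w) | exact: (ni_bwdK l w)].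
Qed.

Section Centre.
Variables (M : braided_gray_monoid) (A : Ob M) (P : pseudomonoid A).
Notation m := (pm_mul P).
Notation half_braiding U u := (iso2 (m ∘ (u ⋊ A)) (m ∘ (A ⋉ u) ∘ br U A)).
Notation one := (hom_id A).

Lemma piece_mapE (U : Ob M) (u v : hom U A) (g : half_braiding U u) (h : half_braiding U v)
    (s : cell u v) :
  piece_map g h s <-> (m ◁ (s ⋊₂ A)) ∙ h = g ∙ ((m ◁ (A ⋉₂ s)) ▷ br U A).
Proof.
rewrite /piece_map (hb_at_id g) (hb_at_id h).
have -> : stl P U s one ∙ h = (m ◁ (s ⋊₂ A)) ∙ h by pasting.
have -> : g ∙ (str P A one s ▷ br U A) = g ∙ ((m ◁ (A ⋉₂ s)) ▷ br U A) by pasting.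
by [].
Qed.

Lemma piece_map_val (U U' : Ob M) (u v : hom U A) (u' v' : hom U' A) (g : half_braiding U u)
    (h : half_braiding U v) (g' : half_braiding U' u') (h' : half_braiding U' v')
    (s s' : Cell M) :
  U = U' -> g = g' :> Cell M -> h = h' :> Cell M -> s = s' -> piece_map g h s -> piece_map g' h' s'.
Proof.
by move=> E; subst U'; rewrite /piece_map !hb_at_id => -> -> ->.
Qed.

Lemma hb_restr_comp (U V W : Ob M) (u : hom U A) (g : half_braiding U u) (f : hom V U) (h : hom W V) :
  hb_restr (hb_restr g f) h = hb_restr g (hom_comp f h) :> Cell M.
Proof. rewrite !hb_restr_val; symmetry; rw (bl_comp A f h); pasting. Qed.
Lemma hb_restr_id (U : Ob M) (u : hom U A) (g : half_braiding U u) : hb_restr g (hom_id U) = g :> Cell M.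
Proof. rewrite !hb_restr_val; rw (bl_id U A); pasting. Qed.

Variables (Z : Ob M) (i : centre_piece P Z) (hi : is_centre i).

Lemma centre_ess U (w : centre_piece P U) : exists (f : hom U Z) (F : iso2 (hom_comp i f) w),
  piece_map (hb_restr (cp_iso i) f) (cp_iso w) F.
Proof.
have [f [s [t [Es Et]]]] := @equivalence_ess _ (cp_category P U) _ w (hi U).
have {}Es := congr1 (fun z => cell_val (cpm_cell z)) Es.
have {}Et := congr1 (fun z => cell_val (cpm_cell z)) Et.
pose F : iso2 (hom_comp i f) w := @Iso2 M _ _ (cpm_cell s) (cpm_cell t) Es Et.
exists f, F; apply/piece_mapE; exact: (cpm_axiom s).
Qed.

Lemma centre_faithful U (f g : hom U Z) (s t : cell f g) : i ◁ s = i ◁ t -> s = t :> Cell M.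
Proof.
move=> E; congr cell_val; apply: (@equivalence_faithful _ _ (cp_functor i U) f g s t (hi U)).
exact: cpm_inj.
Qed.

Lemma centre_faithful_cells (f g : Mor M) (s t : Cell M) : cod f = Z ->
  src s = f -> tgt s = g -> src t = f -> tgt t = g -> i ◁ s = i ◁ t -> s = t.
Proof.
move=> ef s1 s2 t1 t2.
have dg : dom g = dom f by rewrite -s1 -s2 dom_tgt.
have cg : cod g = Z by rewrite -s2 cod_tgt s1.
exact: (@centre_faithful _ (Hom erefl ef) (Hom dg cg) (MkCell s1 s2) (MkCell t1 t2)).
Qed.

Lemma centre_full U (f g : hom U Z) (s : cell (hom_comp i f) (hom_comp i g)) :
  piece_map (hb_restr (cp_iso i) f) (hb_restr (cp_iso i) g) s -> exists t : cell f g, i ◁ t = s.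
Proof.
move=> /piece_mapE E.
pose s' : centre_piece_map (cp_restrict i f) (cp_restrict i g) :=
  @CentrePieceMap _ _ _ _ (cp_restrict i f) (cp_restrict i g) s E.
have [t Et] := @equivalence_full _ _ (cp_functor i U) f g s' (hi U).
by exists t; rewrite -[RHS]/(cell_val (cpm_cell s')) -Et.
Qed.

Lemma centre_lift U (f g : hom U Z) (s : iso2 (hom_comp i f) (hom_comp i g)) :
  piece_map (hb_restr (cp_iso i) f) (hb_restr (cp_iso i) g) s -> exists t : iso2 f g, i ◁ t = s.
Proof.
move=> E.
have [t Et] := centre_full E.
have [t' Et'] := centre_full (piece_map_inv E).
have e1 : t ∙ t' = id2 f.
  apply: (centre_faithful (s := cell_vcomp t t') (t := cell_id f)).
  transitivity ((i ◁ t) ∙ (i ◁ t')); first by pasting.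
  by rewrite Et Et' iso_fwdK; pasting.
have e2 : t' ∙ t = id2 g.
  apply: (centre_faithful (s := cell_vcomp t' t) (t := cell_id g)).
  transitivity ((i ◁ t') ∙ (i ◁ t)); first by pasting.
  by rewrite Et Et' iso_bwdK; pasting.
by exists (Iso2 e1 e2).
Qed.
End Centre.

Section Lifts.
Variables (M : braided_gray_monoid) (A : Ob M) (P : pseudomonoid A).
Variables (Z : Ob M) (i : centre_piece P Z).
Notation m := (pm_mul P).
Notation j := (pm_unit P).
Notation I := (@unitO M).
Notation "x * y" := (star P x y).
Notation stl := (stl P).
Notation str := (str P).
Notation al := (al P).
Notation res := (res P).
Notation lam := (lam P).
Notation rho := (rho P).
Notation iso_str := (iso_str P).
Notation iso_stl := (iso_stl P).
Notation half_braiding U u := (iso2 (m ∘ (u ⋊ A)) (m ∘ (A ⋉ u) ∘ br U A)).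
Notation one := (hom_id A).
Notation g := (cp_iso i).

Variables (mu : hom (Z ⊗ Z) Z) (F : iso2 (hom_comp i mu) (i * i)).
Hypothesis cpF : piece_map (hb_restr g mu) (hb_tens g g) F.

Notation mu_l := (hom_comp mu (hom_rt mu Z)).
Notation mu_r := (hom_cast (tensOA Z Z Z) (hom_comp mu (hom_lt Z mu))).

Lemma piece_map_iso_vcomp (U : Ob M) (u1 u2 u3 : hom U A) (g1 : half_braiding U u1) (g2 : half_braiding U u2)
    (g3 : half_braiding U u3) (s : iso2 u1 u2) (t : iso2 u2 u3) :
  piece_map g1 g2 s -> piece_map g2 g3 t -> piece_map g1 g3 (iso_vcomp s t).
Proof. exact: piece_map_vcomp. Qed.

Lemma piece_map_str_restr (U V W : Ob M) (u : hom U A) (h : half_braiding U u) (w : hom V A)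
    (k : half_braiding V w) (x : hom W A) (l : half_braiding W x) (f : hom V W)
    (t : cell w (hom_comp x f)) : piece_map k (hb_restr l f) t ->
  piece_map (hb_tens h k) (hb_restr (hb_tens h l) (hom_lt U f)) (str U u t).
Proof.
move=> /(piece_map_str h); rewrite /piece_map => H.
have E : hb_at (hb_restr (hb_tens h l) (hom_lt U f)) one = hb_at (hb_tens h (hb_restr l f)) one :> Cell M.
  transitivity (hb_at (hb_tens h (hb_restr l f)) one
    ∙ (str A one (id2 (u * hom_comp x f)) ▷ br (U ⊗ V) A)).
    rewrite -(piece_map_res_r h l f); pasting.
  pasting.
by rw E; rw H; pasting.
Qed.

Lemma iso_assoc : exists s : iso2 (hom_comp i mu_l) (hom_comp i mu_r),
  piece_map (hb_restr g mu_l) (hb_restr g mu_r) s /\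
  s = (F ▷ (mu ⋊ Z)) ∙ (res i mu i)^-1 ∙ stl (Z ⊗ Z) F i ∙ al i i i ∙ str Z i F^-1
      ∙ (F^-1 ▷ (Z ⋉ mu)) :> Cell M.
Proof.
have e1 : dom (hom_comp i mu) = cod (hom_rt mu Z) by bd.
have e2 : dom (i * i) = cod (hom_lt Z mu) by bd.
have e3 : i * hom_comp i mu = (i * i) ∘ hom_lt Z mu :> Mor M by bnd.
have e4 : (hom_comp i mu) ∘ (hom_rt mu Z) = hom_comp i mu_l by bnd.
have e5 : (hom_comp i mu) ∘ (hom_lt Z mu) = hom_comp i mu_r by bnd.
pose s1 : iso2 (hom_comp (hom_comp i mu) (hom_rt mu Z)) (hom_comp (i * i) (hom_rt mu Z)) :=
  iso_rwhisk F e1.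
pose s2 : iso2 (hom_comp (i * i) (hom_rt mu Z)) (hom_comp i mu * i) := (res i mu i)^-1.
pose s3 := iso_stl F i.
pose s4 : iso2 (i * i * i) (hom_cast (tensOA Z Z Z) (i * (i * i))) := al i i i.
pose s6 : iso2 (i * (i * i)) (hom_comp (i * i) (hom_lt Z mu)) := iso_cast erefl e3 (iso_str i F^-1).
pose s7 : iso2 (hom_comp (i * i) (hom_lt Z mu)) (hom_comp (hom_comp i mu) (hom_lt Z mu)) :=
  iso_rwhisk F^-1 e2.
have H1 : piece_map (hb_restr (hb_restr g mu) (hom_rt mu Z)) (hb_restr (hb_tens g g) (hom_rt mu Z)) s1.
  exact: piece_map_restr.
have H2 : piece_map (hb_restr (hb_tens g g) (hom_rt mu Z)) (hb_tens (hb_restr g mu) g) s2.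
  exact/piece_map_inv/piece_map_res.
have H3 : piece_map (hb_tens (hb_restr g mu) g) (hb_tens (hb_tens g g) g) s3.
  exact: piece_map_stl.
have H4 : piece_map (hb_tens (hb_tens g g) g) (hb_assoc g g g) s4 by exact: piece_map_al.
have H6 : piece_map (hb_tens g (hb_tens g g)) (hb_restr (hb_tens g g) (hom_lt Z mu)) s6.
  exact/piece_map_str_restr/piece_map_inv.
have H7 : piece_map (hb_restr (hb_tens g g) (hom_lt Z mu)) (hb_restr (hb_restr g mu) (hom_lt Z mu)) s7.
  exact/piece_map_restr/piece_map_inv.
have E1 := piece_map_iso_vcomp H1 (piece_map_iso_vcomp H2 (piece_map_iso_vcomp H3 H4)).
have E2 := piece_map_iso_vcomp H6 H7.
pose t2 : iso2 (hom_cast (tensOA Z Z Z) (i * (i * i))) (hom_comp i mu_r) :=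
  iso_cast erefl e5 (iso_vcomp s6 s7).
pose t1 : iso2 (hom_comp i mu_l) (hom_cast (tensOA Z Z Z) (i * (i * i))) :=
  iso_cast e4 erefl (iso_vcomp s1 (iso_vcomp s2 (iso_vcomp s3 s4))).
have K1 : piece_map (hb_restr g mu_l) (hb_assoc g g g) t1.
  by apply: (piece_map_val _ _ _ _ E1) => //; exact: hb_restr_comp.
have K2 : piece_map (hb_assoc g g g) (hb_restr g mu_r) t2.
  by apply: (piece_map_val (tensOA Z Z Z) _ _ _ E2) => //; exact: hb_restr_comp.
exists (iso_vcomp t1 t2); split; first exact: piece_map_iso_vcomp K1 K2.
rewrite /t1 /t2 /s1 /s2 /s3 /s4 /s6 /s7; pasting.
Qed.

Lemma iso_braid : exists s : iso2 (hom_comp i mu) (hom_comp i (hom_comp mu (br Z Z))),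
  piece_map (hb_restr g mu) (hb_restr g (hom_comp mu (br Z Z))) s /\
  s = F ∙ hb_at g i ∙ (F^-1 ▷ br Z Z) :> Cell M.
Proof.
have e1 : dom (i * i) = cod (br Z Z) by bd.
have e2 : (hom_comp i mu) ∘ br Z Z = hom_comp i (hom_comp mu (br Z Z)) by bnd.
pose s2 : iso2 (i * i) (hom_comp (i * i) (br Z Z)) := hb_at g i.
pose s3 : iso2 (hom_comp (i * i) (br Z Z)) (hom_comp (hom_comp i mu) (br Z Z)) :=
  iso_rwhisk F^-1 e1.
have H2 : piece_map (hb_tens g g) (hb_restr (hb_tens g g) (br Z Z)) s2 by exact: piece_map_braid.
have H3 : piece_map (hb_restr (hb_tens g g) (br Z Z)) (hb_restr (hb_restr g mu) (br Z Z)) s3.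
  exact/piece_map_restr/piece_map_inv.
have H := piece_map_iso_vcomp cpF (piece_map_iso_vcomp H2 H3).
exists (iso_cast erefl e2 (iso_vcomp F (iso_vcomp s2 s3))); split.
  by apply: (piece_map_val _ _ _ _ H) => //; exact: hb_restr_comp.
rewrite /s2 /s3; pasting.
Qed.

Variables (n : iso2 (id1 A) (br I A)) (En : is_nu A n).
Variables (eta : hom I Z) (G : iso2 (hom_comp i eta) j).
Hypothesis cpG : piece_map (hb_restr g eta) (hb_unit P n) G.
Notation id_l := (hom_cast (esym (tensO1l Z)) (hom_id Z)).
Notation id_r := (hom_cast (esym (tensO1r Z)) (hom_id Z)).

Lemma iso_lunit : exists s : iso2 (hom_comp i (hom_comp mu (hom_rt eta Z))) (hom_comp i id_l),
  piece_map (hb_restr g (hom_comp mu (hom_rt eta Z))) (hb_restr g id_l) s /\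
  s = (F ▷ (eta ⋊ Z)) ∙ (res i eta i)^-1 ∙ stl I G i ∙ lam i :> Cell M.
Proof.
have e1 : dom (hom_comp i mu) = cod (hom_rt eta Z) by bd.
have e2 : (hom_comp i mu) ∘ (hom_rt eta Z) = hom_comp i (hom_comp mu (hom_rt eta Z)) by bnd.
have e3 : hom_cast (esym (tensO1l Z)) i = hom_comp i id_l :> Mor M by bnd.
pose s1 : iso2 (hom_comp (hom_comp i mu) (hom_rt eta Z)) (hom_comp (i * i) (hom_rt eta Z)) :=
  iso_rwhisk F e1.
pose s2 : iso2 (hom_comp (i * i) (hom_rt eta Z)) (hom_comp i eta * i) := (res i eta i)^-1.
pose s3 := iso_stl G i.
pose s4 : iso2 (j * i) (hom_cast (esym (tensO1l Z)) i) := lam i.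
have H1 : piece_map (hb_restr (hb_restr g mu) (hom_rt eta Z)) (hb_restr (hb_tens g g) (hom_rt eta Z)) s1.
  exact: piece_map_restr.
have H2 : piece_map (hb_restr (hb_tens g g) (hom_rt eta Z)) (hb_tens (hb_restr g eta) g) s2.
  exact/piece_map_inv/piece_map_res.
have H3 : piece_map (hb_tens (hb_restr g eta) g) (hb_tens (hb_unit P n) g) s3.
  exact: piece_map_stl.
have H4 : piece_map (hb_tens (hb_unit P n) g) (hb_unit_l g) s4 by exact: piece_map_lam.
have H := piece_map_iso_vcomp H1 (piece_map_iso_vcomp H2 (piece_map_iso_vcomp H3 H4)).
exists (iso_cast e2 e3 (iso_vcomp s1 (iso_vcomp s2 (iso_vcomp s3 s4)))); split.
  apply: (piece_map_val _ _ _ _ H) => //; first exact: hb_restr_comp.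
  exact: esym (hb_restr_id g).
rewrite /s1 /s2 /s3 /s4; pasting.
Qed.

Lemma iso_runit : exists s : iso2 (hom_comp i (hom_comp mu (hom_lt Z eta))) (hom_comp i id_r),
  piece_map (hb_restr g (hom_comp mu (hom_lt Z eta))) (hb_restr g id_r) s /\
  s = (F ▷ (Z ⋉ eta)) ∙ str Z i G ∙ rho i :> Cell M.
Proof.
have e1 : dom (hom_comp i mu) = cod (hom_lt Z eta) by bd.
have e2 : (hom_comp i mu) ∘ (hom_lt Z eta) = hom_comp i (hom_comp mu (hom_lt Z eta)) by bnd.
have e3 : hom_cast (esym (tensO1r Z)) i = hom_comp i id_r :> Mor M by bnd.
have e4 : i * hom_comp i eta = (i * i) ∘ hom_lt Z eta :> Mor M by bnd.
pose s1 : iso2 (hom_comp (hom_comp i mu) (hom_lt Z eta)) (hom_comp (i * i) (hom_lt Z eta)) :=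
  iso_rwhisk F e1.
pose s2 : iso2 (i * j) (hom_comp (i * i) (hom_lt Z eta)) := iso_cast erefl e4 (iso_str i G^-1).
pose s4 : iso2 (i * j) (hom_cast (esym (tensO1r Z)) i) := rho i.
have H1 : piece_map (hb_restr (hb_restr g mu) (hom_lt Z eta)) (hb_restr (hb_tens g g) (hom_lt Z eta)) s1.
  exact: piece_map_restr.
have H2 : piece_map (hb_restr (hb_tens g g) (hom_lt Z eta)) (hb_tens g (hb_unit P n)) s2^-1.
  exact/piece_map_inv/piece_map_str_restr/piece_map_inv.
have H4 : piece_map (hb_tens g (hb_unit P n)) (hb_unit_r g) s4 by exact: piece_map_rho.
have H := piece_map_iso_vcomp H1 (piece_map_iso_vcomp H2 H4).
exists (iso_cast e2 e3 (iso_vcomp s1 (iso_vcomp s2^-1 s4))); split.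
  apply: (piece_map_val _ _ _ _ H) => //; first exact: hb_restr_comp.
  exact: esym (hb_restr_id g).
rewrite /s1 /s2 /s4; pasting.
Qed.
End Lifts.

(** * Coherence of the lifted 2-cells *)

Section Coherence.
Variables (M : braided_gray_monoid) (A : Ob M) (P : pseudomonoid A).
Variables (Z : Ob M) (i : hom Z A).
Notation j := (pm_unit P).
Notation I := (@unitO M).
Notation "x * y" := (star P x y).
Notation stl := (stl P).
Notation str := (str P).
Notation al := (al P).
Notation res := (res P).
Notation lam := (lam P).
Notation rho := (rho P).

Variables (mu : hom (Z ⊗ Z) Z) (F : iso2 (hom_comp i mu) (i * i)).
Variables (a : iso2 (mu ∘ (mu ⋊ Z)) (mu ∘ (Z ⋉ mu))).
Hypothesis Ea : i ◁ a = (F ▷ (mu ⋊ Z)) ∙ (res i mu i)^-1 ∙ stl (Z ⊗ Z) F i ∙ al i i i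
  ∙ str Z i F^-1 ∙ (F^-1 ▷ (Z ⋉ mu)).

Lemma mul_stl (W : Ob M) (f f' : hom W Z) (b : cell f f') :
  (i ∘ mu) ◁ (b ⋊₂ Z) = (F ▷ (f ⋊ Z)) ∙ (res i f i)^-1 ∙ stl W (i ◁ b) i ∙ res i f' i
    ∙ (F^-1 ▷ (f' ⋊ Z)).
Proof.
symmetry; rw (resN3 P b i i); rw (iso_bwdK (res i f i)); rw (iso_fwdK F); pasting.
Qed.

Lemma alV_res2' (V X Y W : Ob M) (x : hom X A) (y : hom Y A) (f : hom W Y) (z : hom V A) :
  (al x y z ▷ (X ⋉ (f ⋊ V))) ∙ str X x (res y f z)^-1
  = (res (x * y) (hom_lt X f) z)^-1 ∙ al x (hom_comp y f) z.
Proof.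
cancel_l (res (x * y) (hom_lt X f) z).
rwr (al_res2 P x y f z); rw (iso_fwdK (res y f z)).
by symmetry; rw (iso_fwdK (res (x * y) (hom_lt X f) z)); pasting.
Qed.

Lemma resV_comp_l (V W X Y : Ob M) (f : hom W X) (h : hom V W) (x : hom X A) (y : hom Y A) :
  (res x (hom_comp f h) y)^-1
  = ((res x f y)^-1 ▷ (h ⋊ Y)) ∙ (res (hom_comp x f) h y)^-1 :> Cell M.
Proof.
cancel_l (res x (hom_comp f h) y); rw (iso_fwdK (res x (hom_comp f h) y)).
by symmetry; rw (res_comp_l P f h x y); rw (iso_fwdK (res x f y));
  rw (iso_fwdK (res (hom_comp x f) h y)); pasting.
Qed.

Lemma pentagon_lift :
  i ◁ ((a ▷ (mu ⋊ (Z ⊗ Z))) ∙ (mu ◁ (ich mu mu)^-1) ∙ (a ▷ ((Z ⊗ Z) ⋉ mu)))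
  = i ◁ ((mu ◁ (a ⋊₂ Z)) ∙ (a ▷ (Z ⋉ (mu ⋊ Z))) ∙ (mu ◁ (Z ⋉₂ a))).
Proof.
have Fv := iso_bwdK F.
have E1 : (i ∘ mu) ◁ (a ⋊₂ Z) = (F ▷ ((mu ∘ (mu ⋊ Z)) ⋊ Z))
    ∙ (res i (hom_comp mu (hom_rt mu Z)) i)^-1 ∙ stl (Z ⊗ Z ⊗ Z) (i ◁ a) i
    ∙ res i (hom_comp mu (hom_lt Z mu)) i ∙ (F^-1 ▷ ((mu ∘ (Z ⋉ mu)) ⋊ Z)).
  exact: (mul_stl (f := hom_comp mu (hom_rt mu Z))
    (f' := hom_cast (tensOA Z Z Z) (hom_comp mu (hom_lt Z mu))) a).
symmetry; rw E1.
rw Ea; rw Ea; rw Fv; rw Ea; rw Fv.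
rw (alV_res2' i i mu i).
rwr (resV_N1 P (hom_lt Z mu) (x' := i * i) i F).
have Er : (res i (hom_comp mu (hom_lt Z mu)) i)
    ∙ ((res i mu i)^-1 ▷ (Z ⋉ (mu ⋊ Z))) ∙ (res (hom_comp i mu) (hom_lt Z mu) i)^-1
    = id2 (hom_comp i (hom_comp mu (hom_lt Z mu)) * i).
  rw (res_comp_l P mu (hom_lt Z mu) i i); rw (iso_fwdK (ich mu i)).
  rw (iso_fwdK (ich (hom_lt Z mu) i)); pasting.
rw Er; rw Fv; rwr (alN2 P i (y' := i * i) F i); rw Fv.
rwr (al_pentagon P i i i i).
rw (resV_comp_l mu (hom_rt mu Z) i i).
symmetry; rw Ea; rw Ea; rw Fv; rwr (ichV_comp_r mu i mu).
rwr (ichV_nat_r mu (g := i * i) (g' := hom_comp i mu) F^-1).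
rwr (alV_res1 P i mu i i).
rwr (resV_N1 P (hom_rt mu Z) (x' := i * i) i F).
rwr (alN1 P (x' := i * i) F i i).
rw (alN3_r P i i (z := i) (g := mu) F^-1).
pasting.
Qed.

Lemma assoc_lift :
  stl (Z ⊗ Z) F^-1 i ∙ res i mu i ∙ (F^-1 ▷ (mu ⋊ Z)) ∙ (i ◁ a)
  = al i i i ∙ str Z i F^-1 ∙ (F^-1 ▷ (Z ⋉ mu)).
Proof.
rw Ea; rw (iso_bwdK F); rw (iso_fwdK (ich mu i)); rw (iso_bwdK F); pasting.
Qed.

Section Units.
Variables (eta : hom I Z) (G : iso2 (hom_comp i eta) j).
Variables (l : iso2 (mu ∘ (eta ⋊ Z)) (id1 Z)) (r : iso2 (mu ∘ (Z ⋉ eta)) (id1 Z)).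
Hypothesis El : i ◁ l = (F ▷ (eta ⋊ Z)) ∙ (res i eta i)^-1 ∙ stl I G i ∙ lam i.
Hypothesis Er : i ◁ r = (F ▷ (Z ⋉ eta)) ∙ str Z i G ∙ rho i.

Lemma triangle_lift :
  i ◁ ((a ▷ (Z ⋉ (eta ⋊ Z))) ∙ (mu ◁ (Z ⋉₂ l))) = i ◁ (mu ◁ (r ⋊₂ Z)).
Proof.
have Fv := iso_bwdK F.
have E1 : (i ∘ mu) ◁ (r ⋊₂ Z) = (F ▷ ((mu ∘ (Z ⋉ eta)) ⋊ Z))
    ∙ (res i (hom_comp mu (hom_lt Z eta)) i)^-1 ∙ stl (Z ⊗ I) (i ◁ r) i
    ∙ res i (hom_id Z) i ∙ (F^-1 ▷ ((id1 Z) ⋊ Z)).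
  exact: (mul_stl (f := hom_comp mu (hom_lt Z eta))
    (f' := hom_cast (esym (tensO1r Z)) (hom_id Z)) r).
symmetry; rw E1; rw Er; rw (ich_id_l Z i).
rw (resV_comp_l mu (hom_lt Z eta) i i).
symmetry; rw Ea; rw El; rw Fv.
rw (alV_res2' i i eta i).
rwr (alN2 P i (y' := j) G i).
rw (triangle P i i).
rwr (resV_N1 P (hom_lt Z eta) (x' := i * i) i F).
pasting.
Qed.

Lemma lunit_lift :
  stl I G^-1 i ∙ res i eta i ∙ (F^-1 ▷ (eta ⋊ Z)) ∙ (i ◁ l) = lam i.
Proof.
rw El; rw (iso_bwdK F); rw (iso_fwdK (ich eta i)); rw (iso_bwdK G); pasting.
Qed.
Lemma runit_lift :
  str Z i G^-1 ∙ (F^-1 ▷ (Z ⋉ eta)) ∙ (i ◁ r) = rho i.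
Proof.
rw Er; rw (iso_bwdK F); rw (iso_bwdK G); pasting.
Qed.
End Units.
End Coherence.

Section Braiding.
Variables (M : braided_gray_monoid) (A : Ob M) (P : pseudomonoid A).
Variables (Z : Ob M) (i : centre_piece P Z).
Notation m := (pm_mul P).
Notation "x * y" := (star P x y).
Notation stl := (stl P).
Notation str := (str P).
Notation al := (al P).
Notation res := (res P).
Notation half_braiding U u := (iso2 (m ∘ (u ⋊ A)) (m ∘ (A ⋉ u) ∘ br U A)).
Notation one := (hom_id A).
Notation g := (cp_iso i).

Lemma piece_map_at (U X : Ob M) (u v : hom U A) (h : half_braiding U u) (k : half_braiding U v)
    (s : cell u v) (x : hom X A) : piece_map h k s ->
  stl U s x ∙ hb_at k x = hb_at h x ∙ (str X x s ▷ br U X).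
Proof.
have <- : hom_comp one x = x by apply: hom_inj; bnd.
rewrite /piece_map !hb_at_comp => H.
have E : (res one x u)^-1 ∙ str X (one ∘ x) s = (str A one s ▷ (x ⋊ U)) ∙ (res one x v)^-1.
  by conj_sq (res one x u) (res one x v); exact: resN2.
rw H; symmetry; rw E; pasting.
Qed.

Lemma hb_at_restr (U V X : Ob M) (u : hom U A) (h : half_braiding U u) (f : hom V U) (x : hom X A) :
  hb_at (hb_restr h f) x = res u f x ∙ (hb_at h x ▷ (f ⋊ X)) ∙ ((x * u) ◁ bl f X) :> Cell M.
Proof.
rewrite !hb_atE. rw (hb_restr_val h f).
rw (ichV_comp_r x u f).
have E := bl_bR f x.
transitivity ((h ▷ ((f ⋊ A) ∘ (V ⋉ x)))
  ∙ ((m ∘ (A ⋉ u)) ◁ ((bl f A ▷ (V ⋉ x)) ∙ ((A ⋉ f) ◁ bR V x)))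
  ∙ (m ◁ ((A ⋉ u) ◁ (ich x f)^-1) ▷ br V X) ∙ (m ◁ ((ich x u)^-1 ▷ ((X ⋉ f) ∘ br V X)))).
  pasting.
rewrite E; rw (iso_fwdK (ich x f)); pasting.
Qed.

Variables (mu : hom (Z ⊗ Z) Z) (F : iso2 (hom_comp i mu) (i * i)).
Hypothesis cpF : piece_map (hb_restr g mu) (hb_tens g g) F.
Variables (a : iso2 (mu ∘ (mu ⋊ Z)) (mu ∘ (Z ⋉ mu))).
Hypothesis Ea : i ◁ a = (F ▷ (mu ⋊ Z)) ∙ (res i mu i)^-1 ∙ stl (Z ⊗ Z) F i ∙ al i i i
  ∙ str Z i F^-1 ∙ (F^-1 ▷ (Z ⋉ mu)).
Variable b : iso2 mu (mu ∘ br Z Z).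
Hypothesis Eb : i ◁ b = F ∙ hb_at g i ∙ (F^-1 ▷ br Z Z).

Lemma hexagon1_lift :
  i ◁ (a ∙ (b ▷ (Z ⋉ mu)) ∙ (mu ◁ bR Z mu) ∙ (a ▷ br Z (Z ⊗ Z)))
  = i ◁ ((mu ◁ (b ⋊₂ Z)) ∙ (a ▷ (br Z Z ⋊ Z)) ∙ (mu ◁ ((Z ⋉₂ b) ▷ (br Z Z ⋊ Z)))
      ∙ ((mu ∘ (Z ⋉ mu)) ◁ (hexR Z Z Z)^-1)).
Proof.
have Fv := iso_bwdK F.
rw Ea; rw Eb; rw Ea; rw Fv; rw Fv.
have Eg := hb_at_comp g i mu.
rwr Eg.
rw (hb_atN g (x := i * i) (x' := hom_comp i mu) F^-1).
rw Fv.
rw (hb_at_hexagon i i i).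
symmetry.
have E1 : (i ∘ mu) ◁ (b ⋊₂ Z) = (F ▷ (mu ⋊ Z)) ∙ (res i mu i)^-1 ∙ stl (Z ⊗ Z) (i ◁ b) i
  ∙ res i (hom_comp mu (br Z Z)) i ∙ (F^-1 ▷ ((mu ∘ br Z Z) ⋊ Z)).
  exact: (mul_stl F (f := mu) (f' := hom_comp mu (br Z Z)) b).
rw E1; rw Eb; rw Ea; rw Fv; rw Eb; rw Fv.
rw (res_comp_l P mu (br Z Z) i i); rw (iso_fwdK (ich mu i)).
rw (resN1 P (br Z Z) (x := i * i) (x' := hom_comp i mu) i F^-1); rw Fv; pasting.
Qed.

Lemma hexagon2_lift :
  i ◁ (a^-1 ∙ (b ▷ (mu ⋊ Z)) ∙ (mu ◁ bl mu Z) ∙ (a^-1 ▷ br (Z ⊗ Z) Z))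
  = i ◁ ((mu ◁ (Z ⋉₂ b)) ∙ (a^-1 ▷ (Z ⋉ br Z Z)) ∙ (mu ◁ ((b ⋊₂ Z) ▷ (Z ⋉ br Z Z)))
      ∙ ((mu ∘ (mu ⋊ Z)) ◁ (hexS Z Z Z)^-1)).
Proof.
have Fv := iso_bwdK F.
have Ea' : i ◁ a^-1 = (F ▷ (Z ⋉ mu)) ∙ str Z i F ∙ (al i i i)^-1 ∙ stl (Z ⊗ Z) F^-1 i
    ∙ res i mu i ∙ (F^-1 ▷ (mu ⋊ Z)).
  have e1 : dom i = cod (mu ∘ (mu ⋊ Z)) by bd.
  cancel_l (iso_lwhisk a e1).
  transitivity (id2 (i ∘ (mu ∘ (mu ⋊ Z)))); first by rw (iso_fwdK a); pasting.
  symmetry; rw Ea; rw Fv; rw (iso_bwdK F); rw (iso_fwdK (al i i i)); rw (iso_fwdK F).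
  rw (iso_bwdK (ich mu i)); rw (iso_fwdK F); pasting.
rw Ea'; rw Eb; rw Ea'; rw Fv; rw Fv.
have Eg := hb_at_restr g mu i.
rwr Eg.
have Et : stl (Z ⊗ Z) F^-1 i ∙ hb_at (hb_restr g mu) i ∙ (str Z i F ▷ br (Z ⊗ Z) Z)
  = hb_at (hb_tens g g) i.
  by rwr (piece_map_at i cpF); rw (iso_bwdK F); pasting.
rw Et; rewrite hb_at_tens hb_tens_atE.
rw (iso_bwdK (al i i i)); rw (iso_fwdK (al i i i)); symmetry.
have E1 : (i ∘ mu) ◁ (b ⋊₂ Z) = (F ▷ (mu ⋊ Z)) ∙ (res i mu i)^-1 ∙ stl (Z ⊗ Z) (i ◁ b) i
    ∙ res i (hom_comp mu (br Z Z)) i ∙ (F^-1 ▷ ((mu ∘ br Z Z) ⋊ Z)).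
  exact: (mul_stl F (f := mu) (f' := hom_comp mu (br Z Z)) b).
have E2 : (i ∘ mu) ◁ (Z ⋉₂ b) = (F ▷ (Z ⋉ mu)) ∙ str Z i (i ◁ b)
    ∙ (F^-1 ▷ (Z ⋉ (mu ∘ br Z Z))).
  by symmetry; rw (iso_fwdK F); pasting.
rw E2; rw Eb; rw Ea'; rw Fv; rw Fv; rw E1; rw Eb; rw Fv.
rw (iso_fwdK (ich mu i)); rw Fv.
rw (res_comp_l P mu (br Z Z) i i).
rw (resN1 P (br Z Z) (x := i * i) (x' := hom_comp i mu) i F^-1).
pasting.
Qed.
End Braiding.

Section Assembly.
Variables (M : braided_gray_monoid) (A : Ob M) (P : pseudomonoid A).
Variables (Z : Ob M) (i : centre_piece P Z) (hi : is_centre i).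
Notation m := (pm_mul P).
Notation j := (pm_unit P).
Notation "x * y" := (star P x y).
Notation stl := (stl P).
Notation str := (str P).
Notation al := (al P).
Notation res := (res P).
Notation lam := (lam P).
Notation rho := (rho P).
Variables (mu : hom (Z ⊗ Z) Z) (F : iso2 (hom_comp i mu) (i * i)).
Hypothesis cpF : piece_map (hb_restr (cp_iso i) mu) (hb_tens (cp_iso i) (cp_iso i)) F.
Variables (eta : hom unitO Z) (G : iso2 (hom_comp i eta) j).
Variables (a : iso2 (mu ∘ (mu ⋊ Z)) (mu ∘ (Z ⋉ mu))).
Variables (l : iso2 (mu ∘ (eta ⋊ Z)) (id1 Z)) (r : iso2 (mu ∘ (Z ⋉ eta)) (id1 Z)).
Variable b : iso2 mu (mu ∘ br Z Z).
Hypothesis Ea : i ◁ a = (F ▷ (mu ⋊ Z)) ∙ (res i mu i)^-1 ∙ stl (Z ⊗ Z) F i ∙ al i i i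
  ∙ str Z i F^-1 ∙ (F^-1 ▷ (Z ⋉ mu)).
Hypothesis El : i ◁ l = (F ▷ (eta ⋊ Z)) ∙ (res i eta i)^-1 ∙ stl unitO G i ∙ lam i.
Hypothesis Er : i ◁ r = (F ▷ (Z ⋉ eta)) ∙ str Z i G ∙ rho i.
Hypothesis Eb : i ◁ b = F ∙ hb_at (cp_iso i) i ∙ (F^-1 ▷ br Z Z).

Lemma centre_pentagon :
  (a ▷ (mu ⋊ (Z ⊗ Z))) ∙ (mu ◁ (ich mu mu)^-1) ∙ (a ▷ ((Z ⊗ Z) ⋉ mu))
  = (mu ◁ (a ⋊₂ Z)) ∙ (a ▷ (Z ⋉ (mu ⋊ Z))) ∙ (mu ◁ (Z ⋉₂ a)).
Proof.
apply: (centre_faithful_cells hi (f := mu ∘ (mu ⋊ Z) ∘ (mu ⋊ (Z ⊗ Z)))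
  (g := mu ∘ (Z ⋉ mu) ∘ ((Z ⊗ Z) ⋉ mu))); [by bd | by bnd..|].
exact: pentagon_lift Ea.
Qed.
Lemma centre_triangle :
  (a ▷ (Z ⋉ (eta ⋊ Z))) ∙ (mu ◁ (Z ⋉₂ l)) = mu ◁ (r ⋊₂ Z).
Proof.
apply: (centre_faithful_cells hi (f := mu ∘ (mu ⋊ Z) ∘ (Z ⋉ (eta ⋊ Z)))
  (g := mu)); [by bd | by bnd..|].
exact (triangle_lift Ea El Er).
Qed.

Definition centre_pseudomonoid : pseudomonoid Z :=
  @Pseudomonoid _ _ mu eta a l r centre_pentagon centre_triangle.

Lemma centre_hexagon1 :
  a ∙ (b ▷ (Z ⋉ mu)) ∙ (mu ◁ bR Z mu) ∙ (a ▷ br Z (Z ⊗ Z))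
    = (mu ◁ (b ⋊₂ Z)) ∙ (a ▷ (br Z Z ⋊ Z)) ∙ (mu ◁ ((Z ⋉₂ b) ▷ (br Z Z ⋊ Z)))
      ∙ ((mu ∘ (Z ⋉ mu)) ◁ (hexR Z Z Z)^-1).
Proof.
apply: (centre_faithful_cells hi (f := mu ∘ (mu ⋊ Z))
  (g := mu ∘ (Z ⋉ mu) ∘ br Z (Z ⊗ Z))); [by bd | by bnd..|].
exact (hexagon1_lift Ea Eb).
Qed.
Lemma centre_hexagon2 :
  a^-1 ∙ (b ▷ (mu ⋊ Z)) ∙ (mu ◁ bl mu Z) ∙ (a^-1 ▷ br (Z ⊗ Z) Z)
    = (mu ◁ (Z ⋉₂ b)) ∙ (a^-1 ▷ (Z ⋉ br Z Z)) ∙ (mu ◁ ((b ⋊₂ Z) ▷ (Z ⋉ br Z Z)))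
      ∙ ((mu ∘ (mu ⋊ Z)) ◁ (hexS Z Z Z)^-1).
Proof.
apply: (centre_faithful_cells hi (f := mu ∘ (Z ⋉ mu))
  (g := mu ∘ (mu ⋊ Z) ∘ br (Z ⊗ Z) Z)); [by bd | by bnd..|].
exact (hexagon2_lift cpF Ea Eb).
Qed.

Lemma centre_braided : exists Q : pseudomonoid Z,
    inhabited (braiding Q)
    /\ exists F : monoidal_morphism Q P i, strong_monoidal F.
Proof.
exists centre_pseudomonoid; split.
  exact: (inhabits (@Braiding _ _ centre_pseudomonoid b centre_hexagon1 centre_hexagon2)).
have e1 : i * i = m ∘ (i ⊗₁ i) :> Mor M by rewrite /tens1 hom_dom hom_cod.
have h1 : (m ◁ ((F^-1 ⋊₂ A) ▷ ((Z ⊗ Z) ⋉ i)))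
      ∙ ((m ∘ (i ⋊ A)) ◁ ich mu i)
      ∙ (F^-1 ▷ (mu ⋊ Z)) ∙ (i ◁ a)
    = (pm_assoc P ▷ ((i ⋊ (A ⊗ A)) ∘ (Z ⋉ (i ⊗₁ i))))
      ∙ (m ◁ ((ich i m)^-1 ▷ (Z ⋉ (i ⊗₁ i))))
      ∙ ((m ∘ (i ⋊ A)) ◁ (Z ⋉₂ F^-1))
      ∙ (F^-1 ▷ (Z ⋉ mu)).
  rewrite /tens1 hom_dom hom_cod.
  transitivity (stl (Z ⊗ Z) F^-1 i ∙ res i mu i ∙ (F^-1 ▷ (mu ⋊ Z)) ∙ (i ◁ a)).
    by pasting.
  rewrite (assoc_lift Ea) alE; pasting.
have h2 : (m ◁ ((G^-1 ⋊₂ A) ▷ i))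
      ∙ ((m ∘ (i ⋊ A)) ◁ ich eta i)
      ∙ (F^-1 ▷ (eta ⋊ Z)) ∙ (i ◁ l) = pm_lunit P ▷ i.
  transitivity (stl unitO G^-1 i ∙ res i eta i ∙ (F^-1 ▷ (eta ⋊ Z)) ∙ (i ◁ l)); first by pasting.
  exact: lunit_lift El.
have h3 : (m ◁ (ich i j)^-1)
      ∙ ((m ∘ (i ⋊ A)) ◁ (Z ⋉₂ G^-1))
      ∙ (F^-1 ▷ (Z ⋉ eta)) ∙ (i ◁ r) = pm_runit P ▷ i.
  transitivity ((m ◁ (ich i j)^-1) ∙ (str Z i G^-1 ∙ (F^-1 ▷ (Z ⋉ eta)) ∙ (i ◁ r))).
    by pasting.
  rewrite (runit_lift Er) rhoE; rw (iso_bwdK (ich i j)); pasting.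
pose Fm : cell (m ∘ (i ⊗₁ i)) (i ∘ mu) := cell_cast e1 erefl (iso_bwd F).
exists (@MonoidalMorphism _ _ _ centre_pseudomonoid P i Fm (iso_bwd G) h1 h2 h3).
split; last by exists (iso_fwd G); split; [exact: iso_bwdK | exact: iso_fwdK].
exists (cell_cast erefl e1 F); split; last exact: iso_fwdK.
exact: etrans (iso_bwdK F) (congr1 id2 e1).
Qed.
End Assembly.

Theorem proposition2p1 (M : braided_gray_monoid) (A : Ob M) (P : pseudomonoid A)
    (ZA : Ob M) (i : centre_piece P ZA) (hi : is_centre i) :
  exists Q : pseudomonoid ZA,
    inhabited (braiding Q)
    /\ exists F : monoidal_morphism Q P i, strong_monoidal F.
Proof.
have [mu [F cpF]] := centre_ess hi (cp_tens i i).
have [n En] := nu_exists A.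
have [n2 En2] := nu_exists (A ⊗ A).
have [eta [G cpG]] := centre_ess hi (mk_piece (unit_hexagon P En En2)).
have [sa [cpa Ea]] := iso_assoc cpF.
have [sl [cpl El]] := iso_lunit cpF En cpG.
have [sr [cpr Er]] := iso_runit cpF En cpG.
have [sb [cpb Eb]] := iso_braid cpF.
have [a Ea'] := centre_lift hi cpa; rewrite {}Ea in Ea'.
have [l El'] := centre_lift hi cpl; rewrite {}El in El'.
have [r Er'] := centre_lift hi cpr; rewrite {}Er in Er'.
have [b Eb'] := centre_lift hi cpb; rewrite {}Eb in Eb'.
clear sa cpa sl cpl sr cpr sb cpb.
pose a' : iso2 (mu ∘ (mu ⋊ ZA)) (mu ∘ (ZA ⋉ mu)) := a.
pose l' : iso2 (mu ∘ (eta ⋊ ZA)) (id1 ZA) := l.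
pose r' : iso2 (mu ∘ (ZA ⋉ eta)) (id1 ZA) := r.
pose b' : iso2 mu (mu ∘ br ZA ZA) := b.
exact: (@centre_braided _ _ _ _ _ hi mu F cpF eta G a' l' r' b' Ea' El' Er' Eb').
Qed.
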